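(* Let $m\in\mathbb{N}$, let $X$ be a Hausdorff space, $\gamma:X\times X\to(0,\infty)$ a continuous conditionally negative definite kernel and $A:X\times X\to\mathbb{C}$ a continuous kernel such that the kernel $C(u,v):=A(u,v)\gamma(u,v)^{m/2}$ on $X$ is positive definite. Define $G_{A,\gamma}:(X\times\mathbb{R}^{m})\times(X\times\mathbb{R}^{m})\to\mathbb{C}$ by $$G_{A,\gamma}((u,x),(v,y)):=A(u,v)\,e^{-\|x-y\|^{2}/\gamma(u,v)}.$$ Then $G_{A,\gamma}$ is positive definite and continuous. If moreover $\gamma$ is metrizable, then $G_{A,\gamma}$ is strictly positive definite (SPD) if and only if $A(u,u)>0$ for every $u\in X$; likewise, $G_{A,\gamma}$ is universal if and only if $A(u,u)>0$ for every $u\in X$.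
   Context: A kernel $\gamma:X\times X\to\mathbb{R}$ is conditionally negative definite if $\gamma(x,y)=\gamma(y,x)$ and $\sum_{\mu,\nu=1}^{n}c_{\mu}c_{\nu}\gamma(x_{\mu},x_{\nu})\le 0$ for all finitely many distinct points $x_{1},\dots,x_{n}$ and $c_{1},\dots,c_{n}\in\mathbb{R}$ with $\sum_{\mu}c_{\mu}=0$. Such a kernel is metrizable if $2\gamma(x,y)>\gamma(x,x)+\gamma(y,y)$ for all $x\neq y$ in $X$. A kernel $K:Y\times Y\to\mathbb{C}$ is positive definite if $\sum_{\mu,\nu=1}^{n}c_{\mu}\overline{c_{\nu}}K(x_{\mu},x_{\nu})\ge 0$ for all finitely many distinct points $x_{\mu}\in Y$ and scalars $c_{\mu}\in\mathbb{C}$, and strictly positive definite (SPD) if moreover the sum vanishes only when all $c_{\mu}=0$. Its reproducing kernel Hilbert space $\mathcal{H}_{K}$ is the Hilbert space of functions $F:Y\to\mathbb{C}$ that contains $K_{y}:=K(\cdot,y)$ for every $y\in Y$, satisfies $\langle F,K_{y}\rangle_{\mathcal{H}_{K}}=F(y)$, and in which $\mathrm{span}\{K_{y}:y\in Y\}$ is dense. A positive definite kernel $K$ on a Hausdorff space $Y$ is universal if $\mathcal{H}_{K}\subset C(Y)$ and for every compact $\mathcal{C}\subset Y$, continuous $g:\mathcal{C}\to\mathbb{C}$ and $\epsilon>0$ there is $f\in\mathcal{H}_{K}$ with $\sup_{x\in\mathcal{C}}|f(x)-g(x)|<\epsilon$. *)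

(* Defs.v *)
From HB Require Import structures.
From mathcomp Require Import all_boot all_order all_algebra.
From mathcomp Require Import complex.
From mathcomp Require Import all_classical all_reals all_analysis.

Set Implicit Arguments.
Unset Strict Implicit.
Unset Printing Implicit Defensive.

Import Order.TTheory GRing.Theory Num.Theory.
Import numFieldNormedType.Exports.

Local Open Scope classical_set_scope.
Local Open Scope ring_scope.
Local Open Scope complex_scope.

Section RealKernels.
Variables (R : realType) (X : Type).
Implicit Type gamma : X -> X -> R.

Definition cond_negative_definite gamma : Prop :=
  (forall x y, gamma x y = gamma y x) /\
  (forall (n : nat) (x : 'I_n -> X) (c : 'I_n -> R),
     injective x -> \sum_(mu < n) c mu = 0 ->
     \sum_(mu < n) \sum_(nu < n) c mu * c nu * gamma (x mu) (x nu) <= 0).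

Definition metrizable_kernel gamma : Prop :=
  forall x y, x <> y -> gamma x x + gamma y y < 2 * gamma x y.

End RealKernels.

Section ComplexKernels.
Variables (R : realType) (Y : Type).
Implicit Type K : Y -> Y -> R[i].

Definition kernel_form K (n : nat) (x : 'I_n -> Y) (c : 'I_n -> R[i]) : R[i] :=
  \sum_(mu < n) \sum_(nu < n) c mu * (c nu)^*%C * K (x mu) (x nu).

(* In the order of R[i], 0 <= z means that z is real and nonnegative. *)
Definition positive_definite K : Prop :=
  forall (n : nat) (x : 'I_n -> Y) (c : 'I_n -> R[i]),
    injective x -> 0 <= kernel_form K x c.

Definition strictly_positive_definite K : Prop :=
  positive_definite K /\
  (forall (n : nat) (x : 'I_n -> Y) (c : 'I_n -> R[i]),
     injective x -> kernel_form K x c = 0 -> forall mu, c mu = 0).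

End ComplexKernels.

Section RKHS.
Variables (R : realType) (Y : Type).
Implicit Types (F G : Y -> R[i]) (H : set (Y -> R[i]))
  (ip : (Y -> R[i]) -> (Y -> R[i]) -> R[i]).

Definition ip_norm ip F : R := Num.sqrt (complex.Re (ip F F)).

(* ip is a total function, but only its values on H are constrained. *)
Record hilbert_function_space H ip : Prop := HilbertFunctionSpace {
  hilb_zero : H (fun=> 0);
  hilb_lin : forall (a : R[i]) F G, H F -> H G ->
    H (fun y => a * F y + G y);
  hilb_ip_linear : forall (a : R[i]) F G L, H F -> H G -> H L ->
    ip (fun y => a * F y + G y) L = a * ip F L + ip G L;
  hilb_ip_hermitian : forall F G, H F -> H G -> ip F G = (ip G F)^*%C;
  hilb_ip_ge0 : forall F, H F -> 0 <= ip F F;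
  hilb_ip_definite : forall F, H F -> ip F F = 0 -> F = (fun=> 0);
  hilb_complete : forall Fs : nat -> Y -> R[i],
    (forall n, H (Fs n)) ->
    (forall e : R, 0 < e -> exists N : nat, forall j k : nat,
       (N <= j)%N -> (N <= k)%N -> ip_norm ip (Fs j \- Fs k) < e) ->
    exists2 F, H F & ip_norm ip (Fs n \- F) @[n --> \oo] --> (0 : R) }.

Record is_rkhs (K : Y -> Y -> R[i]) H ip : Prop := IsRKHS {
  rkhs_hilbert : hilbert_function_space H ip;
  rkhs_kernel : forall y, H (K^~ y);
  rkhs_reproducing : forall F y, H F -> ip F (K^~ y) = F y;
  rkhs_dense : forall F (e : R), H F -> 0 < e ->
    exists (n : nat) (y : 'I_n -> Y) (c : 'I_n -> R[i]),
      ip_norm ip (fun z => F z - \sum_(j < n) c j * K z (y j)) < e }.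

End RKHS.

(* R[i] carries its norm topology through the alias R[i]^o. A pair (H, ip)
   satisfying is_rkhs K is unique up to the values of ip outside H, so the
   existential quantifier denotes "the" reproducing kernel Hilbert space. The
   supremum is taken in \bar R, so that it is meaningful for empty C and for
   unbounded f - g; a continuous function on C is a function on Y whose
   restriction to the subspace C is continuous. *)
Definition universal_kernel (R : realType) (Y : topologicalType)
    (K : Y -> Y -> R[i]) : Prop :=
  positive_definite K /\
  exists (H : set (Y -> R[i])) (ip : (Y -> R[i]) -> (Y -> R[i]) -> R[i]),
    [/\ is_rkhs K H ip,
        (forall F, H F -> continuous (F : Y -> R[i]^o)) &
        (forall (C : set Y) (g : Y -> R[i]^o) (e : R),
           compact C -> {within C, continuous g} -> 0 < e ->
           exists2 f, H f &
             (ereal_sup [set (ComplexField.Normc.normc (f x - g x))%:E | x in C]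
                < e%:E)%E)].

Section GaussKernel.
Variables (R : realType) (X : Type) (m : nat).
Variables (A : X -> X -> R[i]) (gamma : X -> X -> R).

(* The library norm on row vectors is the sup norm. *)
Definition sqr_euclid_norm (x : 'rV[R]_m) : R := \sum_(i < m) x 0 i ^+ 2.

Definition scaled_kernel (u v : X) : R[i] :=
  A u v * (gamma u v `^ (m%:R / 2))%:C.

Definition gauss_kernel (p q : X * 'rV[R]_m) : R[i] :=
  A p.1 q.1 * (expR (- (sqr_euclid_norm (p.2 - q.2) / gamma p.1 q.1)))%:C.

End GaussKernel.

(* Main.v *)
(** Write [G] as [C(u,v)] times the product over the coordinates of
    [gamma^(-1/2) exp (- (x_i - y_i)^2 / gamma)]. By the Gaussian Fourier transform each factor is
    a mixture over frequencies [t] of [exp (i t (x_i - y_i)) exp (- t^2 gamma(u,v) / 4)], which is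
    positive definite by Schoenberg, and [G] is positive definite by Schur.

    Fix a compact set and a base point [w]. Averaging over short frequency intervals shows that the
    uniform closure of the Hilbert space of [G] contains the waves
    [C(u,v) * prod_i exp (i t_i x_i) exp (- t_i^2 gamma(u,w) / 4) * mono_i(u)], where the [mono_i]
    are monomials in the functions [kap(., z)], [kap] being the inner product of the Hilbert space
    embedding attached to [gamma]. The continuous real multipliers of the closed span of the waves
    form a closed algebra. It contains the [kap(., z)], which separate the points of [X] because
    [gamma] is metrizable, hence by Stone-Weierstrass all continuous functions of [u]; undoing the
    change of the factor [exp (- t_i^2 gamma(u,w) / 4)] then gives the frequency shifts
    [exp (i s x_i)], and the algebra separates the points of the compact set. If [A(u,u) > 0] the
    waves have no common zero, so their closed span is everything. This gives universality, and
    strict positive definiteness by density on finite sets. Conversely, if [A(u,u) = 0], every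
    function of the space vanishes at [(u,0)]. *)

Require Import Defs.
From HB Require Import structures.
From mathcomp Require Import all_boot all_order all_algebra.
From mathcomp Require Import complex.
From mathcomp Require Import all_classical all_reals all_analysis.
From mathcomp Require Import measurable_realfun lebesgue_integral_under.
From mathcomp Require Import ring lra.

Set Implicit Arguments.
Unset Strict Implicit.
Unset Printing Implicit Defensive.

Import Order.TTheory GRing.Theory Num.Theory.
Import numFieldNormedType.Exports.

Local Open Scope classical_set_scope.
Local Open Scope ring_scope.
Local Open Scope complex_scope.

(** The span of the waves need not be an algebra: a product of two waves carries the factor [C]
    twice. Hence the detour through multipliers. The monomials make the family of waves stable under
    multiplication by [kap(., z)]. They come from [exp (- t gamma(u,v)) = exp (t gamma(w,w)) exp (-
    t gamma(u,w)) exp (- t gamma(v,w)) exp (2 t kap(u,v))], where every term of the last exponential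
    series is positive definite. Some coordinate has to carry the monomial, so [m > 0] matters: for
    [m = 0] the kernel is [A], and [A = 1] is a counterexample once [X] has two points.

    Membership in a Hilbert space is expressed by an inequality between forms, tested on finite
    combinations. Such inequalities multiply by Schur's theorem, can be integrated over the
    frequency and pass to pointwise limits; the Hilbert space itself is built from them.

    The scaling [gamma^(m/2)] is dictated by the Fourier transform of [exp (- gamma t^2 / 4)], which
    is [sqrt (4 pi) gamma^(-1/2) exp (- s^2 / gamma)]: one factor [gamma^(-1/2)] per coordinate. *)

(* Coefficients attached to repeated points are added up. *)
Lemma merge_points (Y : Type) (A : pzRingType) (s : seq (Y * A)) :
  exists n (x : 'I_n -> Y) (c : 'I_n -> A), injective x /\
    forall f : Y -> A, \sum_i c i * f (x i) = \sum_(p <- s) p.2 * f p.1.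
Proof.
pose u : seq {classic Y} := undup (map (fun p : Y * A => p.1 : {classic Y}) s).
case: s @u => [u|p0 s'].
  exists 0%N, (fun i : 'I_0 => False_rect Y (notF (ltn_ord i))), (fun=> 0).
  by split=> [[]//|f]; rewrite big_ord0 big_nil.
move: (p0 :: s') => s u.
pose x (i : 'I_(size u)) : Y := nth p0.1 u i.
pose c (i : 'I_(size u)) : A := \sum_(p <- s | (p.1 : {classic Y}) == x i) p.2.
have xinj : injective x.
  move=> i j e; apply: val_inj; apply/eqP.
  rewrite -(@nth_uniq {classic Y} p0.1 u) ?undup_uniq ?ltn_ord//.
  exact/eqP.
exists (size u), x, c; split=> // f.
under eq_bigr do rewrite /c mulr_suml.
rewrite (exchange_big_dep predT)//=.
rewrite (@big_seq _ _ _ ({classic Y} * A)%type) [RHS](@big_seq _ _ _ ({classic Y} * A)%type).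
apply: eq_bigr => p ps.
have pu : (p.1 : {classic Y}) \in u by rewrite mem_undup (@map_f ({classic Y} * A)%type).
have iu : (index (p.1 : {classic Y}) u < size u)%N by rewrite index_mem.
have xi : x (Ordinal iu) = p.1 by rewrite /x/= (@nth_index {classic Y}).
rewrite (bigD1 (Ordinal iu)) ?xi//= big1 ?addr0// => j /andP[/eqP pj].
by case/eqP; apply: xinj; rewrite xi.
Qed.

(** * Sesquilinear forms of kernels, Cauchy-Schwarz and Schur's product theorem *)

Section Forms.
Variables (R : realType) (Y : Type).
Implicit Types (F G : Y -> R[i]) (K L : Y -> Y -> R[i]) (s t : seq (Y * R[i])).

(* A sequence [s] of pairs (point, coefficient), points possibly repeated, stands for a finite
   combination of evaluations. *)
Definition ev F s : R[i] := \sum_(p <- s) p.2 * F p.1.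

Definition sform K s t : R[i] :=
  \sum_(p <- s) \sum_(q <- t) p.2 * (q.2)^*%C * K p.1 q.1.

Definition coef_scale (a : R[i]) s := [seq (p.1, a * p.2) | p <- s].

Definition pdk K := forall s, 0 <= sform K s s.

Lemma ev_cat F s t : ev F (s ++ t) = ev F s + ev F t.
Proof. exact: big_cat. Qed.

Lemma ev_coef_scale a F s : ev F (coef_scale a s) = a * ev F s.
Proof. by rewrite /ev big_map mulr_sumr; apply: eq_bigr => p _; rewrite mulrA. Qed.

Lemma ev_lin a F G s : ev (fun y => a * F y + G y) s = a * ev F s + ev G s.
Proof.
rewrite /ev mulr_sumr -big_split/=.
by apply: eq_bigr => p _; ring.
Qed.

Lemma evB F G s : ev (fun y => F y - G y) s = ev F s - ev G s.
Proof. by rewrite /ev -sumrB; apply: eq_bigr => p _; rewrite mulrBr. Qed.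

Lemma sform_catl K s1 s2 t : sform K (s1 ++ s2) t = sform K s1 t + sform K s2 t.
Proof. exact: big_cat. Qed.

Lemma sform_catr K s t1 t2 : sform K s (t1 ++ t2) = sform K s t1 + sform K s t2.
Proof. by rewrite /sform -big_split/=; apply: eq_bigr => p _; rewrite big_cat. Qed.

Lemma sform_coef_scalel a K s t : sform K (coef_scale a s) t = a * sform K s t.
Proof.
rewrite /sform big_map mulr_sumr; apply: eq_bigr => p _.
by rewrite mulr_sumr; apply: eq_bigr => q _; rewrite !mulrA.
Qed.

Lemma sform_coef_scaler a K s t : sform K s (coef_scale a t) = a^*%C * sform K s t.
Proof.
rewrite /sform mulr_sumr; apply: eq_bigr => p _.
rewrite big_map mulr_sumr; apply: eq_bigr => q _ /=.
by rewrite rmorphM/=; ring.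
Qed.

Lemma sformDZ K s t c : sform K (s ++ coef_scale c t) (s ++ coef_scale c t) =
  sform K s s + c^*%C * sform K s t + c * sform K t s + c * c^*%C * sform K t t.
Proof. rewrite sform_catl !sform_catr !sform_coef_scalel !sform_coef_scaler; ring. Qed.

Lemma sform_lin a K L s t :
  sform (fun x y => a * K x y + L x y) s t = a * sform K s t + sform L s t.
Proof.
rewrite /sform mulr_sumr -big_split/=; apply: eq_bigr => p _.
rewrite mulr_sumr -big_split/=; apply: eq_bigr => q _; ring.
Qed.

Lemma sform_rank1 F s : sform (fun x y => F x * (F y)^*%C) s s = ev F s * (ev F s)^*%C.
Proof.
rewrite /ev rmorph_sum mulr_suml; apply: eq_bigr => p _.
rewrite mulr_sumr; apply: eq_bigr => q _ /=; rewrite rmorphM/=; ring.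
Qed.

Lemma sform_mulrank1 K F s :
  sform (fun x y => F x * (F y)^*%C * K x y) s s =
  sform K [seq (p.1, F p.1 * p.2) | p <- s] [seq (p.1, F p.1 * p.2) | p <- s].
Proof.
rewrite /sform big_map; apply: eq_bigr => p _.
rewrite big_map; apply: eq_bigr => q _ /=; rewrite rmorphM/=; ring.
Qed.

Lemma sform1 K x y a b : sform K [:: (x, a)] [:: (y, b)] = a * b^*%C * K x y.
Proof. by rewrite /sform !big_seq1. Qed.

Lemma sform_point K s y : sform K s [:: (y, 1)] = ev (K^~ y) s.
Proof.
rewrite /sform /ev; apply: eq_bigr => p _.
by rewrite big_seq1 conjc1 mulr1.
Qed.

Lemma conj_of_ge0 (z : R[i]) : 0 <= z -> z^*%C = z.
Proof. by case: z => a b; rewrite lecE/= => /andP[/eqP -> _]; rewrite oppr0. Qed.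

(** Polarisation. Since [0 <= z] entails that [z] is real, the form is real at [s + t] and at
    [s + j t] with [j] the imaginary unit; the two equations together give the claim. *)
Lemma pdk_herm K s t : pdk K -> sform K t s = (sform K s t)^*%C.
Proof.
move=> pK.
have [j jJ j0] : exists2 j : R[i], j^*%C = - j & j != 0.
  exists 'i%C; last by rewrite eq_complex/= negb_and oner_eq0 orbT.
  by apply/eqP; rewrite eq_complex/= oppr0 !eqxx.
have hs := conj_of_ge0 (pK s); have ht := conj_of_ge0 (pK t).
have := conj_of_ge0 (pK (s ++ coef_scale 1 t)).
have := conj_of_ge0 (pK (s ++ coef_scale j t)).
rewrite !sformDZ conjc1 jJ.
rewrite !(rmorphD, rmorphM, rmorphN, rmorph1)/= jJ hs ht.
set a := sform K s t; set b := sform K t s => e1 e2.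
have {}e2 : a^*%C + b^*%C = a + b.
  apply: (addrI (sform K s s)); apply: (addIr (sform K t t)).
  by move: e2; rewrite !mul1r !addrA.
have {}e1 : a^*%C - b^*%C = b - a.
  apply: (mulfI j0); apply: (addrI (sform K s s)).
  apply: (addIr (j * - j * sform K t t)).
  transitivity (sform K s s + - - j * a^*%C + - j * b^*%C + - j * - - j * sform K t t); first by ring.
  by rewrite e1; ring.
apply: (@mulfI _ 2%:R); first by rewrite pnatr_eq0.
by transitivity ((a + b) + (b - a)); [ring|rewrite -e1 -e2; ring].
Qed.

Lemma pdk_sym K x y : pdk K -> K y x = (K x y)^*%C.
Proof.
by move=> /(@pdk_herm _ [:: (x, 1)] [:: (y, 1)]); rewrite !sform1 conjc1 !mul1r.
Qed.

Lemma pdk_diag K x : pdk K -> 0 <= K x x.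
Proof. by move=> /(_ [:: (x, 1)]); rewrite sform1 conjc1 !mul1r. Qed.

(* The discriminant inequality; for [d = 0] it forces [a = 0]. *)
Lemma quadratic_bound (N a d : R[i]) : 0 <= N -> 0 <= d ->
  (forall c, 0 <= N + c^*%C * a + c * a^*%C + c * c^*%C * d) -> a * a^*%C <= d * N.
Proof.
move=> N0 d0 h.
have b0 : 0 <= a * a^*%C by exact: mulcJ_ge0.
(* [c] is restricted to [- t a] with [t] real, which leaves a real quadratic in [t]. Its minimum is
   at [1 / d]; for [d = 0] a large [t] makes it negative unless [a = 0]. *)
have h' (t : R) : 0 <= N - (2 * t)%:C * (a * a^*%C) + (t ^+ 2)%:C * (a * a^*%C) * d.
  have e : ((- t)%:C * a)^*%C = (- t)%:C * a^*%C.
    by rewrite rmorphM; congr (_ * _); exact: conjc_real.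
  have := h ((- t)%:C * a); rewrite e; congr (0 <= _).
  have -> : (2 * t)%:C = 2 * t%:C by rewrite rmorphM rmorph_nat.
  have -> : (t ^+ 2)%:C = t%:C * t%:C by rewrite expr2 rmorphM.
  by rewrite rmorphN; ring.
move: N0 d0 b0 h'.
move: (a * a^*%C) => b; case: N h => N0 N1 h; case: d h => d0 d1 h; case: b => b0 b1.
rewrite !lecE/= => /andP[/eqP-> N0ge] /andP[/eqP-> d0ge] /andP[/eqP-> b0ge] h'.
rewrite !mulr0 !mul0r subr0 addr0 eqxx/=.
have {}h' (t : R) : 0 <= N0 - 2 * t * b0 + t ^+ 2 * b0 * d0.
  by have := h' t; rewrite lecE/= => /andP[_]; rewrite ?(mulr0, mul0r, subr0).
move: d0ge; rewrite le0r => /orP[/eqP dE|dgt].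
  rewrite dE mul0r; have [//|bgt] := leP b0 0.
  have := h' ((N0 + 1) / (2 * b0)); rewrite dE mulr0 addr0.
  have -> : N0 - 2 * ((N0 + 1) / (2 * b0)) * b0 = -1 by field; rewrite gt_eqF.
  by rewrite ler0N1.
have := h' d0^-1.
have -> : N0 - 2 * d0^-1 * b0 + d0^-1 ^+ 2 * b0 * d0 = (d0 * N0 - b0) / d0.
  by field; rewrite gt_eqF.
by rewrite pmulr_lge0 ?invr_gt0// subr_ge0.
Qed.

Lemma sform_CS K s t : pdk K ->
  sform K s t * (sform K s t)^*%C <= sform K t t * sform K s s.
Proof.
move=> pK; apply: quadratic_bound => // c.
by rewrite -(pdk_herm _ _ pK) -sformDZ.
Qed.

Lemma pdk_CS K s v : pdk K ->
  ev (K^~ v) s * (ev (K^~ v) s)^*%C <= K v v * sform K s s.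
Proof.
by move=> pK; rewrite -sform_point (le_trans (sform_CS _ _ pK))// sform1 conjc1 !mul1r.
Qed.

Lemma pdk_diag0 K v x : pdk K -> K v v = 0 -> K x v = 0.
Proof.
move=> pK Kv; have := pdk_CS [:: (x, 1)] v pK.
rewrite Kv mul0r /ev big_seq1 mul1r /= -sqr_normc => h.
have /eqP : `|K x v| ^+ 2 = 0.
  by apply/le_anti; rewrite h/= exprn_ge0.
by rewrite sqrf_eq0 normr_eq0 => /eqP.
Qed.

Lemma sform_cons0 K v c s : (forall x, K v x = 0) -> (forall x, K x v = 0) ->
  sform K ((v, c) :: s) ((v, c) :: s) = sform K s s.
Proof.
move=> Kv0 K0v; rewrite -cat1s sform_catl !sform_catr.
rewrite [X in X + _](_ : _ = 0) ?add0r; last first.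
  by rewrite /sform !big_seq1 Kv0 mulr0 add0r big1// => p _; rewrite Kv0 mulr0.
by rewrite [X in X + _](_ : _ = 0) ?add0r// /sform big1// => p _; rewrite big_seq1 K0v mulr0.
Qed.

(* Induction on the number of points: subtracting the rank one kernel
   [K x v * K v y / K v v] from [K] removes the point [v]. *)
Lemma pdkM K L : pdk K -> pdk L -> pdk (fun x y => K x y * L x y).
Proof.
move=> pK pL s; have [n] := ubnP (size s).
elim: n s K pK => // n IH [|[v c] s] K pK /= sn; first by rewrite /sform big_nil.
(* For [K v v = 0] the convention [0^-1 = 0] gives [K' = K], whose row and column at [v] already
   vanish by Cauchy-Schwarz. *)
pose d := (K v v)^-1.
have d0 : 0 <= d by rewrite invr_ge0 pdk_diag.
pose r x y := K x v * (K y v)^*%C.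
pose K' x y := - d * r x y + K x y.
have pK' : pdk K'.
  move=> t; rewrite sform_lin sform_rank1 mulNr addrC subr_ge0.
  have := pdk_CS t v pK; rewrite /d.
  have := pdk_diag v pK; rewrite le0r => /orP[/eqP->|Kv0 h]; first by rewrite invr0 !mul0r.
  by rewrite ler_pdivrMl.
have K'0 x : K' v x = 0.
  rewrite /K' /r -(pdk_sym _ _ pK) /d.
  have [Kv|Kv] := eqVneq (K v v) 0; last by field.
  by rewrite (pdk_sym x v pK) (pdk_diag0 x pK Kv) conjc0 !mulr0 addr0.
have K0' x : K' x v = 0 by rewrite (pdk_sym v x pK') K'0 conjc0.
rewrite (_ : (fun _ _ => _) = (fun x y => d * (r x y * L x y) + K' x y * L x y)); last first.
  by apply/funext => x; apply/funext => y; rewrite /K'; ring.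
rewrite sform_lin addr_ge0//.
  by rewrite mulr_ge0//= (@sform_mulrank1 L (K^~ v)) pL.
rewrite (@sform_cons0 (fun x y => K' x y * L x y)) => [|x|x]; last 2 first.
- by rewrite K'0 mul0r.
- by rewrite K0' mul0r.
exact: IH.
Qed.

Lemma pdkD K L : pdk K -> pdk L -> pdk (fun x y => K x y + L x y).
Proof.
move=> pK pL s; have := @sform_lin 1 K L s s; rewrite mul1r => h.
rewrite (_ : sform _ _ _ = sform K s s + sform L s s) ?addr_ge0// -h.
by congr (sform _ _ _); apply/funext => x; apply/funext => y; rewrite mul1r.
Qed.

Lemma pdk1 : pdk (fun _ _ => 1).
Proof.
move=> s; have := sform_rank1 (fun=> 1) s; rewrite conjc1 mulr1 => ->.
exact: mulcJ_ge0.
Qed.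

Lemma pdk_prod (I : Type) (r : seq I) (K_ : I -> Y -> Y -> R[i]) :
  (forall i, pdk (K_ i)) -> pdk (fun x y => \prod_(i <- r) K_ i x y).
Proof.
move=> pK; elim: r => [|i r IH].
  by under eq_fun do under eq_fun do rewrite big_nil; exact: pdk1.
by under eq_fun do under eq_fun do rewrite big_cons; exact: pdkM.
Qed.

Lemma kernel_formE K n (x : 'I_n -> Y) (c : 'I_n -> R[i]) (s := [seq (x i, c i) | i <- enum 'I_n]) :
  kernel_form K x c = sform K s s.
Proof.
rewrite /kernel_form /sform /s big_map big_enum/=; apply: eq_bigr => i _.
by rewrite big_map big_enum/=.
Qed.

(** [pdk] allows repeated points, which concatenation of combinations produces; merging them yields
    distinct points. The inner sum carries conjugated coefficients, so [key] is used there under a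
    conjugation. *)
Lemma pdkP K : positive_definite K <-> pdk K.
Proof.
split=> [pK s|pK n x c _]; last by rewrite kernel_formE.
have [n [x [c [xinj key]]]] := merge_points s.
rewrite (_ : sform K s s = kernel_form K x c); first exact: pK.
rewrite /kernel_form /sform.
under eq_bigr => p _ do under eq_bigr => q _ do rewrite -mulrA.
under eq_bigr => p _ do rewrite -mulr_sumr.
rewrite -(key (fun z => \sum_(q <- s) (q.2)^*%C * K z q.1)).
apply: eq_bigr => i _; under [RHS]eq_bigr => j _ do rewrite -mulrA.
rewrite -[RHS]mulr_sumr; congr (_ * _).
have := congr1 conjc (key (fun z => (K (x i) z)^*%C)).
rewrite !rmorph_sum/= => e.
under eq_bigr => q _ do rewrite -[K _ _]conjcK -rmorphM.
by rewrite -e; apply: eq_bigr => j _; rewrite rmorphM/= conjcK.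
Qed.

End Forms.

(** * Squared moduli, and limits obtained from intersecting intervals *)

Section SquaredModulus.
Variable R : realType.
Implicit Types z w : R[i].

Lemma real_complexM (a b : R) : (a * b)%:C = a%:C * b%:C.
Proof. exact: rmorphM. Qed.

Lemma real_complexD (a b : R) : (a + b)%:C = a%:C + b%:C.
Proof. exact: rmorphD. Qed.

Lemma real_complexB (a b : R) : (a - b)%:C = a%:C - b%:C.
Proof. exact: rmorphB. Qed.

(* The squared modulus, which avoids the [R[i]]-valued norm. *)
Definition sqc z : R := complex.Re z ^+ 2 + complex.Im z ^+ 2.

Lemma sqcE z : (sqc z)%:C = z * z^*%C.
Proof. by rewrite -sqr_normc -add_Re2_Im2. Qed.

Lemma sqc_ge0 z : 0 <= sqc z. Proof. by rewrite addr_ge0// sqr_ge0. Qed.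

Lemma sqcM z w : sqc (z * w) = sqc z * sqc w.
Proof. by case: z => a b; case: w => c d; rewrite /sqc/=; ring. Qed.

Lemma sqcN z : sqc (- z) = sqc z.
Proof. by case: z => a b; rewrite /sqc/=; ring. Qed.

Lemma sqcJ z : sqc (z^*%C) = sqc z.
Proof. by case: z => a b; rewrite /sqc/=; ring. Qed.

Lemma sqcD z w : sqc (z + w) <= 2 * sqc z + 2 * sqc w.
Proof.
case: z => a b; case: w => c d; rewrite /sqc/=.
have := sqr_ge0 (a - c); have := sqr_ge0 (b - d); nra.
Qed.

Lemma sqcB z w : sqc (z - w) <= 2 * sqc z + 2 * sqc w.
Proof. by rewrite (le_trans (sqcD _ _))// sqcN. Qed.

(** The gap is a sum of squares divided by [d]. Unlike in [sqcD], the first factor tends to 1 with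
    [d], so exact norm constants survive the limit. *)
Lemma sqcD_eps (d : R) z w : 0 < d ->
  sqc (z + w) <= (1 + d) * sqc z + (1 + d^-1) * sqc w.
Proof.
case: z => a b; case: w => c e d0; rewrite /sqc/= -subr_ge0.
have -> : (1 + d) * (a ^+ 2 + b ^+ 2) + (1 + d^-1) * (c ^+ 2 + e ^+ 2) -
    ((a + c) ^+ 2 + (b + e) ^+ 2) = ((d * a - c) ^+ 2 + (d * b - e) ^+ 2) / d.
  by field; rewrite gt_eqF.
by rewrite divr_ge0 ?(ltW d0) ?addr_ge0 ?sqr_ge0.
Qed.

Lemma Re_le_sqc z : complex.Re z ^+ 2 <= sqc z.
Proof. by rewrite lerDl sqr_ge0. Qed.

Lemma Im_le_sqc z : complex.Im z ^+ 2 <= sqc z.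
Proof. by rewrite lerDr sqr_ge0. Qed.

Lemma sqc_eq0 z : sqc z <= 0 -> z = 0.
Proof.
case: z => a b; rewrite /sqc/= => h.
have a0 : a ^+ 2 = 0 by apply/eqP; rewrite eq_le sqr_ge0 andbT; have := sqr_ge0 b; lra.
have b0 : b ^+ 2 = 0 by move: h; rewrite a0 add0r => h; apply/eqP; rewrite eq_le sqr_ge0 h.
by move/eqP: a0; move/eqP: b0; rewrite !sqrf_eq0 => /eqP-> /eqP->.
Qed.

Lemma sqc_eq0_le (z : R[i]) (c : R) : (forall e : R, 0 < e -> e <= 1 -> sqc z <= c * e) -> z = 0.
Proof.
move=> h; apply: sqc_eq0; rewrite leNgt; apply/negP => z0.
have c0 : 0 <= c by have := h 1 ltr01 (lexx _); rewrite mulr1; exact/le_trans/sqc_ge0.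
pose e := Num.min 1 (sqc z / (2 * (c + 1))).
have c1 : 0 < 2 * (c + 1) by rewrite mulr_gt0// ltr_wpDl.
have e0 : 0 < e by rewrite /e lt_min ltr01 divr_gt0.
have e1 : e <= 1 by rewrite /e ge_min lexx.
have ez : e * (2 * (c + 1)) <= sqc z by rewrite -ler_pdivlMr// /e ge_min lexx orbT.
have := h e e0 e1; nra.
Qed.

Lemma le_of_eps (a b c : R) : (forall e : R, 0 < e -> e <= 1 -> a <= b + c * e) -> a <= b.
Proof.
move=> h; rewrite leNgt; apply/negP => ba.
pose d := a - b; have d0 : 0 < d by rewrite subr_gt0.
have c1 : 0 < `|c| + 1 by rewrite ltr_wpDl.
pose e := Num.min 1 (d / (2 * (`|c| + 1))).
have e0 : 0 < e by rewrite /e lt_min ltr01 divr_gt0// mulr_gt0.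
have e1 : e <= 1 by rewrite /e ge_min lexx.
have ez : e * (2 * (`|c| + 1)) <= d.
  by rewrite -ler_pdivlMr ?mulr_gt0// /e ge_min lexx orbT.
have := h e e0 e1; have := ler_norm c; rewrite /d in ez *.
move=> h1 h2; have : c * e <= `|c| * e by rewrite ler_pM2r.
nra.
Qed.

Lemma sqr_le_of_norm (x r : R) : `|x| <= r -> x ^+ 2 <= r ^+ 2.
Proof.
move=> h; rewrite -real_normK ?num_real// ler_sqr ?nnegrE//.
exact: le_trans h.
Qed.

Lemma norm_le_of_sqr (x r : R) : 0 <= r -> x ^+ 2 <= r ^+ 2 -> `|x| <= r.
Proof.
by move=> r0 h; rewrite -ler_sqr ?nnegrE// real_normK ?num_real.
Qed.

(** Helly's theorem on the line: the supremum of the left ends lies in every interval. It yields a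
    limit together with explicit error bounds. *)
Lemma intervals_meet (T : Type) (P : set T) (v r : T -> R) : P !=set0 ->
  (forall x y, P x -> P y -> v x - r x <= v y + r y) ->
  exists l, forall x, P x -> `|v x - l| <= r x.
Proof.
move=> [x0 Px0] h; pose E := [set v x - r x | x in P].
have E0 : E !=set0 by exists (v x0 - r x0); exists x0.
have ubE y : P y -> ubound E (v y + r y) by move=> Py _ [x Px <-]; exact: h.
have hE : has_sup E by split => //; exists (v x0 + r x0); exact: ubE.
exists (sup E) => x Px; rewrite ler_distl.
have h1 : v x - r x <= sup E by apply: ub_le_sup; [exact: hE.2|exists x].
have h2 : sup E <= v x + r x by apply: ge_sup => //; exact: ubE.
by apply/andP; split; lra.
Qed.

Lemma cauchy_seq_limit (u : nat -> R[i]) :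
  (forall e : R, 0 < e -> exists N : nat, forall j k : nat,
     (N <= j)%N -> (N <= k)%N -> sqc (u j - u k) <= e) ->
  exists l, forall e : R, 0 < e -> exists N : nat, forall j : nat,
    (N <= j)%N -> sqc (u j - l) <= e.
Proof.
move=> h.
have part (f : R[i] -> R) : (forall z w, f (z - w) = f z - f w) ->
    (forall z, f z ^+ 2 <= sqc z) ->
    exists l, forall j (r : R), (forall k, (j <= k)%N -> `|f (u j) - f (u k)| <= r) ->
      `|f (u j) - l| <= r.
  move=> fB fs.
  (* [P] collects the intervals around some [f (u j)] that contain the whole tail from [j] on; a
     common point of them is the limit. *)
  pose P := [set jr : nat * R | forall k, (jr.1 <= k)%N -> `|f (u jr.1) - f (u k)| <= jr.2].
  have [||l hl] := @intervals_meet _ P (fun jr => f (u jr.1)) snd.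
  - have [N hN] := h 1 ltr01; exists (N, 1) => k /= Nk.
    apply: norm_le_of_sqr => //; rewrite -fB (le_trans (fs _))// expr1n.
    exact: hN.
  - move=> [j r] [k s] Pj Pk /=.
    have := Pj (maxn j k) (leq_maxl _ _); have := Pk (maxn j k) (leq_maxr _ _).
    by rewrite /= !ler_distl => /andP[a1 a2] /andP[b1 b2]; lra.
  by exists l => j r hj; exact: (hl (j, r)).
have [] := part (@complex.Re R); [by case=> ? ? []|exact: Re_le_sqc|].
move=> l1 hl1.
have [] := part (@complex.Im R); [by case=> ? ? []|exact: Im_le_sqc|].
move=> l2 hl2; exists (l1 +i* l2) => e e0.
have e20 : 0 < e / 2 by rewrite divr_gt0.
have [N hN] := h _ e20; exists N => j Nj.
have r0 := ltW e20.
have h1 : `|complex.Re (u j) - l1| <= Num.sqrt (e / 2).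
  apply: hl1 => k jk; apply: norm_le_of_sqr; rewrite ?sqrtr_ge0// sqr_sqrtr//.
  have -> : complex.Re (u j) - complex.Re (u k) = complex.Re (u j - u k).
    by case: (u j) => ? ?; case: (u k).
  exact: le_trans (Re_le_sqc _) (hN j k Nj (leq_trans Nj jk)).
have h2 : `|complex.Im (u j) - l2| <= Num.sqrt (e / 2).
  apply: hl2 => k jk; apply: norm_le_of_sqr; rewrite ?sqrtr_ge0// sqr_sqrtr//.
  have -> : complex.Im (u j) - complex.Im (u k) = complex.Im (u j - u k).
    by case: (u j) => ? ?; case: (u k).
  exact: le_trans (Im_le_sqc _) (hN j k Nj (leq_trans Nj jk)).
move: (sqr_le_of_norm h1) (sqr_le_of_norm h2); rewrite !sqr_sqrtr//.
by case: (u j) => a b; rewrite /sqc/=; lra.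
Qed.

End SquaredModulus.

(** * Domination of a function by a kernel *)

Section Domination.
Variables (R : realType) (Y : Type).
Implicit Types (F G : Y -> R[i]) (K L : Y -> Y -> R[i]) (s t : seq (Y * R[i])).

Definition qn K s : R := complex.Re (sform K s s).

Lemma qnE K s : pdk K -> (qn K s)%:C = sform K s s.
Proof. by move=> /(_ s); rewrite /qn; case: sform => a b; rewrite lecE/= => /andP[/eqP->]. Qed.

Lemma qn_ge0 K s : pdk K -> 0 <= qn K s.
Proof. by move=> pK; rewrite -ler0c qnE. Qed.

(* [F] belongs to the reproducing kernel Hilbert space of [K], with squared norm
   at most [M]. *)
Definition dom K (M : R) F := forall s, sqc (ev F s) <= M * qn K s.

(** Turns domination into positivity of a kernel, the form in which Schur's theorem applies to
    it. *)
Lemma domE K M F : pdk K ->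
  dom K M F <-> pdk (fun x y => M%:C * K x y + - (F x * (F y)^*%C)).
Proof.
move=> pK.
have e s : sform (fun x y => M%:C * K x y + - (F x * (F y)^*%C)) s s =
    (M * qn K s - sqc (ev F s))%:C.
  rewrite sform_lin -[X in _ + X]opprK -[X in _ - X]mulN1r -[X in _ - X]addr0.
  have -> : (0 : R[i]) = sform (fun _ _ => 0) s s.
    by rewrite /sform big1// => p _; rewrite big1// => q _; rewrite mulr0.
  rewrite -sform_lin.
  have -> : sform (fun x y => -1 * - (F x * (F y)^*%C) + 0) s s =
      sform (fun x y => F x * (F y)^*%C) s s.
    by congr (sform _ _ _); apply/funext => x; apply/funext => y; rewrite mulN1r opprK addr0.
  by rewrite sform_rank1 -sqcE -(qnE _ pK) rmorphB rmorphM.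
by split=> h s; have := h s; rewrite e ler0c subr_ge0.
Qed.

Lemma dom_weak K M N F : pdk K -> M <= N -> dom K M F -> dom K N F.
Proof. by move=> pK MN dF s; rewrite (le_trans (dF s))// ler_wpM2r// qn_ge0. Qed.

Lemma dom_lin K M N a F G : pdk K -> dom K M F -> dom K N G ->
  dom K (2 * sqc a * M + 2 * N) (fun y => a * F y + G y).
Proof.
move=> pK dF dG s; rewrite ev_lin (le_trans (sqcD _ _))// sqcM.
have := ler_wpM2l (sqc_ge0 a) (dF s); have := dG s; nra.
Qed.

Lemma domB K M N F G : pdk K -> dom K M F -> dom K N G ->
  dom K (2 * M + 2 * N) (fun y => F y - G y).
Proof.
move=> pK dF dG s; rewrite evB (le_trans (sqcB _ _))//.
by have := dF s; have := dG s; nra.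
Qed.

Lemma domN K M F : dom K M F -> dom K M (fun y => - F y).
Proof.
move=> dF s; rewrite (_ : ev _ s = - ev F s) ?sqcN//.
by rewrite /ev -sumrN; apply: eq_bigr => p _; rewrite mulrN.
Qed.

Lemma dom_kernel K v : pdk K -> dom K (complex.Re (K v v)) (K^~ v).
Proof.
move=> pK s; rewrite -lecR sqcE real_complexM qnE//.
apply: le_trans (pdk_CS _ _ pK) _; apply: ler_wpM2r => //.
by have := pdk_diag v pK; case: (K v v) => a b; rewrite !lecE/= => /andP[/eqP-> _]; rewrite eqxx lexx.
Qed.

Lemma dom_eval K M F y : dom K M F -> sqc (F y) <= M * complex.Re (K y y).
Proof.
by move=> /(_ [:: (y, 1)]); rewrite /qn sform1 conjc1 /ev big_seq1 !mul1r.
Qed.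

(** With [f] and [g] for the rank one kernels of [F] and [G],
    [MK NL - f g = (MK - f) NL + f (NL - g)], and both products are positive definite by Schur. *)
Lemma domM K L M N F G : pdk K -> pdk L -> 0 <= M -> 0 <= N ->
  dom K M F -> dom L N G ->
  dom (fun x y => K x y * L x y) (M * N) (fun y => F y * G y).
Proof.
move=> pK pL M0 N0 /(domE _ _ pK) dF /(domE _ _ pL) dG.
apply/domE; first exact: pdkM.
have pNL : pdk (fun x y => N%:C * L x y).
  by move=> s; rewrite -(addr0 (sform _ _ _)); have := @sform_lin _ _ N%:C L (fun _ _ => 0) s s;
     under eq_fun do under eq_fun do rewrite addr0; move=> ->;
     rewrite addr0 addr_ge0 ?mulr_ge0 ?ler0c//;
     rewrite /sform big1// => p _; rewrite big1// => q _; rewrite mulr0.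
have pF : pdk (fun x y => F x * (F y)^*%C) by move=> s; rewrite sform_rank1 mulcJ_ge0.
have := pdkD (pdkM dF pNL) (pdkM pF dG).
congr pdk; apply/funext => x; apply/funext => y.
by rewrite rmorphM rmorphM; ring.
Qed.

Lemma ev0 s : ev (fun=> 0 : R[i]) s = 0 :> R[i].
Proof. by rewrite /ev big1// => p _; rewrite mulr0. Qed.

(** The conjugates turn [ev (comb K t) s] into [sform K s t], so [comb K t] stands for a vector of
    squared norm [qn K t]. *)
Definition comb K t := fun z => \sum_(q <- t) (q.2)^*%C * K z q.1.

Lemma ev_comb K s t : ev (comb K t) s = sform K s t.
Proof.
rewrite /ev /sform; apply: eq_bigr => p _; rewrite mulr_sumr.
by apply: eq_bigr => q _; rewrite mulrA.
Qed.

Lemma ev_combB K F s t : ev (fun y => F y - comb K t y) s = ev F s - sform K s t.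
Proof. by rewrite evB ev_comb. Qed.

(* A near minimiser of the distance functional [t |-> |comb K t|^2 - 2 Re <F, comb K t>]. *)
Lemma dom_approx K M F e : pdk K -> 0 <= M -> dom K M F -> 0 < e ->
  exists t, dom K e (fun y => F y - comb K t y).
Proof.
move=> pK M0 dF e0.
pose q t := qn K t - 2 * complex.Re (ev F t).
have qE t : (q t)%:C = sform K t t - ev F t - (ev F t)^*%C.
  by rewrite /q real_complexB real_complexM rmorph_nat qnE// -addcJ; ring.
have qlb t : - M <= q t.
  have := dF t; rewrite /q /sqc; set x := complex.Re _; set y := complex.Im _.
  have := qn_ge0 t pK; move: (qn K t) => N N0 h.
  have : `|2 * x| <= M + N.
    rewrite -[leRHS]ger0_norm ?addr_ge0// -ler_sqr ?nnegrE// -!normrX !ger0_norm ?sqr_ge0//.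
    have := sqr_ge0 (M - N); have := sqr_ge0 y; nra.
  by move/(le_trans (ler_norm _)); lra.
pose E := [set q t | t in [set: seq (Y * R[i])]].
have hE : has_inf E.
  by split; [exists (q [::]); exists [::]|exists (- M) => _ [t _ <-]].
have [_ [t _ <-] qt] := inf_adherent e0 hE.
exists t => s; rewrite ev_combB.
(* Moving [t] by [c s] changes [q] by a quadratic in [c] with linear coefficient [a], and cannot
   lower it by more than [e]. [quadratic_bound] then bounds [a], which up to sign is the conjugate
   of the error. *)
pose a := sform K t s - (ev F s)^*%C.
have aJ : a^*%C = sform K s t - ev F s.
  by rewrite /a rmorphB/= conjcK -(pdk_herm _ _ pK).
rewrite -lecR -opprB sqcN -aJ sqcJ sqcE real_complexM qnE// [leRHS]mulrC.
apply: quadratic_bound => // [|c]; first by rewrite ler0c ltW.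
have -> : e%:C + c^*%C * a + c * a^*%C + c * c^*%C * sform K s s =
    (e + q (t ++ coef_scale c s) - q t)%:C.
  have eJ : (ev F t + c * ev F s)^*%C = (ev F t)^*%C + c^*%C * (ev F s)^*%C.
    by rewrite rmorphD rmorphM.
  rewrite real_complexB real_complexD !qE sformDZ ev_cat ev_coef_scale eJ aJ /a.
  by ring.
rewrite ler0c; have : inf E <= q (t ++ coef_scale c s).
  by apply: ge_inf; [exact: hE.2|exists (t ++ coef_scale c s)].
by move: qt; lra.
Qed.

(** Tested on [w] itself, the domination reads [qn w ^ 2 <= d qn w]. *)
Lemma qn_le_dom K d w : pdk K -> 0 <= d -> dom K d (comb K w) -> qn K w <= d.
Proof.
move=> pK d0 /(_ w); rewrite ev_comb; have := qn_ge0 w pK.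
have -> : sqc (sform K w w) = qn K w ^+ 2.
  by rewrite -(qnE _ pK) /sqc/= expr0n/= addr0.
rewrite le0r => /orP[/eqP-> //|h]; by rewrite expr2 ler_pM2r.
Qed.

Lemma sqc_ev_le K M d F w : pdk K -> 0 <= M -> 0 <= d -> dom K M F ->
  dom K d (comb K w) -> sqc (ev F w) <= M * d.
Proof.
by move=> pK M0 d0 dF dw; rewrite (le_trans (dF w))// ler_wpM2l// qn_le_dom.
Qed.

Lemma comb_cat K s t : comb K (s ++ t) = fun y => comb K s y + comb K t y.
Proof. by apply/funext => y; rewrite /comb big_cat. Qed.

Lemma combN K t : comb K (coef_scale (-1) t) = fun y => - comb K t y.
Proof.
apply/funext => y; rewrite /comb big_map -sumrN; apply: eq_bigr => q _ /=.
by rewrite rmorphM rmorphN rmorph1; ring.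
Qed.

End Domination.

(** * The space of a positive definite kernel *)

Section MooreAronszajn.
Variables (R : realType) (Y : Type) (K : Y -> Y -> R[i]).
Hypothesis pK : pdk K.
Implicit Types (F G : Y -> R[i]) (s t : seq (Y * R[i])).

Definition rk_space : set (Y -> R[i]) := [set F | exists2 M, 0 <= M & dom K M F].

(* [l = <F, G>]: if [comb K t] is within [sqrt d] of [G], then [ev F t = <F, comb K t>]
   is within [|F| sqrt d] of [l]. *)
Definition is_ip F G (l : R[i]) := exists2 M : R, 0 <= M & forall (d : R) t,
  0 <= d -> dom K d (fun y => G y - comb K t y) -> sqc (ev F t - l) <= M * d.

Definition rk_ip F G : R[i] := xget 0 [set l | is_ip F G l].

Lemma comb_diff G d d' t t' : dom K d (fun y => G y - comb K t y) ->
  dom K d' (fun y => G y - comb K t' y) ->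
  dom K (2 * d + 2 * d') (comb K (t ++ coef_scale (-1) t')).
Proof.
move=> h h'; rewrite comb_cat combN addrC.
have := domB pK h' h; congr dom; apply/funext => y; ring.
Qed.

(** Two approximants of [G] with squared errors [d] and [d'] differ by a vector of squared norm at
    most [2 d + 2 d'], so their values under [F] differ by at most [sqrt (2 M d) + sqrt (2 M d')].
    [intervals_meet] on real and imaginary parts then gives [l]. *)
Lemma is_ip_exists F G : rk_space F -> rk_space G -> exists l, is_ip F G l.
Proof.
move=> [M M0 dF] [N N0 dG].
pose P := [set td : seq (Y * R[i]) * R |
  0 <= td.2 /\ dom K td.2 (fun y => G y - comb K td.1 y)].
have P0 : P !=set0.
  by have [t dt] := dom_approx pK N0 dG ltr01; exists (t, 1).
pose r (td : seq (Y * R[i]) * R) := Num.sqrt (2 * M * td.2).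
have key x y : P x -> P y -> sqc (ev F x.1 - ev F y.1) <= (r x + r y) ^+ 2.
  move=> [x0 dx] [y0 dy].
  have -> : ev F x.1 - ev F y.1 = ev F (x.1 ++ coef_scale (-1) y.1).
    by rewrite ev_cat ev_coef_scale mulN1r.
  have xy0 : 0 <= 2 * x.2 + 2 * y.2 by lra.
  have h := sqc_ev_le pK M0 xy0 dF (comb_diff dx dy).
  apply: le_trans h _; rewrite sqrrD !sqr_sqrtr ?mulr_ge0//.
  have : 0 <= r x * r y by rewrite mulr_ge0 ?sqrtr_ge0.
  by rewrite -mulr_natr; nra.
have part (f : R[i] -> R) : (forall z w, f (z - w) = f z - f w) ->
    (forall z, f z ^+ 2 <= sqc z) ->
    exists l, forall x, P x -> `|f (ev F x.1) - l| <= r x.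
  move=> fB fs; apply: intervals_meet => // x y Px Py.
  have : `|f (ev F x.1) - f (ev F y.1)| <= r x + r y.
    rewrite -ler_sqr ?nnegrE ?addr_ge0 ?sqrtr_ge0// real_normK ?num_real//.
    by rewrite -fB (le_trans (fs _))// key.
  by rewrite ler_distl => /andP[_]; lra.
have [] := part (@complex.Re R); [by case=> ? ? []|exact: Re_le_sqc|].
move=> l1 hl1.
have [] := part (@complex.Im R); [by case=> ? ? []|exact: Im_le_sqc|].
move=> l2 hl2; exists (l1 +i* l2), (4 * M); first by rewrite mulr_ge0.
move=> d t d0 dt; have Pt : P (t, d) by [].
have := sqr_le_of_norm (hl1 _ Pt); have := sqr_le_of_norm (hl2 _ Pt).
rewrite /r/= sqr_sqrtr ?mulr_ge0//; case: (ev F t) => a b /=.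
by rewrite /sqc/=; nra.
Qed.

Lemma is_ip_uniq F G l l' : rk_space G -> is_ip F G l -> is_ip F G l' -> l = l'.
Proof.
move=> [N N0 dG] [M M0 h] [M' M'0 h']; apply/eqP; rewrite -subr_eq0; apply/eqP.
apply: (@sqc_eq0_le _ _ (2 * M + 2 * M')) => e e0 e1.
have [t dt] := dom_approx pK N0 dG e0.
have := h e t (ltW e0) dt; have := h' e t (ltW e0) dt.
have := sqcB (ev F t - l') (ev F t - l).
have -> : ev F t - l' - (ev F t - l) = l - l' by ring.
nra.
Qed.

Lemma rk_ipP F G : rk_space F -> rk_space G -> is_ip F G (rk_ip F G).
Proof. by move=> HF HG; have [l hl] := is_ip_exists HF HG; exact: xgetI hl. Qed.

Lemma rk_ip_eq F G l : rk_space F -> rk_space G -> is_ip F G l -> rk_ip F G = l.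
Proof. by move=> HF HG; apply: is_ip_uniq => //; exact: rk_ipP. Qed.

Lemma rk_space_kernel y : rk_space (K^~ y).
Proof.
exists (complex.Re (K y y)); last exact: dom_kernel.
by have := qn_ge0 [:: (y, 1)] pK; rewrite /qn sform1 conjc1 !mul1r.
Qed.

Lemma rk_space_lin a F G : rk_space F -> rk_space G ->
  rk_space (fun y => a * F y + G y).
Proof.
move=> [M M0 dF] [N N0 dG]; exists (2 * sqc a * M + 2 * N); last exact: dom_lin.
by rewrite addr_ge0// !mulr_ge0// sqc_ge0.
Qed.

Lemma rk_spaceB F G : rk_space F -> rk_space G -> rk_space (F \- G).
Proof.
move=> [M M0 dF] [N N0 dG]; exists (2 * M + 2 * N); last exact: domB.
by rewrite addr_ge0// mulr_ge0.
Qed.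

Lemma rk_ip_lin a F G H : rk_space F -> rk_space G -> rk_space H ->
  rk_ip (fun y => a * F y + G y) H = a * rk_ip F H + rk_ip G H.
Proof.
move=> HF HG HH; apply: rk_ip_eq => //; first exact: rk_space_lin.
have [M M0 h] := rk_ipP HF HH; have [N N0 h'] := rk_ipP HG HH.
exists (2 * sqc a * M + 2 * N); first by rewrite addr_ge0// !mulr_ge0// sqc_ge0.
move=> d t d0 dt; rewrite ev_lin.
have -> : a * ev F t + ev G t - (a * rk_ip F H + rk_ip G H) =
  a * (ev F t - rk_ip F H) + (ev G t - rk_ip G H) by ring.
have := sqcD (a * (ev F t - rk_ip F H)) (ev G t - rk_ip G H).
have := h d t d0 dt; have := h' d t d0 dt; rewrite sqcM.
by move=> h1 /(ler_wpM2l (sqc_ge0 a)); nra.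
Qed.

Lemma rk_reproducing F y : rk_space F -> rk_ip F (K^~ y) = F y.
Proof.
move=> HF; apply: rk_ip_eq => //; first exact: rk_space_kernel.
have [M M0 dF] := HF; exists M => // d t d0 dt.
have -> : ev F t - F y = ev F (t ++ [:: (y, -1)]).
  by rewrite ev_cat /ev big_seq1 mulN1r.
apply: (sqc_ev_le pK) => //; rewrite comb_cat.
have := domN dt; congr dom; apply/funext => z.
by rewrite /comb big_seq1 rmorphN rmorph1; ring.
Qed.

Lemma qn_approx M e F t : 0 <= M -> 0 <= e -> dom K M F ->
  dom K e (fun y => F y - comb K t y) -> qn K t <= 2 * M + 2 * e.
Proof.
move=> M0 e0 dF dt; apply: (qn_le_dom pK); first by rewrite addr_ge0// mulr_ge0.
have := domB pK dF dt; congr dom; apply/funext => y; ring.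
Qed.

Lemma rk_ip_herm F G : rk_space F -> rk_space G -> rk_ip F G = (rk_ip G F)^*%C.
Proof.
move=> HF HG; apply/eqP; rewrite -subr_eq0; apply/eqP.
have [A A0 hA] := rk_ipP HF HG; have [B B0 hB] := rk_ipP HG HF.
have [M M0 dF] := HF; have [N N0 dG] := HG.
apply: (@sqc_eq0_le _ _ (4 * (A + B + (2 * M + 2) + (2 * N + 2)))) => e e0 e1.
have [f df] := dom_approx pK M0 dF e0; have [g dg] := dom_approx pK N0 dG e0.
have qf := qn_approx M0 (ltW e0) dF df; have qg := qn_approx N0 (ltW e0) dG dg.
have h1 := hA _ _ (ltW e0) dg; have h2 := hB _ _ (ltW e0) df.
have := df g; have := dg f; rewrite !ev_combB => h3 h4.
have -> : rk_ip F G - (rk_ip G F)^*%C =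
    (- (ev F g - rk_ip F G) + (ev F g - sform K g f)) +
    ((- (ev G f - sform K f g))^*%C + (ev G f - rk_ip G F)^*%C).
  by rewrite rmorphN !rmorphB/= -(pdk_herm f g pK); ring.
have := sqcD (- (ev F g - rk_ip F G) + (ev F g - sform K g f))
    ((- (ev G f - sform K f g))^*%C + (ev G f - rk_ip G F)^*%C).
have := sqcD (- (ev F g - rk_ip F G)) (ev F g - sform K g f).
have := sqcD ((- (ev G f - sform K f g))^*%C) ((ev G f - rk_ip G F)^*%C).
rewrite !sqcJ !sqcN => k1 k2 k3.
have qf' : e * qn K f <= e * (2 * M + 2) by rewrite ler_pM2l//; lra.
have qg' : e * qn K g <= e * (2 * N + 2) by rewrite ler_pM2l//; lra.
by nra.
Qed.

(** Approximants with squared error [d ^ 2] recover the squared norm of [F] up to an error linear in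
    [d]; the norm estimates below are made on [qn K t] and passed to the limit. *)
Lemma rk_ip_self F M : 0 <= M -> dom K M F -> exists2 c, 0 <= c &
  forall d : R, 0 < d -> d <= 1 -> exists t,
  [/\ sqc (ev F t - rk_ip F F) <= c * d ^+ 2, dom K (d ^+ 2) (fun y => F y - comb K t y)
    & sqc ((qn K t)%:C - rk_ip F F) <= (c * d) ^+ 2].
Proof.
move=> M0 dF; have HF : rk_space F by exists M.
have [A A0 hA] := rk_ipP HF HF.
pose c := 1 + 2 * A + 2 * (2 * M + 2); have c1 : 1 <= c by rewrite /c; lra.
exists c; first by lra.
move=> d d0 d1; have dd0 : 0 < d ^+ 2 by rewrite exprn_gt0.
have dd1 : d ^+ 2 <= 1 by rewrite exprn_ile1// ltW.
have [t dt] := dom_approx pK M0 dF dd0; exists t.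
have h1 := hA _ _ (ltW dd0) dt.
have qt := qn_approx M0 (ltW dd0) dF dt.
split=> //; first by apply: le_trans h1 _; rewrite ler_pM2r// /c; lra.
rewrite qnE//; have := dt t; rewrite ev_combB => h2.
have -> : sform K t t - rk_ip F F = - (ev F t - sform K t t) + (ev F t - rk_ip F F) by ring.
apply: le_trans (sqcD _ _) _; rewrite sqcN.
have h3 : d ^+ 2 * qn K t <= d ^+ 2 * (2 * M + 2) by rewrite ler_pM2l//; lra.
apply: (@le_trans _ _ (c * d ^+ 2)); first by rewrite /c; nra.
by rewrite exprMn ler_pM2r// expr2 ler_peMl//; lra.
Qed.

Lemma rk_ip_real F : rk_space F -> complex.Im (rk_ip F F) = 0 /\ 0 <= complex.Re (rk_ip F F).
Proof.
move=> [M M0 dF]; have [c c0 h] := rk_ip_self M0 dF; set l := rk_ip F F.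
split.
  apply/eqP; rewrite -sqrf_eq0 eq_le sqr_ge0 andbT.
  apply: (@le_of_eps _ _ 0 (c ^+ 2)) => e e0 e1; rewrite add0r.
  have [t [_ _]] := h e e0 e1; have := Im_le_sqc ((qn K t)%:C - l).
  have -> : complex.Im ((qn K t)%:C - l) ^+ 2 = complex.Im l ^+ 2.
    by case: l => a b /=; ring.
  move=> h1 h2; apply: le_trans h1 (le_trans h2 _); rewrite exprMn.
  by rewrite ler_wpM2l ?sqr_ge0// expr2 ler_piMl// ltW.
apply: (@le_of_eps _ _ _ c) => e e0 e1.
have [t [_ _ ht]] := h e e0 e1; have := le_trans (Re_le_sqc _) ht.
move=> /(norm_le_of_sqr (mulr_ge0 c0 (ltW e0))).
have -> : complex.Re ((qn K t)%:C - l) = qn K t - complex.Re l by case: l.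
by rewrite ler_distl => /andP[_]; have := qn_ge0 t pK; lra.
Qed.

Lemma rk_ip_ge0 F : rk_space F -> 0 <= rk_ip F F.
Proof.
by move=> /rk_ip_real; case: rk_ip => a b /= [-> a0]; rewrite ler0c.
Qed.

(** With [rk_ip_le], identifies the squared norm as the least dominating constant. Cauchy-Schwarz
    holds for an approximant [comb K t], and [sqcD_eps] transfers it to [F] at the cost of a factor
    [1 + e]. *)
Lemma dom_rk_ip F : rk_space F -> dom K (complex.Re (rk_ip F F)) F.
Proof.
move=> HF s; have [M M0 dF] := HF; have [c c0 h] := rk_ip_self M0 dF.
have [_] := rk_ip_real HF; set l := complex.Re _ => l0.
have S0 := qn_ge0 s pK.
apply: (@le_of_eps _ _ _ ((l + 2 * c + 2) * qn K s)) => e e0 e1.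
have [t [_ h2 h3]] := h e e0 e1.
have qt : qn K t <= l + c * e.
  have := le_trans (Re_le_sqc _) h3.
  move=> /(norm_le_of_sqr (mulr_ge0 c0 (ltW e0))).
  have -> : complex.Re ((qn K t)%:C - rk_ip F F) = qn K t - l by rewrite /l; case: rk_ip.
  by rewrite ler_distl => /andP[].
have := h2 s; rewrite ev_combB => h4.
have CS : sqc (sform K s t) <= qn K t * qn K s.
  by rewrite -lecR sqcE real_complexM !qnE// sform_CS.
have := sqcD_eps (sform K s t) (ev F s - sform K s t) e0.
rewrite subrKC => k; apply: le_trans k _.
have e1' : (1 + e^-1) * e ^+ 2 = e ^+ 2 + e by field; rewrite gt_eqF.
have k1 : (1 + e^-1) * sqc (ev F s - sform K s t) <= (e ^+ 2 + e) * qn K s.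
  by rewrite -e1' -mulrA ler_wpM2l// addr_ge0// invr_ge0 ltW.
have k2 : (1 + e) * sqc (sform K s t) <= (1 + e) * ((l + c * e) * qn K s).
  apply: ler_wpM2l; first by rewrite addr_ge0// ltW.
  by apply: le_trans CS _; exact: ler_wpM2r.
apply: le_trans (lerD k2 k1) _.
have -> : (1 + e) * ((l + c * e) * qn K s) + (e ^+ 2 + e) * qn K s =
  ((1 + e) * (l + c * e) + (e ^+ 2 + e)) * qn K s by ring.
have -> : l * qn K s + (l + 2 * c + 2) * qn K s * e =
  (l + (l + 2 * c + 2) * e) * qn K s by ring.
apply: ler_wpM2r => //.
have : e ^+ 2 <= e by rewrite expr2 ler_piMl// ltW.
by move: (ltW e0) => ? ?; nra.
Qed.

(** Domination tested on approximants of [F] becomes [l ^ 2 <= M l] in the limit, [l] being the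
    squared norm. *)
Lemma rk_ip_le F M : 0 <= M -> dom K M F -> complex.Re (rk_ip F F) <= M.
Proof.
move=> M0 dF; have HF : rk_space F by exists M.
have [c c0 h] := rk_ip_self M0 dF.
have [lI] := rk_ip_real HF; set l := complex.Re _ => l0.
suff : l * l <= M * l.
  by move: l0; rewrite le0r => /orP[/eqP->//|l0]; rewrite ler_pM2r.
apply: (@le_of_eps _ _ _ (M * l + 2 * M * c + 2 * c)) => e e0 e1.
have [t [h1 h2 h3]] := h e e0 e1.
have qt : qn K t <= l + c * e.
  have := le_trans (Re_le_sqc _) h3.
  move=> /(norm_le_of_sqr (mulr_ge0 c0 (ltW e0))).
  have -> : complex.Re ((qn K t)%:C - rk_ip F F) = qn K t - l by rewrite /l; case: rk_ip.
  by rewrite ler_distl => /andP[].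
have := dF t => h4.
have := sqcD_eps (ev F t) (- (ev F t - rk_ip F F)) e0.
rewrite subKr sqcN.
have -> : sqc (rk_ip F F) = l * l by rewrite /sqc lI expr0n/= addr0.
move=> k; apply: le_trans k _.
have e1' : (1 + e^-1) * e ^+ 2 = e ^+ 2 + e by field; rewrite gt_eqF.
have k1 : (1 + e^-1) * sqc (ev F t - rk_ip F F) <= (e ^+ 2 + e) * c.
  by rewrite -e1' -mulrA (mulrC _ c) ler_wpM2l// addr_ge0// invr_ge0 ltW.
have k2 : (1 + e) * sqc (ev F t) <= (1 + e) * (M * (l + c * e)).
  apply: ler_wpM2l; first by rewrite addr_ge0// ltW.
  by apply: le_trans h4 _; exact: ler_wpM2l.
apply: le_trans (lerD k2 k1) _.
have ee : e ^+ 2 <= e by rewrite expr2 ler_piMl// ltW.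
have : M * c * e ^+ 2 <= M * c * e by rewrite ler_wpM2l ?mulr_ge0.
have : c * e ^+ 2 <= c * e by rewrite ler_wpM2l.
by move: (ltW e0) => ? ? ?; nra.
Qed.

(** Domination tests only finite combinations, so it is stable under pointwise limits: the pointwise
    limit of a Cauchy sequence is also its limit in norm. *)
Lemma rk_complete (Fs : nat -> Y -> R[i]) : (forall n, rk_space (Fs n)) ->
  (forall e : R, 0 < e -> exists N : nat, forall j k : nat,
     (N <= j)%N -> (N <= k)%N -> ip_norm rk_ip (Fs j \- Fs k) < e) ->
  exists2 F, rk_space F & ip_norm rk_ip (Fs n \- F) @[n --> \oo] --> (0 : R).
Proof.
move=> HFs cau.
have cdom (e : R) : 0 < e -> exists N : nat, forall j k : nat,
    (N <= j)%N -> (N <= k)%N -> dom K (e ^+ 2) (Fs j \- Fs k).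
  move=> e0; have [N hN] := cau e e0; exists N => j k Nj Nk.
  have HB := rk_spaceB (HFs j) (HFs k).
  apply: dom_weak (dom_rk_ip HB) => //.
  have [_ ip0] := rk_ip_real HB; rewrite -[leLHS](sqr_sqrtr ip0).
  by rewrite ler_sqr ?nnegrE ?sqrtr_ge0 ?(ltW e0)// ltW// hN.
have [F hF] : exists F : Y -> R[i], forall y (e : R), 0 < e ->
    exists N : nat, forall j, (N <= j)%N -> sqc (Fs j y - F y) <= e.
  suff /choice [F hF] : forall y, exists l : R[i], forall e : R, 0 < e ->
      exists N : nat, forall j, (N <= j)%N -> sqc (Fs j y - l) <= e.
    by exists F.
  move=> y; apply: cauchy_seq_limit => e e0.
  (* The added 1 covers [K y y = 0]. *)
  have Ky0 : 0 < complex.Re (K y y) + 1.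
    by have := qn_ge0 [:: (y, 1)] pK; rewrite /qn sform1 conjc1 !mul1r; lra.
  have d0 : 0 < Num.sqrt (e / (complex.Re (K y y) + 1)) by rewrite sqrtr_gt0 divr_gt0.
  have [N hN] := cdom _ d0; exists N => j k Nj Nk.
  apply: le_trans (dom_eval y (hN j k Nj Nk)) _.
  have q0 : 0 <= e / (complex.Re (K y y) + 1) by rewrite divr_ge0// ltW.
  rewrite (sqr_sqrtr q0) mulrAC ler_pdivrMr// ler_pM2l//.
  by rewrite lerDl.
have evlim s (e : R) : 0 < e -> exists N : nat, forall j, (N <= j)%N ->
    sqc (ev (Fs j \- F) s) <= e.
  elim: s e => [|p s IH] e e0.
    by exists 0%N => j _; rewrite /ev big_nil /sqc/= expr0n/= addr0 ltW.
  have p0 : 0 < sqc p.2 + 1 by rewrite ltr_wpDl// sqc_ge0.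
  have [N1 h1] := IH (e / 4) (divr_gt0 e0 (ltr0n _ 4)).
  have [N2 h2] := hF p.1 (e / 4 / (sqc p.2 + 1)) (divr_gt0 (divr_gt0 e0 (ltr0n _ 4)) p0).
  exists (maxn N1 N2) => j; rewrite geq_max => /andP[/h1 k1 /h2].
  rewrite ler_pdivlMr// => k2; rewrite /ev big_cons.
  apply: le_trans (sqcD _ _) _; rewrite sqcM.
  have : sqc p.2 * sqc (Fs j p.1 - F p.1) <= e / 4.
    by apply: le_trans k2; rewrite mulrC ler_wpM2l ?sqc_ge0// lerDl.
  by move: k1; rewrite /ev; lra.
have domF (e : R) : 0 < e -> exists N : nat, forall j, (N <= j)%N ->
    dom K (2 * e ^+ 2) (Fs j \- F).
  move=> e0; have [N hN] := cdom e e0; exists N => j Nj s.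
  apply: (@le_of_eps _ _ _ 2) => d d0 _.
  have [N' hN'] := evlim s d d0; pose k := maxn N N'.
  have h1 := hN j k Nj (leq_maxl _ _) s; have h2 := hN' k (leq_maxr _ _).
  have -> : ev (Fs j \- F) s = ev (Fs j \- Fs k) s + ev (Fs k \- F) s.
    by rewrite !evB; ring.
  by apply: le_trans (sqcD _ _) _; lra.
have HF : rk_space F.
  have [N hN] := domF 1 ltr01.
  have HD : rk_space (Fs N \- F).
    by exists (2 * 1 ^+ 2); [rewrite expr1n mulr1|exact: hN].
  have := rk_spaceB (HFs N) HD; congr rk_space; apply/funext => y /=; ring.
exists F => //; apply/cvgrPdist_le => e e0.
have [N hN] := domF (e / 2) (divr_gt0 e0 (ltr0n _ 2)).
exists N => // j /= Nj; rewrite sub0r normrN ger0_norm ?sqrtr_ge0//.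
rewrite -[leRHS]ger0_norm ?(ltW e0)// -sqrtr_sqr ler_wsqrtr//.
have D0 : 0 <= 2 * (e / 2) ^+ 2 by rewrite mulr_ge0// sqr_ge0.
apply: le_trans (rk_ip_le D0 (hN j Nj)) _.
by have := sqr_ge0 e; lra.
Qed.

Lemma rk_is_rkhs : is_rkhs K rk_space rk_ip.
Proof.
split; last 3 first.
- exact: rk_space_kernel.
- by move=> F y; exact: rk_reproducing.
- move=> F e [M M0 dF] e0.
  have d0 : 0 < (e / 2) ^+ 2 by rewrite exprn_gt0// divr_gt0.
  have [t dt] := dom_approx pK M0 dF d0.
  exists (size t), (fun j => (tnth (in_tuple t) j).1), (fun j => ((tnth (in_tuple t) j).2)^*%C).
  rewrite (_ : (fun z => _) = (fun z => F z - comb K t z)); last first.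
    by apply/funext => z; rewrite /comb (big_tnth _ _ t).
  apply: (@le_lt_trans _ _ (e / 2)); last by rewrite ltr_pdivrMr// ltr_pMr// ltr1n.
  rewrite -[leRHS]ger0_norm ?divr_ge0 ?(ltW e0)// -sqrtr_sqr ler_wsqrtr//.
  by apply: rk_ip_le => //; exact: ltW.
- split.
  + by exists 0 => // s; rewrite ev0 mul0r /sqc/= expr0n/= addr0.
  + exact: rk_space_lin.
  + exact: rk_ip_lin.
  + exact: rk_ip_herm.
  + exact: rk_ip_ge0.
  + move=> F HF F0; apply/funext => y; apply: sqc_eq0.
    by have := dom_eval y (dom_rk_ip HF); rewrite F0 mul0r.
  + exact: rk_complete.
Qed.

End MooreAronszajn.

(** * The Fourier transform of a Gaussian *)

Section GaussFourier.
Variable R : realType.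
Implicit Types a s x t : R.
Notation mu := (@lebesgue_measure R).

Definition gs a x : R := expR (- (a * x ^+ 2)).

Lemma gs_gt0 a x : 0 < gs a x. Proof. exact: expR_gt0. Qed.

Lemma gs_continuous a : continuous (gs a).
Proof.
move=> x; apply: continuous_comp; last exact: continuous_expR.
apply: (@continuousN _ R^o); apply: continuousM; first exact: cvg_cst.
exact: sqr_continuous.
Qed.

Lemma integrable_scale (D : set R) c (f : R -> R) : measurable D ->
  mu.-integrable D (EFin \o f) -> mu.-integrable D (EFin \o (fun x => c * f x)).
Proof.
move=> mD fi; have := @integrableZl _ _ _ mu D mD c _ fi.
by apply: eq_integrable.
Qed.

(** [gs a] is a multiple of the normal density of variance [1 / (2 a)]. *)
Lemma integrable_gs_int a : 0 < a -> mu.-integrable setT (EFin \o gs a) /\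
  \int[mu]_x gs a x = Num.sqrt (pi / a).
Proof.
move=> a0; pose sg := Num.sqrt (2 * a)^-1.
have a20 : 0 < 2 * a by rewrite mulr_gt0.
have sg0 : sg != 0 by rewrite gt_eqF// sqrtr_gt0 invr_gt0.
have sg2 : sg ^+ 2 = (2 * a)^-1 by rewrite sqr_sqrtr// invr_ge0 ltW.
have pk0 := normal_peak_gt0 sg0.
have pkE : normal_peak sg = (Num.sqrt (pi / a))^-1.
  rewrite /normal_peak sg2; congr ((Num.sqrt _)^-1).
  by rewrite -mulr_natr; field; rewrite gt_eqF.
have e x : normal_pdf 0 sg x = normal_peak sg * gs a x.
  rewrite normal_pdfE// /normal_fun subr0 sg2 /gs; congr (_ * expR _).
  by rewrite -mulr_natr; field; rewrite gt_eqF.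
have e' : gs a = fun x => (normal_peak sg)^-1 * normal_pdf 0 sg x.
  by apply/funext => x; rewrite e mulKf// gt_eqF.
have int0 := integrable_normal_pdf 0 sg.
split.
  by rewrite e'; exact: integrable_scale.
rewrite e' RintegralZl// /Rintegral integral_normal_pdf /= mulr1 pkE invrK//.
Qed.

(** Half of the exponent absorbs the factor [|x|]. This supplies the integrable majorant,
    independent of the frequency, for differentiating under the integral. *)
Lemma gs_moment a x : 0 < a -> `|x| * gs a x <= (1 + 2 / a) * gs (a / 2) x.
Proof.
move=> a0.
have -> : gs a x = gs (a / 2) x * gs (a / 2) x.
  by rewrite /gs -expRD; congr expR; field.
rewrite mulrA ler_pM2r ?gs_gt0// -ler_pdivlMr ?gs_gt0// /gs expRN invrK.
have h := expR_ge1Dx (a / 2 * x ^+ 2).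
have a1 : 0 < 1 + 2 / a by rewrite addr_gt0// divr_gt0.
apply: (@le_trans _ _ ((1 + 2 / a) * (1 + a / 2 * x ^+ 2))); last by rewrite ler_pM2l.
have -> : (1 + 2 / a) * (1 + a / 2 * x ^+ 2) = 1 + x ^+ 2 + (2 / a + a / 2 * x ^+ 2).
  by field; rewrite gt_eqF.
have p : 0 <= 2 / a + a / 2 * x ^+ 2.
  by apply: addr_ge0; [|apply: mulr_ge0; rewrite ?sqr_ge0//]; rewrite divr_ge0// ltW.
have : `|x| <= 1 + x ^+ 2 by rewrite -real_normK ?num_real//; have := sqr_ge0 (`|x| - 1); have := normr_ge0 x; nra.
by lra.
Qed.

Lemma continuous_integrable_le (f g : R -> R) : continuous f ->
  (forall x, `|f x| <= g x) -> mu.-integrable setT (EFin \o g) ->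
  mu.-integrable setT (EFin \o f).
Proof.
move=> cf fg; apply: le_integrable => //.
  by apply/measurable_EFinP; exact: continuous_measurable_fun.
by move=> x _ /=; rewrite lee_fin (le_trans (fg x))// ler_norm.
Qed.

Lemma integrable_gs_le a c (f : R -> R) : 0 < a -> continuous f ->
  (forall x, `|f x| <= c * gs a x) -> mu.-integrable setT (EFin \o f).
Proof.
move=> a0 cf fg; apply: (continuous_integrable_le cf fg).
have [ia _] := integrable_gs_int a0.
exact: integrable_scale.
Qed.

(** The fundamental theorem of calculus on growing intervals, then dominated convergence. *)
Lemma integral_derive0 (h h' : R -> R) :
  (forall x, is_derive x 1 h (h' x)) -> continuous h' ->
  mu.-integrable setT (EFin \o h') ->
  (h n%:R @[n --> \oo] --> (0:R)) -> (h (- n%:R) @[n --> \oo] --> (0:R)) ->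
  \int[mu]_x h' x = 0.
Proof.
move=> dh ch ih hp hn.
(* [n.+1] rather than [n], so that the interval is never degenerate. *)
pose I n : set R := `[- n.+1%:R, n.+1%:R]%classic.
have FTC n : (\int[mu]_(x in I n) (h' x)%:E = (h n.+1%:R)%:E - (h (- n.+1%:R))%:E)%E.
  apply: continuous_FTC2.
  - by rewrite gtrN.
  - exact: continuous_subspaceT.
  - have dd x : derivable h x 1 by have := dh x => -[].
    have cc x : {for x, continuous h} by apply: differentiable_continuous; exact/derivable1_diffP.
    split => //.
    + exact/cvg_at_right_filter/cc.
    + exact/cvg_at_left_filter/cc.
  - by move=> x _; rewrite derive1E; have := dh x => -[].
have mh' : measurable_fun setT (EFin \o h').
  by apply/measurable_EFinP; exact: continuous_measurable_fun.
have mI n : measurable (I n) by exact: measurable_itv.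
have mf n : measurable_fun setT ((EFin \o h') \_ (I n)).
  by move: (@measurable_restrictT _ _ _ _ (I n) (EFin \o h') (mI n)) => [+ _]; apply; exact: measurable_funTS mh'.
have Iev x : \forall n \near \oo, x \in I n.
  near=> n; rewrite inE /I/= in_itv/= -ler_norml.
  apply: le_trans (ltW (truncnS_gt _)) _; rewrite ler_nat ltnS.
  by near: n; exact: nbhs_infty_ge.
have lim1 x : ((EFin \o h') \_ (I n)) x @[n --> \oo] --> (h' x)%:E.
  apply: (@cvg_trans _ ((cst (h' x)%:E) n @[n --> \oo])); last exact: cvg_cst.
  apply: near_eq_cvg; near=> n; rewrite patchE ifT//.
  by near: n; exact: Iev.
have dm x n : (`|((EFin \o h') \_ (I n)) x| <= (EFin \o (Num.norm \o h')) x)%E.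
  by rewrite patchE; case: ifPn => _ /=; rewrite ?lexx// ?normr0 lee_fin.
have ae1 : {ae mu, forall x, setT x ->
    ((EFin \o h') \_ (I n)) x @[n --> \oo] --> (EFin \o h') x}.
  by apply: aeW => x _; exact: lim1.
have ae2 : {ae mu, forall x (n : nat), setT x ->
    (`|((EFin \o h') \_ (I n)) x| <= (EFin \o (Num.norm \o h')) x)%E}.
  by apply: aeW => x n _; exact: dm.
have [] := @dominated_convergence _ _ R mu setT measurableT
  (fun n => (EFin \o h') \_ (I n)) (EFin \o h') (EFin \o (Num.norm \o h')).
- exact: mf.
- exact: mh'.
- exact: ae1.
- exact: integrable_norm ih.
- exact: ae2.
move=> _ _ cv.
have cv0 : ((h n.+1%:R)%:E - (h (- n.+1%:R))%:E)%E @[n --> \oo] --> 0%:E.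
  apply: cvg_EFin; first exact: nearW.
  rewrite -[0](subr0 0); apply: cvgB.
    by rewrite -(cvg_shiftS (fun n => h n%:R)) in hp.
  by rewrite -(cvg_shiftS (fun n => h (- n%:R))) in hn.
rewrite /Rintegral.
have -> : (\int[mu]_x (h' x)%:E = 0)%E; last by [].
apply: cvg_unique cv0 => //.
by move: cv; apply: cvg_trans; apply: near_eq_cvg; near=> n; rewrite -FTC [in RHS]integral_mkcond.
Unshelve. all: by end_near. Qed.

Section Identity.
Variable a : R.
Hypothesis a0 : 0 < a.

Let F s := \int[mu]_x (cos (s * x) * gs a x).
Let F' s := \int[mu]_x (- (x * sin (s * x)) * gs a x).

Lemma cosM_continuous s : continuous (fun x : R => cos (s * x)).
Proof.
move=> x; apply: continuous_comp; last exact: continuous_cos.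
by apply: continuousM; [exact: cvg_cst|exact: cvg_id].
Qed.

Lemma sinM_continuous s : continuous (fun x : R => sin (s * x)).
Proof.
move=> x; apply: continuous_comp; last exact: continuous_sin.
by apply: continuousM; [exact: cvg_cst|exact: cvg_id].
Qed.

Lemma integrable_cos_gs s : mu.-integrable setT (EFin \o (fun x => cos (s * x) * gs a x)).
Proof.
apply: (@integrable_gs_le a 1) => // [x|x].
  by apply: continuousM; [exact: cosM_continuous|exact: gs_continuous].
by rewrite normrM (gtr0_norm (gs_gt0 _ _)) ler_pM2r ?gs_gt0// cos_max.
Qed.

Lemma integrable_xsin_gs s :
  mu.-integrable setT (EFin \o (fun x => - (x * sin (s * x)) * gs a x)).
Proof.
apply: (@integrable_gs_le (a / 2) (1 + 2 / a)) => [|x|x]; first by rewrite divr_gt0.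
  apply: cvgM; last exact: gs_continuous.
  apply: (@cvgN _ R^o); apply: cvgM; [exact: cvg_id|exact: sinM_continuous].
apply: le_trans (gs_moment x a0).
rewrite normrM normrN (gtr0_norm (gs_gt0 _ _)) ler_pM2r ?gs_gt0// normrM.
by rewrite ler_piMr// sin_max.
Qed.

Lemma is_derive_F s : is_derive s 1 F (F' s).
Proof.
pose f s x := cos (s * x) * gs a x.
have df t x : is_derive t 1 (f ^~ x) (- (x * sin (t * x)) * gs a x).
  rewrite /f; apply: is_derive_eq.
  by rewrite /GRing.scale/=; ring.
have Is : `]s - 1, s + 1[%classic s by rewrite /= in_itv/= ltrBlDr ltrDl ltr01.
have der t x : `]s - 1, s + 1[%classic t -> setT x -> derivable (f ^~ x) t 1.
  by move=> _ _; have [] := df t x.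
have G0 (x : R) : 0 <= (1 + 2 / a) * gs (a / 2) x.
  by rewrite mulr_ge0// ?ltW ?gs_gt0// addr_gt0// divr_gt0.
have iG : mu.-integrable setT (EFin \o (fun x => (1 + 2 / a) * gs (a / 2) x)).
  by apply: integrable_scale => //; apply: (integrable_gs_int _).1; rewrite divr_gt0.
have Gub t x : `]s - 1, s + 1[%classic t -> setT x ->
    `|partial1of2 f t x| <= (1 + 2 / a) * gs (a / 2) x.
  move=> _ _; rewrite partial1of2E; have [_ ->] := df t x.
  apply: le_trans (gs_moment x a0).
  rewrite normrM normrN (gtr0_norm (gs_gt0 _ _)) ler_pM2r ?gs_gt0// normrM.
  by rewrite ler_piMr// sin_max.
have iF t : `]s - 1, s + 1[%classic t -> mu.-integrable setT (EFin \o f t).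
  by move=> _; exact: integrable_cos_gs.
have dF := @derivable_under_integral R _ _ mu f setT measurableT s _ _ Is iF der _ G0 iG Gub.
have eF := @differentiation_under_integral R _ _ mu f setT measurableT s _ _ Is iF der _ G0 iG Gub.
apply: DeriveDef => //; rewrite -derive1E eF; apply: eq_Rintegral => x _.
by rewrite partial1of2E; have [_ ->] := df s x.
Qed.

Lemma gs_cvg0 (u : nat -> R) (f : R -> R) : (forall n, n%:R <= `|u n|) ->
  (forall x, `|f x| <= gs a x) -> f (u n) @[n --> \oo] --> (0 : R).
Proof.
move=> nu fg; apply/norm_cvg0P; apply/cvgrPdist_le => e e0.
near=> n; rewrite sub0r normrN ger0_norm ?normr_ge0//.
apply: le_trans (fg _) _.
have n0 : (0 < n)%N by near: n; exact: nbhs_infty_gt.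
have n1 : 1 <= n%:R :> R by rewrite ler1n.
have h : n%:R <= `|u n| ^+ 2.
  by have := nu n; move: (`|u n|) => v; nra.
have := expR_ge1Dx (a * u n ^+ 2); rewrite -(real_normK (num_real (u n))) => h1.
rewrite /gs -(real_normK (num_real (u n))) expRN -[leRHS]invrK lef_pV2 ?posrE ?expR_gt0 ?invr_gt0//.
apply: le_trans h1; apply: (@le_trans _ _ (a * n%:R)); last first.
  by apply: (@le_trans _ _ (a * `|u n| ^+ 2)); [rewrite ler_pM2l|rewrite lerDr].
rewrite -ler_pdivrMl//.
apply: le_trans (ltW (truncnS_gt _)) _; rewrite ler_nat.
by near: n; exact: nbhs_infty_ge.
Unshelve. all: by end_near. Qed.

(** Integration by parts: [sin (s x) gs a x] vanishes at both infinities, so its derivative has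
    integral zero. The outcome is a linear differential equation for [F]. *)
Lemma F'E s : F' s = - (s / (2 * a)) * F s.
Proof.
pose h x := sin (s * x) * gs a x.
pose h' x := s * (cos (s * x) * gs a x) + 2 * a * (- (x * sin (s * x)) * gs a x).
have dh x : is_derive x 1 h (h' x).
  rewrite /h /gs; apply: is_derive_eq.
  rewrite /h' /gs; move: (sin _) (cos _) (expR _) => S C E.
  by rewrite /GRing.scale/=; ring.
have bh x : `|h x| <= gs a x.
  by rewrite normrM (gtr0_norm (gs_gt0 _ _)) ler_piMl ?sin_max// ltW ?gs_gt0.
have i1 := @integrable_scale setT s _ measurableT (integrable_cos_gs s).
have i2 := @integrable_scale setT (2 * a) _ measurableT (integrable_xsin_gs s).
have ih' : mu.-integrable setT (EFin \o h').
  have := integrableD measurableT i1 i2; exact: eq_integrable.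
have ch' : continuous h'.
  move=> x; apply: cvgD; apply: cvgM; try exact: cvg_cst.
    by apply: cvgM; [exact: cosM_continuous|exact: gs_continuous].
  apply: cvgM; last exact: gs_continuous.
  by apply: (@cvgN _ R^o); apply: cvgM; [exact: cvg_id|exact: sinM_continuous].
have := integral_derive0 dh ch' ih'.
move=> /(_ (gs_cvg0 _ bh) (gs_cvg0 _ bh)).
rewrite RintegralD// !RintegralZl//; [|exact: integrable_xsin_gs|exact: integrable_cos_gs].
rewrite -/(F s) -/(F' s) => e.
have {}e : s * F s + 2 * a * F' s = 0.
  by apply: e => n; rewrite ?normrN ger0_norm.
have e' : F' s = - (s * F s) / (2 * a).
  have a20 : 2 * a != 0 by rewrite gt_eqF// mulr_gt0.
  by apply: (mulIf a20); rewrite divfK//; lra.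
by rewrite e'; field; rewrite gt_eqF.
Qed.

(** By [F'E], [F s] times [expR (s ^ 2 / (4 a))] has derivative zero, and its value at 0 is the
    Gaussian integral. *)
Lemma gauss_fourier s :
  \int[mu]_x (cos (s * x) * gs a x) = Num.sqrt (pi / a) * expR (- (s ^+ 2 / (4 * a))).
Proof.
pose f t := F t * expR (t ^+ 2 / (4 * a)).
have df t : is_derive t 1 f 0.
  have dF := is_derive_F t; rewrite /f; apply: is_derive_eq.
  by rewrite F'E /GRing.scale/=; field; rewrite gt_eqF.
have := @is_derive_0_is_cst R f s 0 df; rewrite /f expr0n/= mul0r expR0 mulr1 => e.
have F0 : F 0 = Num.sqrt (pi / a).
  rewrite /F -(integrable_gs_int a0).2; apply: eq_Rintegral => x _.
  by rewrite mul0r cos0 mul1r.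
by rewrite -F0 -e -mulrA -expRD subrr expR0 mulr1.
Qed.

End Identity.
End GaussFourier.

(** * Real kernels viewed as complex ones, and their exponentials *)

Section RealKernels.
Variables (R : realType) (Y : Type).
Implicit Types (f g : Y -> R) (k l : Y -> Y -> R) (s : seq (Y * R[i])).

Definition rk k : Y -> Y -> R[i] := fun x y => (k x y)%:C.

Definition rfm k s : R :=
  \sum_(p <- s) \sum_(q <- s) complex.Re (p.2 * (q.2)^*%C) * k p.1 q.1.

Lemma Re_sum (I : Type) (r : seq I) (F : I -> R[i]) :
  complex.Re (\sum_(i <- r) F i) = \sum_(i <- r) complex.Re (F i).
Proof.
elim: r => [|i r IH]; first by rewrite !big_nil.
by rewrite !big_cons -IH; case: (F i) => a b; case: (\sum_(j <- r) F j).
Qed.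

Lemma Re_mulr_real (z : R[i]) (a : R) : complex.Re (z * a%:C) = complex.Re z * a.
Proof. by case: z => x y /=; rewrite mulr0 subr0. Qed.

Lemma qn_rk k s : qn (rk k) s = rfm k s.
Proof.
rewrite /qn /sform /rfm Re_sum; apply: eq_bigr => p _; rewrite Re_sum.
by apply: eq_bigr => q _; rewrite Re_mulr_real.
Qed.

Lemma sform_rk k s : (forall x y, k x y = k y x) -> sform (rk k) s s = (rfm k s)%:C.
Proof.
move=> ks; rewrite -qn_rk /qn.
suff : (sform (rk k) s s)^*%C = sform (rk k) s s.
  by case: (sform _ _ _) => a b /eqP; rewrite eq_complex/= => /andP[_ /eqP b0]; congr (_ +i* _); lra.
rewrite /sform rmorph_sum exchange_big/=; apply: eq_bigr => p _.
rewrite rmorph_sum; apply: eq_bigr => q _ /=.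
rewrite !rmorphM/= conjcK /rk ks oppr0 complexr0.
by ring.
Qed.

Lemma pdk_rk k : (forall x y, k x y = k y x) -> (forall s, 0 <= rfm k s) -> pdk (rk k).
Proof. by move=> ks h s; rewrite sform_rk// ler0c. Qed.

Lemma rfm_ge0 k s : pdk (rk k) -> 0 <= rfm k s.
Proof. by move=> pk; rewrite -qn_rk qn_ge0. Qed.

Lemma rfmD k l s : rfm (fun x y => k x y + l x y) s = rfm k s + rfm l s.
Proof.
rewrite /rfm -big_split; apply: eq_bigr => p _; rewrite -big_split.
by apply: eq_bigr => q _; rewrite /= mulrDr.
Qed.

Lemma rfmZ a k s : rfm (fun x y => a * k x y) s = a * rfm k s.
Proof.
rewrite /rfm mulr_sumr; apply: eq_bigr => p _; rewrite mulr_sumr.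
by apply: eq_bigr => q _; rewrite mulrCA.
Qed.

Definition rsc f s := [seq (p.1, (f p.1)%:C * p.2) | p <- s].

Lemma Re_scale a b (z w : R[i]) :
  complex.Re (a%:C * z * (b%:C * w)^*%C) = a * b * complex.Re (z * w^*%C).
Proof. by case: z => x y; case: w => u v /=; ring. Qed.

Lemma rfm_rank1 f k s : rfm (fun x y => f x * f y * k x y) s = rfm k (rsc f s).
Proof.
rewrite /rfm /rsc big_map; apply: eq_bigr => p _.
by rewrite big_map; apply: eq_bigr => q _ /=; rewrite Re_scale; ring.
Qed.

Lemma ev_rsc f (F : Y -> R[i]) s : ev (fun y => (f y)%:C * F y) s = ev F (rsc f s).
Proof. by rewrite /ev /rsc big_map; apply: eq_bigr => p _ /=; ring. Qed.

Lemma cvg_rfm (kn : nat -> Y -> Y -> R) k s :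
  (forall x y, kn n x y @[n --> \oo] --> k x y) -> rfm (kn n) s @[n --> \oo] --> rfm k s.
Proof.
move=> h; rewrite /rfm.
by apply: cvg_big => [|p _]; [exact: add_continuous|];
   apply: cvg_big => [|q _]; [exact: add_continuous|];
   apply: cvgM; [exact: cvg_cst|exact: h].
Qed.

Lemma pdk_rkM k l : pdk (rk k) -> pdk (rk l) -> pdk (rk (fun x y => k x y * l x y)).
Proof.
move=> pk pl; have := pdkM pk pl; congr pdk.
by apply/funext => x; apply/funext => y; rewrite /rk real_complexM.
Qed.

Lemma pdk_rkX k n : pdk (rk k) -> pdk (rk (fun x y => k x y ^+ n)).
Proof.
move=> pk; elim: n => [|n IH]; last by under eq_fun do under eq_fun do rewrite exprS; exact: pdk_rkM.
by have := @pdk1 R Y; congr pdk.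
Qed.

Lemma rk_sym k x y : pdk (rk k) -> k x y = k y x.
Proof. by move=> /(pdk_sym x y); rewrite /rk/= => -[]. Qed.

(** All terms of the exponential series are positive definite by Schur, so the sum dominates each of
    them. The case [n = 0] gives positivity of the exponential, higher [n] the domination of
    monomials. *)
Lemma rfm_exp_ge k n s : pdk (rk k) ->
  rfm (fun x y => k x y ^+ n / n`!%:R) s <= rfm (fun x y => expR (k x y)) s.
Proof.
move=> pk.
have cv : rfm (fun x y => series (exp_coeff (k x y)) N) s @[N --> \oo] -->
    rfm (fun x y => expR (k x y)) s.
  by apply: (@cvg_rfm (fun N x y => series (exp_coeff (k x y)) N)) => x y; exact: is_cvg_series_exp_coeff.
have pkn j : 0 <= rfm (fun x y => k x y ^+ j / j`!%:R) s.
  rewrite (_ : rfm _ s = j`!%:R^-1 * rfm (fun x y => k x y ^+ j) s).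
    by rewrite mulr_ge0// ?invr_ge0// rfm_ge0//; exact: pdk_rkX.
  by rewrite -rfmZ; congr rfm; apply/funext => x; apply/funext => y; rewrite mulrC.
apply: (cvgr_to_ge cv).
near=> N; have nN : (n < N)%N by near: N; exact: nbhs_infty_gt.
have -> : rfm (fun x y => series (exp_coeff (k x y)) N) s =
    \sum_(0 <= j < N) rfm (fun x y => k x y ^+ j / j`!%:R) s.
  elim: (N) => [|M IH].
    rewrite big_geq// /rfm big1// => p _; rewrite big1// => q _.
    by rewrite /series/= big_geq// mulr0.
  rewrite big_nat_recr//= -IH -rfmD; congr rfm; apply/funext => x; apply/funext => y.
  by rewrite /series/= big_nat_recr.
rewrite big_mkord (bigD1 (Ordinal nN))//= lerDl.
by apply: sumr_ge0 => j _; exact: pkn.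
Unshelve. all: by end_near. Qed.

Lemma pdk_rk_exp k : pdk (rk k) -> pdk (rk (fun x y => expR (k x y))).
Proof.
move=> pk; apply: pdk_rk => [x y|s]; first by rewrite (rk_sym x y pk).
apply: le_trans (rfm_exp_ge 0 s pk).
have := rfm_ge0 s (pdk_rkX 0 pk); congr (_ <= rfm _ _).
by apply/funext => x; apply/funext => y; rewrite expr0 fact0 divr1.
Qed.

(** The form of a symmetric real kernel at [a + i b] is its form at [a] plus its form at [b]. *)
Lemma pdk_real_coef k : (forall x y, k x y = k y x) ->
  (forall s : seq (Y * R), 0 <= \sum_(p <- s) \sum_(q <- s) p.2 * q.2 * k p.1 q.1) ->
  pdk (rk k).
Proof.
move=> ks h; apply: pdk_rk => // s.
have := addr_ge0 (h [seq (p.1, complex.Re p.2) | p <- s])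
                 (h [seq (p.1, complex.Im p.2) | p <- s]).
congr (0 <= _); rewrite !big_map -big_split/=; apply: eq_bigr => p _.
rewrite !big_map -big_split/=; apply: eq_bigr => q _.
by case: p.2 => a b; case: q.2 => c d /=; ring.
Qed.

End RealKernels.

(** * Conditionally negative definite kernels *)

Section Schoenberg.
Variables (R : realType) (X : Type) (gamma : X -> X -> R).
Hypothesis cnd : cond_negative_definite gamma.
Implicit Types (u v w : X) (t : R).

Let gs_sym u v : gamma u v = gamma v u. Proof. exact: cnd.1. Qed.

Lemma cnd_seq (s : seq (X * R)) : \sum_(p <- s) p.2 = 0 ->
  \sum_(p <- s) \sum_(q <- s) p.2 * q.2 * gamma p.1 q.1 <= 0.
Proof.
move=> s0; have [n [x [c [xinj key]]]] := merge_points s.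
have c0 : \sum_i c i = 0.
  transitivity (\sum_i c i * 1); first by apply: eq_bigr => i _; rewrite mulr1.
  by rewrite (key (fun=> 1)) -[RHS]s0; apply: eq_bigr => p _; rewrite mulr1.
have := cnd.2 n x c xinj c0; congr (_ <= 0).
under eq_bigr do under eq_bigr do rewrite -mulrA.
under eq_bigr do rewrite -mulr_sumr (key (gamma _)).
rewrite (key (fun y => \sum_(q <- s) q.2 * gamma y q.1)).
apply: eq_bigr => p _; rewrite mulr_sumr.
by apply: eq_bigr => q _; rewrite mulrA.
Qed.

(* The inner product of the embedded points [u] and [v], with [w] as origin. *)
Definition kap w u v : R := (gamma u w + gamma v w - gamma u v - gamma w w) / 2.

Lemma pdk_kap w : pdk (rk (kap w)).
Proof.
apply: pdk_real_coef => [u v|s]; first by rewrite /kap (gs_sym u v) (addrC (gamma u w)).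
pose C := \sum_(p <- s) p.2; pose D := \sum_(p <- s) p.2 * gamma p.1 w.
pose E := \sum_(p <- s) \sum_(q <- s) p.2 * q.2 * gamma p.1 q.1.
(* Adding the origin [w] with weight [- C] makes the total weight zero; the form of [gamma] on the
   enlarged combination is minus twice the form of [kap w] on [s]. *)
have := @cnd_seq ((w, - C) :: s); rewrite !big_cons/= addNr => /(_ erefl).
have -> : \sum_(q <- s) - C * q.2 * gamma w q.1 = - C * D.
  by rewrite /D mulr_sumr; apply: eq_bigr => q _; rewrite gs_sym mulrA.
have -> : \sum_(p <- s) \sum_(q <- (w, - C) :: s) p.2 * q.2 * gamma p.1 q.1 = - C * D + E.
  rewrite /D mulr_sumr /E -big_split/=; apply: eq_bigr => p _.
  by rewrite big_cons/=; congr (_ + _); ring.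
move=> h.
have -> : \sum_(p <- s) \sum_(q <- s) p.2 * q.2 * kap w p.1 q.1 =
    (C * D + C * D - E - C * C * gamma w w) / 2.
  have -> : C * D + C * D - E - C * C * gamma w w =
      \sum_(p <- s) \sum_(q <- s) p.2 * q.2 * (gamma p.1 w + gamma q.1 w - gamma p.1 q.1 - gamma w w).
    have -> : C * C * gamma w w = \sum_(p <- s) \sum_(q <- s) p.2 * q.2 * gamma w w.
      rewrite /C !mulr_suml; apply: eq_bigr => p _; rewrite mulr_sumr mulr_suml.
      by apply: eq_bigr => q _.
    have -> : C * D = \sum_(p <- s) \sum_(q <- s) p.2 * q.2 * gamma q.1 w.
      rewrite /C /D mulr_suml; apply: eq_bigr => p _; rewrite mulr_sumr.
      by apply: eq_bigr => q _; rewrite mulrA.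
    have e : \sum_(p <- s) \sum_(q <- s) p.2 * q.2 * gamma q.1 w =
             \sum_(p <- s) \sum_(q <- s) p.2 * q.2 * gamma p.1 w.
      rewrite exchange_big/=; apply: eq_bigr => p _; apply: eq_bigr => q _; ring.
    rewrite [X in X + _ - _ - _]e /E -!big_split -!sumrB; apply: eq_bigr => p _ /=.
    rewrite -!big_split -!sumrB; apply: eq_bigr => q _ /=; ring.
  rewrite mulr_suml; apply: eq_bigr => p _; rewrite mulr_suml.
  by apply: eq_bigr => q _; rewrite /kap mulrA.
by rewrite divr_ge0//; nra.
Qed.

(** Schoenberg's splitting: a positive constant, a rank one kernel and, for [t >= 0], the
    exponential of a positive definite kernel. *)
Lemma exp_gammaE t w u v : expR (- (t * gamma u v)) =
  expR (t * gamma w w) * (expR (- (t * gamma u w)) * expR (- (t * gamma v w)) * expR (2 * t * kap w u v)).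
Proof. by rewrite -!expRD; congr expR; rewrite /kap; field. Qed.

Lemma pdk_rkZ (Y : Type) (c : R) (k : Y -> Y -> R) : 0 <= c -> pdk (rk k) ->
  pdk (rk (fun x y => c * k x y)).
Proof.
move=> c0 pk; apply: pdk_rk => [x y|s]; first by rewrite (rk_sym x y pk).
by rewrite rfmZ mulr_ge0// rfm_ge0.
Qed.

Lemma pdk_exp_kap t w : 0 <= t -> pdk (rk (fun u v => expR (2 * t * kap w u v))).
Proof.
by move=> t0; apply: pdk_rk_exp; apply: pdk_rkZ; [rewrite mulr_ge0|exact: pdk_kap].
Qed.

Lemma rfm_exp_gamma t w s :
  rfm (fun u v => expR (- (t * gamma u v))) s = expR (t * gamma w w) *
  rfm (fun u v => expR (2 * t * kap w u v)) (rsc (fun u => expR (- (t * gamma u w))) s).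
Proof.
rewrite -rfm_rank1 -rfmZ; congr rfm; apply/funext => u; apply/funext => v.
exact: exp_gammaE.
Qed.

Lemma pdk_exp_gamma t : 0 <= t -> pdk (rk (fun u v => expR (- (t * gamma u v)))).
Proof.
move=> t0; apply: pdk_rk => [u v|s]; first by rewrite gs_sym.
(* Some origin is needed; the first point of the combination serves. *)
case: s => [|[w c] s]; first by rewrite /rfm big_nil.
rewrite (rfm_exp_gamma _ w) mulr_ge0 ?expR_ge0// rfm_ge0//.
exact: pdk_exp_kap.
Qed.

Definition mono w (r : seq X) u : R := \prod_(v <- r) kap w u v.

(** Each factor is a section of the kernel [kap w], dominated by it with constant [kap w v v];
    [domM] multiplies these dominations. *)
Lemma dom_mono w r : dom (rk (fun u v => kap w u v ^+ size r)) (\prod_(v <- r) kap w v v)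
  (fun u => (mono w r u)%:C) /\ 0 <= \prod_(v <- r) kap w v v.
Proof.
have kge0 v : 0 <= kap w v v by rewrite -ler0c; exact: (pdk_diag v (pdk_kap w)).
have pge0 r' : 0 <= \prod_(v <- r') kap w v v by apply: prodr_ge0.
split=> //; elim: r => [s|v r IH].
  rewrite /mono !big_nil mul1r qn_rk (_ : rfm _ s = sqc (ev (fun=> 1%:C) s)).
    by rewrite (_ : (fun u => _) = (fun=> 1%:C))//; apply/funext => u; rewrite big_nil.
  apply: complexI; rewrite sqcE -sform_rank1 -sform_rk; last by move=> x y.
  by congr sform; apply/funext => x; apply/funext => y; rewrite /rk expr0 conjc_real -real_complexM mulr1.
have dv := dom_kernel v (pdk_kap w).
have := domM (pdk_kap w) (pdk_rkX (size r) (pdk_kap w)) (kge0 v) (pge0 r) dv IH.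
rewrite big_cons; congr dom.
  by apply/funext => x; apply/funext => y; rewrite /rk -real_complexM -exprS.
by apply/funext => x; rewrite /mono /rk big_cons -real_complexM.
Qed.

(* The term of order [size r] of [exp (2 t kap)] dominates the monomial. *)
Lemma dom_exp_mono t w r : 0 < t -> 0 <= gamma w w ->
  dom (rk (fun u v => expR (- (t * gamma u v))))
    (\prod_(v <- r) kap w v v * (size r)`!%:R / (2 * t) ^+ size r)
    (fun u => (expR (- (t * gamma u w)) * mono w r u)%:C).
Proof.
move=> t0 gw s; set N := size r.
have -> : ev (fun u => (expR (- (t * gamma u w)) * mono w r u)%:C) s =
    ev (fun u => (mono w r u)%:C) (rsc (fun u => expR (- (t * gamma u w))) s).
  by rewrite -ev_rsc /ev; apply: eq_bigr => p _; rewrite real_complexM.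
set s' := rsc _ s.
have [dm p0] := dom_mono w r.
apply: le_trans (dm s') _; rewrite !qn_rk -!mulrA ler_wpM2l//.
have t20 : 0 < (2 * t) ^+ N by rewrite exprn_gt0// mulr_gt0.
have := @rfm_exp_ge R X (fun u v => 2 * t * kap w u v) N s'.
have p2 : pdk (rk (fun u v => 2 * t * kap w u v)).
  by apply: pdk_rkZ; [rewrite mulr_ge0// ltW|exact: pdk_kap].
move=> /(_ p2).
have -> : rfm (fun u v => (2 * t * kap w u v) ^+ N / N`!%:R) s' =
    (2 * t) ^+ N / N`!%:R * rfm (fun u v => kap w u v ^+ N) s'.
  by rewrite -rfmZ; congr rfm; apply/funext => u; apply/funext => v; rewrite exprMn; ring.
have f0 : 0 < N`!%:R :> R by rewrite ltr0n fact_gt0.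
move=> h.
have {}h : rfm (fun u v => kap w u v ^+ N) s' <=
    N`!%:R / (2 * t) ^+ N * rfm (fun u v => expR (2 * t * kap w u v)) s'.
  rewrite -(ler_pM2l (divr_gt0 t20 f0)); apply: le_trans h _.
  rewrite mulrA; have -> : (2 * t) ^+ N / N`!%:R * (N`!%:R / (2 * t) ^+ N) = 1.
    by field; rewrite (gt_eqF t20) (gt_eqF f0).
  by rewrite mul1r.
apply: le_trans h _; rewrite mulrA ler_wpM2l ?divr_ge0 ?(ltW f0) ?(ltW t20)//.
rewrite (rfm_exp_gamma t w) -/s' ler_peMl//.
  by rewrite rfm_ge0//; apply: pdk_exp_kap; exact: ltW.
by rewrite -[leLHS]expR0 ler_expR mulr_ge0// ltW.
Qed.

End Schoenberg.

(** * The one-dimensional Gaussian kernel *)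

Section Pullback.
Variables (R : realType) (X Y : Type) (h : Y -> X).
Implicit Types (K : X -> X -> R[i]) (F : X -> R[i]).

Let push (s : seq (Y * R[i])) := [seq (h p.1, p.2) | p <- s].

Lemma sform_pullback K s t : sform (fun x y => K (h x) (h y)) s t = sform K (push s) (push t).
Proof. by rewrite /sform big_map; apply: eq_bigr => p _; rewrite big_map. Qed.

Lemma pdk_pullback K : pdk K -> pdk (fun x y => K (h x) (h y)).
Proof. by move=> pK s; rewrite sform_pullback. Qed.

Lemma dom_pullback K (M : R) F : dom K M F ->
  dom (fun x y => K (h x) (h y)) M (fun x => F (h x)).
Proof.
move=> dF s; rewrite /qn sform_pullback.
by have := dF (push s); rewrite /ev big_map.
Qed.

End Pullback.

Section MeanValue.
Variable R : realType.
Notation mu := (@lebesgue_measure R).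
Implicit Types (f g : R -> R) (D : set R).

Lemma integrable_sumr (I : Type) (r : seq I) D (F : I -> R -> R) : measurable D ->
  (forall i, mu.-integrable D (EFin \o F i)) ->
  mu.-integrable D (EFin \o (fun x => \sum_(i <- r) F i x)) /\
  \int[mu]_(x in D) \sum_(i <- r) F i x = \sum_(i <- r) \int[mu]_(x in D) F i x.
Proof.
move=> mD iF; elim: r => [|i r [IH1 IH2]].
  rewrite big_nil; have e : (fun x : R => \sum_(i <- [::]) F i x) = cst 0.
    by apply/funext => x; rewrite big_nil.
  rewrite e; split; last by rewrite Rintegral_cst// mul0r.
  exact: integrable0.
have e : (fun x => \sum_(j <- i :: r) F j x) = (fun x => F i x + \sum_(j <- r) F j x).
  by apply/funext => x; rewrite big_cons.
rewrite e; split; last by rewrite RintegralD// IH2 big_cons.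
by have := @integrableD _ _ _ mu D mD _ _ (iF i) IH1; apply: eq_integrable.
Qed.

Lemma continuous_integrable_itv f (a b : R) : continuous f ->
  mu.-integrable `[a, b] (EFin \o f).
Proof.
move=> cf; apply: continuous_compact_integrable; first exact: segment_compact.
exact: continuous_subspaceT.
Qed.

Lemma Rintegral_itv_cst (a b c : R) : a < b -> \int[mu]_(x in `[a, b]) c = c * (b - a).
Proof.
move=> ab; rewrite Rintegral_cst//=; congr (_ * _).
by rewrite lebesgue_measure_itv/= lte_fin ab.
Qed.

(** Jensen's inequality, from the integral of [(f - m) ^ 2] over the interval, [m] being the
    mean. *)
Lemma sqr_mean_le f (a b : R) : a < b -> continuous f ->
  ((b - a)^-1 * \int[mu]_(x in `[a, b]) f x) ^+ 2 <=
  (b - a)^-1 * \int[mu]_(x in `[a, b]) (f x ^+ 2).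
Proof.
move=> ab cf; set d := b - a; set J := \int[mu]_(x in _) f x; pose m := d^-1 * J.
have d0 : 0 < d by rewrite subr_gt0.
have JE : J = d * m by rewrite /m mulVKf// gt_eqF.
have cf2 : continuous (fun x => f x ^+ 2).
  by move=> x; exact: (cvgM (cf x) (cf x)).
have cst_c (z : R) : continuous (cst z : R -> R) by exact: cst_continuous.
have cl : continuous (fun x => 2 * m * f x).
  by move=> x; apply: cvgM; [exact: cvg_cst|exact: cf].
have i1 := @continuous_integrable_itv _ a b cf2.
have i2 := @continuous_integrable_itv _ a b cl.
have i3 := @continuous_integrable_itv _ a b (cst_c (m ^+ 2)).
have i0 := @continuous_integrable_itv _ a b cf.
have i12 : mu.-integrable `[a, b] (EFin \o (fun x => f x ^+ 2 - 2 * m * f x)).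
  by apply: continuous_integrable_itv => x; apply: (@cvgB _ R^o); [exact: cf2|exact: cl].
have : 0 <= \int[mu]_(x in `[a, b]) (f x ^+ 2 - 2 * m * f x + m ^+ 2).
  apply: Rintegral_ge0 => x _.
  have -> : f x ^+ 2 - 2 * m * f x + m ^+ 2 = (f x - m) ^+ 2 by ring.
  exact: sqr_ge0.
rewrite RintegralD// RintegralB// RintegralZl// Rintegral_itv_cst// -/J -/d => h.
rewrite -/m -(ler_pM2l d0) mulVKf ?gt_eqF//.
by move: h; rewrite JE; lra.
Qed.

Lemma mean_close f (a b c e : R) : a < b -> continuous f ->
  (forall x, a <= x -> x <= b -> `|f x - c| <= e) ->
  `|(b - a)^-1 * (\int[mu]_(x in `[a, b]) f x) - c| <= e.
Proof.
move=> ab cf fc; have d0 : 0 < b - a by rewrite subr_gt0.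
have cst_c (z : R) : continuous (cst z : R -> R) by exact: cst_continuous.
have i0 := @continuous_integrable_itv _ a b cf.
have fab x : `[a, b]%classic x -> c - e <= f x /\ f x <= c + e.
  rewrite /= in_itv/= => /andP[ax xb]; have := fc x ax xb.
  by rewrite ler_distl => /andP[].
have h1 := @le_Rintegral _ _ _ mu `[a, b]%classic (fun=> c - e) f (measurable_itv _)
  (@continuous_integrable_itv _ a b (cst_c (c - e))) i0 (fun x h => (fab x h).1).
have h2 := @le_Rintegral _ _ _ mu `[a, b]%classic f (fun=> c + e) (measurable_itv _)
  i0 (@continuous_integrable_itv _ a b (cst_c (c + e))) (fun x h => (fab x h).2).
rewrite !Rintegral_itv_cst// in h1 h2.
by rewrite ler_distl mulrC ler_pdivlMr// ler_pdivrMr// h1 h2.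
Qed.

End MeanValue.

Section GaussKernel1.
Variables (R : realType) (X Y : Type) (gamma : X -> X -> R) (h : Y -> X) (l : Y -> R).
Hypothesis cnd : cond_negative_definite gamma.
Hypothesis gamma_gt0 : forall u v, 0 < gamma u v.
Notation mu := (@lebesgue_measure R).
Implicit Types (p q : Y) (x : R) (s : seq (Y * R[i])).

(* By [gauss_fourier], [gauss1] is [(4 pi)^(-1/2)] times the integral of [wave_kernel x] over [x].
   The integrand at [x <> 0] dominates [wave b w r x]. *)
Definition gauss1 p q : R :=
  (Num.sqrt (gamma (h p) (h q)))^-1 * expR (- ((l p - l q) ^+ 2 / gamma (h p) (h q))).

Definition wave_kernel x p q : R :=
  cos ((l p - l q) * x) * gs (gamma (h p) (h q) / 4) x.

(** Real waves keep all frequency integrals real; [cwave] recombines sine and cosine later. *)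
Definition trig (b : bool) x : R := if b then sin x else cos x.

Definition wave b w (r : seq X) x p : R :=
  trig b (l p * x) * (expR (- (x ^+ 2 / 4 * gamma (h p) w)) * mono gamma w r (h p)).

Lemma continuous_trig b : continuous (trig b).
Proof. by case: b; [exact: continuous_sin|exact: continuous_cos]. Qed.

Lemma integral_wave_kernel p q : mu.-integrable setT (EFin \o (wave_kernel ^~ p ^~ q)) /\
  \int[mu]_x wave_kernel x p q = Num.sqrt (4 * pi) * gauss1 p q.
Proof.
have g0 : 0 < gamma (h p) (h q) / 4 by rewrite divr_gt0.
split; first exact: integrable_cos_gs.
rewrite gauss_fourier// /gauss1 [RHS]mulrA; congr (_ * expR _).
  rewrite -sqrtrV ?(ltW (gamma_gt0 _ _))// -sqrtrM ?mulr_ge0 ?pi_ge0//; congr Num.sqrt.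
  by field; rewrite gt_eqF.
by field; rewrite gt_eqF.
Qed.

Lemma rfm_rank1_eq (f : Y -> R) s :
  rfm (fun p q => f p * f q) s = sqc (ev (fun p => (f p)%:C) s).
Proof.
apply: complexI; rewrite sqcE -sform_rank1 -sform_rk; last by move=> x y; rewrite mulrC.
congr sform; apply/funext => x; apply/funext => y.
by rewrite /rk conjc_real -real_complexM.
Qed.

Lemma pdk_rank1 (f : Y -> R) : pdk (rk (fun p q => f p * f q)).
Proof.
apply: pdk_rk => [x y|s]; first by rewrite mulrC.
by rewrite rfm_rank1_eq sqc_ge0.
Qed.

Lemma cos_kernelE x : (fun p q => cos ((l p - l q) * x)) =
  (fun p q => cos (l p * x) * cos (l q * x) + sin (l p * x) * sin (l q * x)).
Proof.
apply/funext => p; apply/funext => q; rewrite mulrBl cosB; ring.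
Qed.

Lemma pdk_cos_kernel x : pdk (rk (fun p q => cos ((l p - l q) * x))).
Proof.
rewrite cos_kernelE.
have := pdkD (pdk_rank1 (fun p => cos (l p * x))) (pdk_rank1 (fun p => sin (l p * x))).
by congr pdk; apply/funext => p; apply/funext => q; rewrite /rk real_complexD.
Qed.

Lemma dom_trig b x :
  dom (rk (fun p q => cos ((l p - l q) * x))) 1 (fun p => (trig b (l p * x))%:C).
Proof.
move=> s; rewrite mul1r qn_rk cos_kernelE rfmD.
have := rfm_ge0 s (pdk_rank1 (fun p => cos (l p * x))).
have := rfm_ge0 s (pdk_rank1 (fun p => sin (l p * x))).
by rewrite !rfm_rank1_eq; case: b => ? ?; rewrite ?lerDr ?lerDl.
Qed.

Lemma wave_kernelE x : rk (wave_kernel x) = fun p q =>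
  rk (fun p q => cos ((l p - l q) * x)) p q *
  rk (fun u v => expR (- (x ^+ 2 / 4 * gamma u v))) (h p) (h q).
Proof.
apply/funext => p; apply/funext => q; rewrite /rk -real_complexM /wave_kernel /gs.
by congr ((_ * expR _)%:C); field.
Qed.

Lemma pdk_wave_kernel x : pdk (rk (wave_kernel x)).
Proof.
rewrite wave_kernelE; apply: pdkM; first exact: pdk_cos_kernel.
apply: (pdk_pullback h); apply: pdk_exp_gamma => //.
by rewrite divr_ge0// sqr_ge0.
Qed.

Definition wave_bound w (r : seq X) x : R :=
  \prod_(v <- r) kap gamma w v v * (size r)`!%:R / (2 * (x ^+ 2 / 4)) ^+ size r.

Lemma prod_kap_ge0 w r : 0 <= \prod_(v <- r) kap gamma w v v.
Proof. by have [] := dom_mono cnd w r. Qed.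

Lemma wave_bound_ge0 w r x : 0 <= wave_bound w r x.
Proof.
rewrite /wave_bound divr_ge0//; first by rewrite mulr_ge0// prod_kap_ge0.
by rewrite exprn_ge0// mulr_ge0// divr_ge0// sqr_ge0.
Qed.

(** The cosine kernel dominates the trigonometric factor, by the addition formula, and the
    Schoenberg kernel dominates the weighted monomial. Frequency 0 is excluded because [wave_bound]
    divides by a power of [x]. *)
Lemma dom_wave b w r x : x != 0 ->
  dom (rk (wave_kernel x)) (wave_bound w r x) (fun p => (wave b w r x p)%:C).
Proof.
move=> x0; have t0 : 0 < x ^+ 2 / 4 by rewrite divr_gt0// exprn_even_gt0.
have := domM (pdk_cos_kernel x) (pdk_pullback h (pdk_exp_gamma cnd (ltW t0)))
  ler01 (wave_bound_ge0 w r x) (dom_trig b x)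
  (dom_pullback h (dom_exp_mono cnd r t0 (ltW (gamma_gt0 w w)))).
rewrite -wave_kernelE mul1r; congr dom; apply/funext => p.
by rewrite /wave -real_complexM.
Qed.

Lemma rfm_wave_kernel s : mu.-integrable setT (EFin \o (fun x => rfm (wave_kernel x) s)) /\
  \int[mu]_x rfm (wave_kernel x) s = Num.sqrt (4 * pi) * rfm gauss1 s.
Proof.
have i1 p q := (integral_wave_kernel p q).1.
have i2 (a : Y * R[i]) (b : Y * R[i]) :
    mu.-integrable setT (EFin \o (fun x => complex.Re (a.2 * (b.2)^*%C) * wave_kernel x a.1 b.1)).
  by apply: integrable_scale => //; exact: i1.
have [i3 e3] := integrable_sumr s measurableT
  (fun a => (integrable_sumr s measurableT (i2 a)).1).
split; first exact: i3.
rewrite /rfm e3 mulr_sumr; apply: eq_bigr => a _.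
rewrite (integrable_sumr s measurableT (i2 a)).2 mulr_sumr; apply: eq_bigr => b _.
rewrite RintegralZl//.
by rewrite (integral_wave_kernel _ _).2 mulrCA.
Qed.

Lemma sqrt4pi_gt0 : 0 < Num.sqrt (4 * pi) :> R.
Proof. by rewrite sqrtr_gt0 mulr_gt0// pi_gt0. Qed.

Lemma pdk_gauss1 : pdk (rk gauss1).
Proof.
apply: pdk_rk => [p q|s].
  by rewrite /gauss1 (cnd.1 (h p)) -sqrrN opprB.
rewrite -(pmulr_rge0 _ sqrt4pi_gt0) -(rfm_wave_kernel s).2.
by apply: Rintegral_ge0 => x _; rewrite rfm_ge0//; exact: pdk_wave_kernel.
Qed.

Definition wave_mean b w r (a a' : R) p : R :=
  (a' - a)^-1 * \int[mu]_(x in `[a, a']) wave b w r x p.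

Lemma continuous_wave b w r p : continuous (fun x => wave b w r x p).
Proof.
move=> x; apply: cvgM.
  apply: continuous_comp; last exact: continuous_trig.
  by apply: cvgM; [exact: cvg_cst|exact: cvg_id].
apply: cvgM; last exact: cvg_cst.
apply: continuous_comp; last exact: continuous_expR.
apply: (@cvgN _ R^o); apply: cvgM; last exact: cvg_cst.
by apply: cvgM; [exact: sqr_continuous|exact: cvg_cst].
Qed.

Lemma Re_ev_real (f : Y -> R) s :
  complex.Re (ev (fun p => (f p)%:C) s) = \sum_(p <- s) complex.Re p.2 * f p.1.
Proof. by rewrite /ev Re_sum; apply: eq_bigr => p _; rewrite Re_mulr_real. Qed.

Lemma Im_ev_real (f : Y -> R) s :
  complex.Im (ev (fun p => (f p)%:C) s) = \sum_(p <- s) complex.Im p.2 * f p.1.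
Proof.
rewrite /ev; elim: s => [|p s IH]; first by rewrite !big_nil.
rewrite !big_cons -IH; case: (\sum_(j <- s) _) => c d; case: p.2 => a b /=.
by rewrite mulr0 add0r.
Qed.

(* A single frequency has measure zero, so only averages of waves over an interval lie in the
   space of [gauss1]; shrinking the interval puts the waves in its uniform closure. *)
Lemma dom_wave_mean b w r (a a' : R) : 0 < a -> a < a' ->
  exists2 M, 0 <= M & dom (rk gauss1) M (fun p => (wave_mean b w r a a' p)%:C).
Proof.
move=> a0 aa'; set d := a' - a; have d0 : 0 < d by rewrite subr_gt0.
have := wave_bound_ge0 w r a; move e : (wave_bound w r a) => N N0.
(* [N] is the value of [wave_bound] at the left end [a], and bounds it on the interval because it
   does not increase with [x > 0]. The factor [d^-1] comes from Jensen's inequality, [sqrt (4 pi)]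
   from the Fourier transform. *)
pose M := d^-1 * N * Num.sqrt (4 * pi); exists M.
  apply: mulr_ge0 (sqrtr_ge0 _); apply: mulr_ge0 N0.
  by rewrite invr_ge0 ltW.
move=> s; rewrite qn_rk.
have part (c : Y * R[i] -> R) (A := fun x => \sum_(p <- s) c p * wave b w r x p.1) :
    [/\ continuous A, continuous (fun x => A x ^+ 2) &
    (\sum_(p <- s) c p * wave_mean b w r a a' p.1) ^+ 2 <=
    d^-1 * \int[mu]_(x in `[a, a']) A x ^+ 2].
  have cA (p : Y * R[i]) : continuous (fun x => c p * wave b w r x p.1).
    by move=> x; apply: cvgM; [exact: cvg_cst|exact: continuous_wave].
  have cA' : continuous A.
    by move=> x; apply: cvg_big => [|p _]; [exact: add_continuous|exact: cA].
  split=> //; first by move=> x; exact: (cvgM (cA' x) (cA' x)).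
  have -> : \sum_(p <- s) c p * wave_mean b w r a a' p.1 =
      d^-1 * \int[mu]_(x in `[a, a']) A x.
    rewrite /A (integrable_sumr s (measurable_itv _)
      (fun p : Y * R[i] => continuous_integrable_itv a a' (cA p))).2 mulr_sumr.
    apply: eq_bigr => p _; rewrite RintegralZl//; first by rewrite /wave_mean mulrCA.
    exact/continuous_integrable_itv/continuous_wave.
  exact: sqr_mean_le.
have [cA cA2 hA] := part (fun a0 => complex.Re a0.2).
have [cB cB2 hB] := part (fun a0 => complex.Im a0.2).
set A := fun x => _ in cA cA2 hA; set B := fun x => _ in cB cB2 hB.
rewrite /sqc Re_ev_real Im_ev_real; apply: le_trans (lerD hA hB) _.
have iA := continuous_integrable_itv a a' cA2.
have iB := continuous_integrable_itv a a' cB2.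
rewrite -mulrDr -RintegralD// /M -!mulrA ler_pM2l ?invr_gt0//.
have [iK eK] := rfm_wave_kernel s; rewrite -eK.
have iK' : mu.-integrable `[a, a'] (EFin \o (fun x => rfm (wave_kernel x) s)).
  exact: (@integrableS _ _ _ mu setT `[a, a']%classic _ measurableT (measurable_itv _) _ iK).
apply: (@le_trans _ _ (\int[mu]_(x in `[a, a']) (N * rfm (wave_kernel x) s))).
  apply: le_Rintegral => //.
  - have := @integrableD _ _ _ mu _ (measurable_itv _) _ _ iA iB; exact: eq_integrable.
  - exact: integrable_scale.
  move=> x; rewrite /= in_itv/= => /andP[ax xa'].
  have x0 : 0 < x by apply: lt_le_trans ax.
  have := dom_wave b w r (lt0r_neq0 x0) s; rewrite /sqc Re_ev_real Im_ev_real qn_rk.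
  move/le_trans; apply; apply: ler_wpM2r; first by rewrite rfm_ge0//; exact: pdk_wave_kernel.
  rewrite -e /wave_bound ler_wpM2l ?mulr_ge0 ?prod_kap_ge0//.
  have sq2 (y : R) : 0 < y -> 0 < 2 * (y ^+ 2 / 4).
    by move=> y0; rewrite mulr_gt0// divr_gt0// exprn_gt0.
  have ax2 : a ^+ 2 <= x ^+ 2 by rewrite ler_sqr ?nnegrE ?(ltW a0) ?(ltW x0).
  rewrite lef_pV2 ?posrE ?exprn_gt0 ?sq2//.
  by apply: lerXn2r; rewrite ?nnegrE ?(ltW (sq2 _ _))//; lra.
(* The form of [wave_kernel x] is nonnegative, so the integral may be extended from the interval to
   the line. *)
rewrite RintegralZl// ler_wpM2l// [leLHS]Rintegral_mkcond.
apply: le_Rintegral => //.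
  have /integrable_mkcond := iK'; move=> /(_ (measurable_itv _)).
  by rewrite restrict_EFin.
move=> x _; rewrite patchE; case: ifPn => // _.
by rewrite rfm_ge0//; exact: pdk_wave_kernel.
Qed.

End GaussKernel1.

(** * Uniform approximation on compact sets *)

(** The sets [S] with [P] true of [C] minus [S] form a filter containing [C], proper if [P C] fails.
    A cluster point in [C] then contradicts the local hypothesis. *)
Lemma compact_induction (T : topologicalType) (C : set T) (P : set T -> Prop) :
  P set0 -> (forall A B, A `<=` B -> P B -> P A) ->
  (forall A B, P A -> P B -> P (A `|` B)) -> compact C ->
  (forall x, C x -> exists2 U, nbhs x U & P (U `&` C)) -> P C.
Proof.
move=> P0 Psub PU cC loc; apply: contrapT => nPC.
pose F : set_system T := [set S | P (C `\` S)].
have FF : ProperFilter F.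
  split; first by rewrite /F /= setD0.
  split=> [|A B FA FB|A B AB FA]; rewrite /F /=.
  - by rewrite setDT.
  - by rewrite setDIr; exact: PU.
  - by apply: Psub FA => x [Cx nBx]; split => // /AB.
have FC : F C by rewrite /F /= setDv.
have [x [Cx clx]] := cC F FF FC.
have [U Ux PUC] := loc x Cx.
have FU : F (~` U) by rewrite /F /= setDE setCK setIC.
by have [y [nUy Uy]] := clx (~` U) U FU Ux.
Qed.

(** * The Stone-Weierstrass theorem on a compact set *)

Section StoneWeierstrass.
Variables (R : realType) (T : topologicalType) (C : set T).
Hypothesis cC : compact C.
Implicit Types f g h : T -> R.

Definition cont_on f := forall x, C x -> forall e : R, 0 < e ->
  exists2 U, nbhs x U & forall y, U y -> C y -> `|f x - f y| <= e.

Lemma within_cont_on f : {within C, continuous f} -> cont_on f.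
Proof.
move=> /subspace_continuousP cf x Cx e e0.
have /cvgrPdist_le /(_ e e0) := cf x Cx.
by rewrite near_withinE => h; eexists; [exact: h|move=> y; exact].
Qed.

Lemma cont_on_continuous f : continuous f -> cont_on f.
Proof.
move=> cf x Cx e e0; have /cvgrPdist_le /(_ e e0) h := cf x.
by eexists; [exact: h|].
Qed.

Lemma cont_on_op (op : R -> R -> R) f g :
  (forall a b c d, `|op a b - op c d| <= `|a - c| + `|b - d|) ->
  cont_on f -> cont_on g -> cont_on (fun x => op (f x) (g x)).
Proof.
move=> opL cf cg x Cx e e0; have e20 : 0 < e / 2 by rewrite divr_gt0.
have [U Ux hU] := cf x Cx _ e20; have [V Vx hV] := cg x Cx _ e20.
exists (U `&` V); first exact: filterI.
move=> y [Uy Vy] Cy; apply: le_trans (opL _ _ _ _) _.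
by have := hU y Uy Cy; have := hV y Vy Cy; lra.
Qed.

Lemma cont_on_sub f g : cont_on f -> cont_on g -> cont_on (fun x => f x - g x).
Proof.
apply: (@cont_on_op (fun a b => a - b)) => a b c d.
have -> : a - b - (c - d) = (a - c) - (b - d) by ring.
exact: ler_normB.
Qed.

Lemma cont_on_bounded f : cont_on f -> exists2 B : R, 0 < B & forall x, C x -> `|f x| <= B.
Proof.
move=> cf; pose P := [set D : set T | exists2 B : R, 0 < B & forall x, D x -> C x -> `|f x| <= B].
suff [B B0 hB] : P C by exists B => // x Cx; exact: hB.
apply: compact_induction => //.
- by exists 1.
- by move=> A B AB [b b0 hb]; exists b => // x /AB; exact: hb.
- move=> A B [a a0 ha] [b b0 hb]; exists (a + b); first exact: addr_gt0.
  by move=> x [/ha h /h|/hb h /h] => [k|k]; rewrite (le_trans k)// ?lerDl ?lerDr ltW.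
move=> x Cx; have [U Ux hU] := cf x Cx 1 ltr01; exists U => //.
exists (`|f x| + 1); first by rewrite ltr_wpDl.
move=> y [Uy _] Cy; have -> : f y = f x - (f x - f y) by ring.
by rewrite (le_trans (ler_normB _ _))// lerD2l hU.
Qed.

Variable A : set (T -> R).
Hypothesis A_cst : forall c, A (fun=> c).
Hypothesis A_add : forall f g, A f -> A g -> A (fun x => f x + g x).
Hypothesis A_mul : forall f g, A f -> A g -> A (fun x => f x * g x).
Hypothesis A_closed : forall f,
  (forall e : R, 0 < e -> exists2 g, A g & forall x, C x -> `|f x - g x| <= e) -> A f.

Lemma A_scale c f : A f -> A (fun x => c * f x).
Proof. by move=> Af; apply: A_mul => //; exact: A_cst. Qed.

Lemma A_sub f g : A f -> A g -> A (fun x => f x - g x).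
Proof.
move=> Af Ag; have := A_add Af (A_scale (-1) Ag).
by congr A; apply/funext => x; rewrite mulN1r.
Qed.

(** The classical recursion for [sqrt (f ^ 2)]: polynomials in [f] that increase to the absolute
    value where [|f| <= 1]. *)
Fixpoint sqrt_approx f n : T -> R := if n is m.+1 then
  fun x => sqrt_approx f m x + 2^-1 * (f x * f x - sqrt_approx f m x * sqrt_approx f m x)
  else fun=> 0.

Lemma A_sqrt_approx f n : A f -> A (sqrt_approx f n).
Proof.
move=> Af; elim: n => [|n IH] /=; first exact: A_cst.
by apply: A_add => //; apply: A_scale; apply: A_sub; exact: A_mul.
Qed.

(* The error [d] after [n] steps satisfies [d (1 + n |f| / 2) <= |f|]. *)
Lemma sqrt_approxP f n x : `|f x| <= 1 ->
  [/\ 0 <= sqrt_approx f n x, sqrt_approx f n x <= `|f x| &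
      (`|f x| - sqrt_approx f n x) * (1 + n%:R * `|f x| / 2) <= `|f x|].
Proof.
move=> f1; have f2 : f x * f x = `|f x| * `|f x| by rewrite -normrM ger0_norm// -expr2 sqr_ge0.
have f0 := normr_ge0 (f x).
elim: n => [|n [p0 pf IH]] /=; first by split=> //; rewrite subr0 !mul0r addr0 mulr1.
rewrite f2; move: (sqrt_approx f n x) (`|f x|) f0 f1 p0 pf IH => p a a0 a1 p0 pa IH {f2}.
have n0 : 0 <= n%:R :> R by [].
split.
- by nra.
- by nra.
rewrite -[n.+1%:R]natr1; move: (n%:R) n0 IH => m m0 IH.
have d0 : 0 <= a - p by rewrite subr_ge0.
(* One step of the recursion multiplies the error [a - p] by [1 - (a + p) / 2]. *)
have h1 : (1 - (a + p) / 2) * (1 + (m + 1) * a / 2) <= 1 + m * a / 2.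
  have : 0 <= p / 2 * (1 + (m + 1) * a / 2) by rewrite mulr_ge0 ?divr_ge0// addr_ge0// divr_ge0// mulr_ge0// addr_ge0.
  have : 0 <= m * (a * a) by rewrite !mulr_ge0.
  nra.
have := ler_wpM2l d0 h1.
move=> h2; apply: le_trans IH; apply: le_trans h2.
by rewrite le_eqVlt; apply/orP; left; apply/eqP; field.
Qed.

Lemma A_abs f : cont_on f -> A f -> A (fun x => `|f x|).
Proof.
move=> cf Af; have [B B0 hB] := cont_on_bounded cf.
pose g x := B^-1 * f x.
have g1 x : C x -> `|g x| <= 1.
  by move=> Cx; rewrite normrM gtr0_norm ?invr_gt0// ler_pdivrMl// mulr1 hB.
suff Ag : A (fun x => `|g x|).
  have := A_scale B Ag; congr A; apply/funext => x.
  by rewrite normrM gtr0_norm ?invr_gt0// mulVKf// gt_eqF.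
(* [n > 2 / e], since [sqrt_approxP] leaves an error of at most [2 / n]. *)
apply: A_closed => e e0; pose n := (Num.truncn (2 / e)).+1.
exists (sqrt_approx g n); first by apply: A_sqrt_approx; exact: A_scale.
move=> x /g1 gx; have [p0 pg] := sqrt_approxP n gx.
have a0 : 0 <= `|g x| by exact: normr_ge0.
move: (sqrt_approx g n x) (`|g x|) p0 pg a0 {gx} => p a p0 pg a0.
rewrite [`|a - p|]ger0_norm ?subr_ge0//; set d := a - p.
have d0 : 0 <= d by rewrite subr_ge0.
have n0 : 0 < n%:R :> R by rewrite ltr0n.
have ne : 2 / e < n%:R by exact: truncnS_gt.
have {ne} ne : 2 < n%:R * e by rewrite -ltr_pdivrMr.
have da : d <= a by rewrite lerBlDr lerDl.
move: (n%:R) n0 ne => m m0 me h.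
rewrite leNgt; apply/negP => ed.
have a_gt0 : 0 < a by apply: lt_le_trans da; apply: lt_trans ed.
have : 1 < m * d / 2.
  rewrite ltr_pdivlMr// mul1r; apply: lt_trans me _; by rewrite ltr_pM2l.
move=> k.
have : a < a * (m * d / 2) by rewrite ltr_pMr.
have -> : a * (m * d / 2) = d * (m * a / 2) by field.
by nra.
Qed.

Lemma A_max f g : cont_on f -> cont_on g -> A f -> A g -> A (fun x => Num.max (f x) (g x)).
Proof.
move=> cf cg Af Ag.
have cfg := cont_on_sub cf cg.
have := A_scale 2^-1 (A_add (A_add Af Ag) (A_abs cfg (A_sub Af Ag))).
by congr A; apply/funext => x; rewrite maxr_absE mulrC.
Qed.

Lemma A_min f g : cont_on f -> cont_on g -> A f -> A g -> A (fun x => Num.min (f x) (g x)).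
Proof.
move=> cf cg Af Ag.
have cfg := cont_on_sub cf cg.
have := A_scale 2^-1 (A_sub (A_add Af Ag) (A_abs cfg (A_sub Af Ag))).
by congr A; apply/funext => x; rewrite minr_absE mulrC.
Qed.

Lemma maxr_lipschitz (a b c d : R) :
  `|Num.max a b - Num.max c d| <= `|a - c| + `|b - d|.
Proof.
have key (x y z t s : R) : x <= z + s -> y <= t + s -> Num.max x y <= Num.max z t + s.
  move=> xz yt; rewrite ge_max; apply/andP; split.
    by rewrite (le_trans xz)// lerD2r le_max lexx.
  by rewrite (le_trans yt)// lerD2r le_max lexx orbT.
have := ler_norm (a - c); have := ler_norm (b - d).
have := ler_norm (c - a); have := ler_norm (d - b).
have := normr_ge0 (a - c); have := normr_ge0 (b - d).
rewrite (distrC c) (distrC d) => *.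
by rewrite ler_distl lerBlDr !key//; lra.
Qed.

Lemma cont_on_max f g : cont_on f -> cont_on g -> cont_on (fun x => Num.max (f x) (g x)).
Proof. exact: (@cont_on_op Num.max f g maxr_lipschitz). Qed.

Lemma cont_on_min f g : cont_on f -> cont_on g -> cont_on (fun x => Num.min (f x) (g x)).
Proof.
apply: (@cont_on_op Num.min) => a b c d.
have mE (x y : R) : Num.min x y = - Num.max (- x) (- y) by rewrite oppr_max !opprK.
rewrite !mE -opprD normrN; apply: le_trans (maxr_lipschitz _ _ _ _) _.
by rewrite -!opprD !normrN.
Qed.

Hypothesis A_sep : forall x y, C x -> C y -> x <> y ->
  exists f, [/\ A f, continuous f & f x <> f y].

Lemma interpolate2 g x y : C x -> C y -> exists h,
  [/\ A h, cont_on h, h x = g x & h y = g y].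
Proof.
move=> Cx Cy; have [->|xy] := pselect (x = y).
  exists (fun=> g y); split=> //; apply: cont_on_continuous; exact: cst_continuous.
have [f [Af cf fxy]] := A_sep Cx Cy xy.
have fxy0 : f y - f x != 0 by rewrite subr_eq0; apply/eqP => e; apply: fxy.
pose c := (g y - g x) / (f y - f x).
exists (fun z => (g x - c * f x) + c * f z); split.
- by apply: A_add => //; exact: A_scale.
- apply: cont_on_continuous => z; apply: cvgD; first exact: cvg_cst.
  by apply: cvgM; [exact: cvg_cst|exact: cf].
- by rewrite subrK.
- by rewrite /c; field.
Qed.

(** Interpolating [g] at [x] and [y] gives a function above [g - e] near [y]. By compactness a
    finite maximum suffices, and it keeps the value at [x]. *)
Lemma approx_above g (e : R) x : cont_on g -> 0 < e -> C x -> exists k,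
  [/\ A k, cont_on k, k x = g x & forall y, C y -> g y - e <= k y].
Proof.
move=> cg e0 Cx; pose P := [set D : set T | exists k,
  [/\ A k, cont_on k, k x = g x & forall y, D y -> C y -> g y - e <= k y]].
suff [k [Ak ck kx hk]] : P C by exists k; split=> // y Cy; exact: hk.
apply: compact_induction => //.
- by exists (fun=> g x); split=> //; apply: cont_on_continuous; exact: cst_continuous.
- by move=> D E DE [k [Ak ck kx hk]]; exists k; split=> // y /DE; exact: hk.
- move=> D E [k [Ak ck kx hk]] [l [Al cl lx hl]].
  exists (fun y => Num.max (k y) (l y)); split.
  + exact: A_max.
  + exact: cont_on_max.
  + by rewrite kx lx maxxx.
  + by move=> y [Dy|Ey] Cy; rewrite le_max; [rewrite hk|rewrite orbC hl].
move=> y Cy; have [h [Ah ch hx hy]] := interpolate2 g Cx Cy.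
have e20 : 0 < e / 2 by rewrite divr_gt0.
have [U Uy hU] := ch y Cy _ e20; have [V Vy hV] := cg y Cy _ e20.
exists (U `&` V); first exact: filterI.
exists h; split=> // z [[Uz Vz] _] Cz.
have := hU z Uz Cz; have := hV z Vz Cz; rewrite hy !ler_distl.
by move=> /andP[? ?] /andP[? ?]; lra.
Qed.

(** The functions of [approx_above] stay below [g + e] near their base point [x]; a finite minimum
    of them is uniformly close to [g]. *)
Lemma stone_weierstrass g : {within C, continuous g} -> A g.
Proof.
move=> /within_cont_on cg; apply: A_closed => e e0.
pose P := [set D : set T | exists k, [/\ A k, cont_on k,
  forall y, C y -> g y - e <= k y & forall y, D y -> C y -> k y <= g y + e]].
suff [k [Ak ck k1 k2]] : P C.
  by exists k => // y Cy; rewrite distrC ler_distl k1//= k2.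
apply: compact_induction => //.
- have [B B0 hB] := cont_on_bounded cg; exists (fun=> B); split=> //.
    by apply: cont_on_continuous; exact: cst_continuous.
  by move=> y /hB; rewrite ler_norml => /andP[? ?]; lra.
- by move=> D E DE [k [Ak ck k1 k2]]; exists k; split=> // y /DE; exact: k2.
- move=> D E [k [Ak ck k1 k2]] [l [Al cl l1 l2]].
  exists (fun y => Num.min (k y) (l y)); split.
  + exact: A_min.
  + exact: cont_on_min.
  + by move=> y Cy; rewrite le_min k1// l1.
  + by move=> y [Dy|Ey] Cy; rewrite ge_min; [rewrite k2|rewrite orbC l2].
move=> x Cx; have [k [Ak ck kx k1]] := approx_above cg e0 Cx.
have e20 : 0 < e / 2 by rewrite divr_gt0.
have [U Uy hU] := ck x Cx _ e20; have [V Vy hV] := cg x Cx _ e20.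
exists (U `&` V); first exact: filterI.
exists k; split=> // z [[Uz Vz] _] Cz.
have := hU z Uz Cz; have := hV z Vz Cz; rewrite kx !ler_distl.
by move=> /andP[? ?] /andP[? ?]; lra.
Qed.

End StoneWeierstrass.

Section ComplexContinuity.
Variables (R : realType) (T : Type) (FF : set_system T).
Hypothesis FFil : Filter FF.
Implicit Types (f g : T -> R[i]) (z : R[i]).

Lemma norm_le_sqc (z : R[i]) (e : R) : 0 <= e -> (`|z| <= e%:C) = (sqc z <= e ^+ 2).
Proof.
move=> e0; rewrite normc_def lecR -(@ler_sqr R) ?nnegrE ?sqrtr_ge0//.
by rewrite sqr_sqrtr ?sqc_ge0.
Qed.

Lemma cvgC_sqc f z : (f x : R[i]^o) @[x --> FF] --> (z : R[i]^o) <->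
  forall e : R, 0 < e -> \forall x \near FF, sqc (z - f x) <= e.
Proof.
split=> [/cvgrPdist_le cf e e0|h].
  have se0 : 0 < Num.sqrt e by rewrite sqrtr_gt0.
  have := cf (Num.sqrt e)%:C; rewrite ltcR => /(_ se0).
  apply: filterS => x; by rewrite (norm_le_sqc _ (ltW se0)) (sqr_sqrtr (ltW e0)).
apply/cvgrPdist_le => -[e ei]; rewrite ltcE/= => /andP[/eqP-> e0].
have := h (e ^+ 2) (exprn_gt0 _ e0); apply: filterS => x.
by rewrite -(norm_le_sqc _ (ltW e0)) complexr0.
Qed.

Lemma cvgC_parts f z : (f x : R[i]^o) @[x --> FF] --> (z : R[i]^o) <->
  complex.Re (f x) @[x --> FF] --> complex.Re z /\ complex.Im (f x) @[x --> FF] --> complex.Im z.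
Proof.
rewrite cvgC_sqc; split=> [h|[/cvgrPdist_le h1 /cvgrPdist_le h2] e e0].
  split; apply/cvgrPdist_le => e e0; apply: filterS (h (e ^+ 2) (exprn_gt0 _ e0)) => x hx.
    apply: norm_le_of_sqr (ltW e0) _; apply: le_trans hx.
    by have := Re_le_sqc (z - f x); case: (z) => a b; case: (f x).
  apply: norm_le_of_sqr (ltW e0) _; apply: le_trans hx.
  by have := Im_le_sqc (z - f x); case: (z) => a b; case: (f x).
have e20 : 0 < e / 2 by rewrite divr_gt0.
have s0 : 0 < Num.sqrt (e / 2) by rewrite sqrtr_gt0.
have := h1 _ s0; apply: filterS2 (h2 _ s0) => x /sqr_le_of_norm + /sqr_le_of_norm.
rewrite !sqr_sqrtr ?(ltW e20)//; rewrite /sqc; case: (z) => a b; case: (f x) => c d /=.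
by lra.
Qed.

Lemma cvg_real_complex (f : T -> R) (a : R) : f x @[x --> FF] --> a ->
  ((f x)%:C : R[i]^o) @[x --> FF] --> (a%:C : R[i]^o).
Proof. by move=> fa; apply/cvgC_parts; split => //=; exact: cvg_cst. Qed.

End ComplexContinuity.

(** * The closed span of a set of generators and the algebra of its multipliers *)

Section Hull.
Variables (R : realType) (Y : topologicalType) (C : set Y).
Hypothesis cC : compact C.
Variable Gen : set (Y -> R[i]).
Hypothesis Gen_cont : forall F, Gen F -> continuous (F : Y -> R[i]^o).
Implicit Types (F G : Y -> R[i]) (b : Y -> R).

(* The uniform closure on [C] of the linear span of [Gen]. *)
Inductive hull : (Y -> R[i]) -> Prop :=
| hull_gen F of Gen F : hull F
| hull_lin a F G of hull F & hull G : hull (fun y => a * F y + G y)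
| hull_lim F (Fs : R -> Y -> R[i]) of (forall e, 0 < e -> hull (Fs e)) &
    (forall e, 0 < e -> forall y, C y -> sqc (F y - Fs e y) <= e) : hull F.

Lemma hull_eq F G : hull F -> (forall y, C y -> F y = G y) -> hull G.
Proof.
move=> hF FG; apply: (@hull_lim _ (fun=> F)) => // e e0 y Cy.
by rewrite FG// subrr /sqc/= expr0n/= addr0 ltW.
Qed.

Lemma hull_scale a F : hull F -> hull (fun y => a * F y).
Proof.
move=> hF; apply: hull_eq (hull_lin (a - 1) hF hF) _ => y _; ring.
Qed.

Lemma hull_add F G : hull F -> hull G -> hull (fun y => F y + G y).
Proof. by move=> hF hG; apply: hull_eq (hull_lin 1 hF hG) _ => y _; rewrite mul1r. Qed.

(** [hull_lim] wants a family of approximants indexed by the tolerance; choice provides it. *)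
Lemma hull_approx F : (forall e, 0 < e -> exists2 G, hull G &
    forall y, C y -> sqc (F y - G y) <= e) -> hull F.
Proof.
move=> h; have /choice[Fs hFs] : forall e : R, exists G, 0 < e ->
    hull G /\ forall y, C y -> sqc (F y - G y) <= e.
  move=> e; have [e0|e0] := ltP 0 e; last by exists (fun=> 0).
  by have [G hG h'] := h e e0; exists G.
by apply: (@hull_lim _ Fs) => e e0; have [] := hFs e e0.
Qed.

Lemma Gen_bounded F : continuous (F : Y -> R[i]^o) -> exists2 B : R, 0 < B & forall y, C y -> sqc (F y) <= B.
Proof.
move=> cF; have cR : continuous (fun y => complex.Re (F y)) by move=> y; have /cvgC_parts[] := cF y.
have cI : continuous (fun y => complex.Im (F y)) by move=> y; have /cvgC_parts[] := cF y.
have [B1 B10 h1] := cont_on_bounded cC (cont_on_continuous (C := C) cR).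
have [B2 B20 h2] := cont_on_bounded cC (cont_on_continuous (C := C) cI).
exists (B1 ^+ 2 + B2 ^+ 2); first by rewrite addr_gt0// exprn_gt0.
by move=> y Cy; rewrite /sqc lerD// sqr_le_of_norm ?h1 ?h2.
Qed.

Lemma hull_bounded F : hull F -> exists2 B : R, 0 < B & forall y, C y -> sqc (F y) <= B.
Proof.
elim=> {F} [F /Gen_cont|a F G _ [B B0 hB] _ [D D0 hD]|F Fs _ IH h].
- exact: Gen_bounded.
- exists (2 * (sqc a * B) + 2 * D).
    by rewrite ltr_wpDl ?mulr_gt0// !mulr_ge0 ?sqc_ge0// ltW.
  move=> y Cy; apply: le_trans (sqcD _ _) _; rewrite sqcM.
  by have := hD y Cy; have := ler_wpM2l (sqc_ge0 a) (hB y Cy); lra.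
have [B B0 hB] := IH 1 ltr01; exists (2 * 1 + 2 * B); first by rewrite addr_gt0// mulr_gt0.
move=> y Cy; have -> : F y = (F y - Fs 1 y) + Fs 1 y by rewrite subrK.
by apply: le_trans (sqcD _ _) _; have := h 1 ltr01 y Cy; have := hB y Cy; lra.
Qed.

(** Real-valued, to fit the real Stone-Weierstrass theorem; complex functions are recovered from
    their parts, the hull being a complex space. *)
Definition mult : set (Y -> R) := [set b | forall F, hull F -> hull (fun y => (b y)%:C * F y)].

(** [b] is bounded on [C], so multiplication by it respects uniform limits, and checking the
    generators is enough. *)
Lemma mult_gen b : continuous b -> (forall F, Gen F -> hull (fun y => (b y)%:C * F y)) -> mult b.
Proof.
move=> cb hb F; have [B B0 bB] := cont_on_bounded cC (cont_on_continuous (C := C) cb).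
elim=> {F} [F /hb//|a F G _ IHF _ IHG|F Fs _ IH h].
  by apply: hull_eq (hull_lin a IHF IHG) _ => y _; ring.
apply: hull_approx => e e0; have B20 : 0 < B ^+ 2 by rewrite exprn_gt0.
have d0 : 0 < e / B ^+ 2 by rewrite divr_gt0.
exists (fun y => (b y)%:C * Fs (e / B ^+ 2) y); first exact: IH.
move=> y Cy; rewrite -mulrBr sqcM.
have -> : sqc (b y)%:C = b y ^+ 2 by rewrite /sqc/= expr0n/= addr0.
apply: (@le_trans _ _ (B ^+ 2 * (e / B ^+ 2))); last by rewrite mulrC divfK// gt_eqF.
by apply: ler_pM; rewrite ?sqr_ge0 ?sqc_ge0// ?h// sqr_le_of_norm// bB.
Qed.

Lemma mult_cst c : mult (fun=> c).
Proof. by move=> F hF; exact: hull_scale. Qed.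

Lemma mult_add b b' : mult b -> mult b' -> mult (fun y => b y + b' y).
Proof.
move=> hb hb' F hF; apply: hull_eq (hull_add (hb F hF) (hb' F hF)) _ => y _.
by rewrite real_complexD mulrDl.
Qed.

Lemma mult_mul b b' : mult b -> mult b' -> mult (fun y => b y * b' y).
Proof.
move=> hb hb' F hF; apply: hull_eq (hb _ (hb' F hF)) _ => y _.
by rewrite real_complexM mulrA.
Qed.

Lemma mult_closed b : (forall e : R, 0 < e -> exists2 b', mult b' &
    forall y, C y -> `|b y - b' y| <= e) -> mult b.
Proof.
move=> h F hF; have [B B0 hB] := hull_bounded hF.
apply: hull_approx => e e0; have eB0 : 0 < e / B by rewrite divr_gt0.
have s0 : 0 < Num.sqrt (e / B) by rewrite sqrtr_gt0.
have [b' hb' bb'] := h _ s0.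
exists (fun y => (b' y)%:C * F y); first exact: hb'.
move=> y Cy; rewrite -mulrBl -real_complexB sqcM.
have -> : sqc (b y - b' y)%:C = (b y - b' y) ^+ 2 by rewrite /sqc/= expr0n/= addr0.
apply: (@le_trans _ _ (e / B * B)); last by rewrite divfK// gt_eqF.
apply: ler_pM; rewrite ?sqr_ge0 ?sqc_ge0// ?hB//.
by have := sqr_le_of_norm (bb' y Cy); rewrite sqr_sqrtr// ltW.
Qed.

(** Stone-Weierstrass on the compact image of [C]. It applies before the multipliers are known to
    separate the points of [Y]: for functions that factor through [h], separation in [X] is
    enough. *)
Lemma mult_comp (X : topologicalType) (h : Y -> X) : continuous h ->
  (forall u v, u <> v -> exists f : X -> R,
     [/\ mult (f \o h), continuous f & f u <> f v]) ->
  forall f : X -> R, continuous f -> mult (f \o h).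
Proof.
move=> ch sep f cf.
have ci : compact (h @` C) by apply: continuous_compact => //; exact: continuous_subspaceT.
apply: (@stone_weierstrass R X (h @` C) ci [set f : X -> R | mult (f \o h)]) => /=.
- by move=> c; exact: mult_cst.
- by move=> b b' hb hb'; exact: mult_add hb hb'.
- by move=> b b' hb hb'; exact: mult_mul hb hb'.
- move=> b hb; apply: mult_closed => e e0; have [b' hb' bb'] := hb e e0.
  by exists (b' \o h) => // y Cy; apply: bb'; exists y.
- by move=> u v _ _ uv; have [k [? ? ?]] := sep u v uv; exists k.
- exact: continuous_subspaceT.
Qed.

Hypothesis sep : forall u v, C u -> C v -> u <> v -> exists b,
  [/\ mult b, continuous b & b u <> b v].

Lemma mult_all b : {within C, continuous b} -> mult b.
Proof.
apply: (@stone_weierstrass R Y C cC mult).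
- exact: mult_cst.
- exact: mult_add.
- exact: mult_mul.
- exact: mult_closed.
- exact: sep.
Qed.

Hypothesis Gen_ex : exists F, Gen F.
Hypothesis Gen_neq0 : forall y, C y -> exists2 F, Gen F & F y != 0.

(* [sqc (F y) = F^* F], and the real and imaginary parts of [F] are multipliers. *)
Lemma hull_positive : exists h : Y -> R,
  [/\ continuous h, hull (fun y => (h y)%:C) & forall y, C y -> 0 < h y].
Proof.
pose P := [set D : set Y | exists h : Y -> R, [/\ continuous h, hull (fun y => (h y)%:C),
   (forall y, 0 <= h y) & forall y, D y -> C y -> 0 < h y]].
suff [h [ch hh _ h0]] : P C by exists h; split=> // y Cy; exact: h0.
apply: compact_induction => //.
- have [F GF] := Gen_ex; exists (fun=> 0); split=> //; first exact: cst_continuous.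
  by apply: hull_eq (hull_scale 0 (hull_gen GF)) _ => y _; rewrite mul0r.
- by move=> A B AB [h [ch hh h0 h1]]; exists h; split=> // y /AB; exact: h1.
- move=> A B [h [ch hh h0 h1]] [k [ck hk k0 k1]]; exists (fun y => h y + k y); split.
  + by move=> y; apply: cvgD; [exact: ch|exact: ck].
  + by apply: hull_eq (hull_add hh hk) _ => y _; rewrite real_complexD.
  + by move=> y; rewrite addr_ge0.
  + by move=> y [Ay|By] Cy; [rewrite ltr_wpDr// h1|rewrite ltr_wpDl// k1].
move=> y Cy; have [F GF Fy] := Gen_neq0 Cy; have cF := Gen_cont GF.
have cR : continuous (fun y => complex.Re (F y)) by move=> z; have /cvgC_parts[] := cF z.
have cI : continuous (fun y => complex.Im (F y)) by move=> z; have /cvgC_parts[] := cF z.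
have hR := mult_all (continuous_subspaceT cR) (hull_gen GF).
have hI := mult_all (continuous_subspaceT cI) (hull_gen GF).
have cS : continuous (fun z => sqc (F z)).
  by move=> z; apply: cvgD; [exact: (cvgM (cR z) (cR z))|exact: (cvgM (cI z) (cI z))].
have Fy0 : 0 < sqc (F y).
  rewrite lt_neqAle sqc_ge0 andbT; apply: contra Fy => /eqP e.
  by apply/eqP; apply: sqc_eq0; rewrite -e.
exists [set z | 0 < sqc (F z)].
  exact: (cvgr_gt (sqc (F y)) (cS y) 0 Fy0).
exists (fun z => sqc (F z)); split=> //.
- apply: hull_eq (hull_lin (- 'i%C) hI hR) _ => z _.
  by case: (F z) => a b; apply/eqP; rewrite eq_complex /sqc/=; apply/andP; split; apply/eqP; ring.
- by move=> z; exact: sqc_ge0.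
- by move=> z [].
Qed.

(** [b = (b / h) h] on [C], with [h] positive there and in the hull, and [b / h] continuous on [C],
    hence a multiplier. *)
Lemma hull_all_real b : {within C, continuous b} -> hull (fun y => (b y)%:C).
Proof.
move=> cb; have [h [ch hh h0]] := hull_positive.
have cbh : {within C, continuous (fun y => b y / h y)}.
  apply/subspace_continuousP => y Cy; move/subspace_continuousP : cb => /(_ y Cy) cb.
  apply: cvgM => //; apply: cvgV; first by rewrite gt_eqF// h0.
  exact: cvg_within_filter (ch y).
apply: hull_eq (mult_all cbh hh) _ => y Cy.
by rewrite -real_complexM divfK// gt_eqF// h0.
Qed.

Lemma hull_all (g : Y -> R[i]^o) : {within C, continuous g} -> hull g.
Proof.
move=> /subspace_continuousP cg.
have cR : {within C, continuous (fun y => complex.Re (g y))}.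
  by apply/subspace_continuousP => y Cy; have /cvgC_parts[] := cg y Cy.
have cI : {within C, continuous (fun y => complex.Im (g y))}.
  by apply/subspace_continuousP => y Cy; have /cvgC_parts[] := cg y Cy.
apply: hull_eq (hull_lin 'i%C (hull_all_real cI) (hull_all_real cR)) _ => y _.
by rewrite addrC -complexE.
Qed.

End Hull.

(** * Uniform closures of reproducing kernel Hilbert spaces *)

Section UniformClosure.
Variables (R : realType) (Y : Type) (C : set Y).
Implicit Types (F G : Y -> R[i]) (K L : Y -> Y -> R[i]).

Definition rk_closure K F := forall e : R, 0 < e ->
  exists2 f, rk_space K f & forall y, C y -> sqc (F y - f y) <= e.

(** Makes every function of the space bounded on [C], by [dom_eval]. *)
Definition diag_bounded K := exists2 B : R, 0 < B & forall y, C y -> complex.Re (K y y) <= B.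

Lemma rk_closure_space K F : rk_space K F -> rk_closure K F.
Proof.
by move=> KF e e0; exists F => // y _; rewrite subrr /sqc/= expr0n/= addr0 ltW.
Qed.

Lemma rk_closure_eq K F G : (forall y, C y -> F y = G y) -> rk_closure K F -> rk_closure K G.
Proof. by move=> FG cF e e0; have [f Kf hf] := cF e e0; exists f => // y Cy; rewrite -FG// hf. Qed.

Lemma rk_closure_lim K F : (forall e : R, 0 < e -> exists2 G, rk_closure K G &
  forall y, C y -> sqc (F y - G y) <= e) -> rk_closure K F.
Proof.
move=> h e e0; have e40 : 0 < e / 4 by rewrite divr_gt0.
have [G cG hG] := h _ e40; have [f Kf hf] := cG _ e40; exists f => // y Cy.
have -> : F y - f y = (F y - G y) + (G y - f y) by ring.
by apply: le_trans (sqcD _ _) _; have := hG y Cy; have := hf y Cy; lra.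
Qed.

Lemma rk_closure_lin K a F G : pdk K -> rk_closure K F -> rk_closure K G ->
  rk_closure K (fun y => a * F y + G y).
Proof.
move=> pK cF cG e e0.
have a0 : 0 < sqc a + 1 by rewrite ltr_wpDl// sqc_ge0.
have e40 : 0 < e / 4 by rewrite divr_gt0.
have [f Kf hf] := cF _ (divr_gt0 e40 a0); have [g Kg hg] := cG _ e40.
exists (fun y => a * f y + g y); first exact: rk_space_lin.
move=> y Cy; have -> : a * F y + G y - (a * f y + g y) = a * (F y - f y) + (G y - g y) by ring.
apply: le_trans (sqcD _ _) _; rewrite sqcM.
have := hf y Cy; rewrite ler_pdivlMr// mulrC => h1; have h2 := hg y Cy.
have h3 := sqc_ge0 (F y - f y).
have h4 : sqc a * sqc (F y - f y) <= e / 4.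
  by apply: le_trans h1; rewrite ler_wpM2r// lerDl.
by lra.
Qed.

Lemma rk_space_bounded K F : diag_bounded K -> rk_space K F ->
  exists2 B : R, 0 < B & forall y, C y -> sqc (F y) <= B.
Proof.
move=> [D D0 hD] [M M0 dF]; exists (M * D + 1); first by rewrite ltr_wpDl// mulr_ge0// ltW.
move=> y Cy; apply: le_trans (dom_eval y dF) _.
by rewrite (le_trans (ler_wpM2l M0 (hD y Cy)))// lerDl.
Qed.

Lemma rk_closure_bounded K F : diag_bounded K -> rk_closure K F ->
  exists2 B : R, 0 < B & forall y, C y -> sqc (F y) <= B.
Proof.
move=> bK cF; have [f Kf hf] := cF 1 ltr01; have [B B0 hB] := rk_space_bounded bK Kf.
exists (2 * 1 + 2 * B); first by rewrite addr_gt0// mulr_gt0.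
move=> y Cy; have -> : F y = (F y - f y) + f y by rewrite subrK.
by apply: le_trans (sqcD _ _) _; have := hf y Cy; have := hB y Cy; lra.
Qed.

Lemma rk_spaceM K L F G : pdk K -> pdk L -> rk_space K F -> rk_space L G ->
  rk_space (fun x y => K x y * L x y) (fun y => F y * G y).
Proof.
move=> pK pL [M M0 dF] [N N0 dG]; exists (M * N); first exact: mulr_ge0.
exact: domM.
Qed.

(** [F] is approximated relative to a bound of [G], then [G] relative to a bound of the [f] just
    chosen. *)
Lemma rk_closureM K L F G : pdk K -> pdk L -> diag_bounded K -> diag_bounded L ->
  rk_closure K F -> rk_closure L G ->
  rk_closure (fun x y => K x y * L x y) (fun y => F y * G y).
Proof.
move=> pK pL bK bL cF cG e e0.
have e40 : 0 < e / 4 by rewrite divr_gt0.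
have [B B0 hB] := rk_closure_bounded bL cG.
have [f Kf hf] := cF _ (divr_gt0 e40 B0).
have [D D0 hD] := rk_space_bounded bK Kf.
have [g Lg hg] := cG _ (divr_gt0 e40 D0).
exists (fun y => f y * g y); first exact: rk_spaceM.
move=> y Cy; have -> : F y * G y - f y * g y = (F y - f y) * G y + f y * (G y - g y) by ring.
apply: le_trans (sqcD _ _) _; rewrite !sqcM.
have h1 : sqc (F y - f y) * sqc (G y) <= e / 4 / B * B by rewrite ler_pM ?sqc_ge0 ?hf ?hB.
have h2 : sqc (f y) * sqc (G y - g y) <= D * (e / 4 / D) by rewrite ler_pM ?sqc_ge0 ?hg ?hD.
by move: h1 h2; rewrite divfK ?gt_eqF// mulrC (mulrC D) divfK ?gt_eqF//; lra.
Qed.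

Lemma diag_boundedM K L : pdk K -> pdk L -> diag_bounded K -> diag_bounded L ->
  diag_bounded (fun x y => K x y * L x y).
Proof.
move=> pK pL [B B0 hB] [D D0 hD]; exists (B * D); first exact: mulr_gt0.
move=> y Cy; have := hB y Cy; have := hD y Cy.
have := pdk_diag y pK; have := pdk_diag y pL.
case: (K y y) => a a'; case: (L y y) => b b'; rewrite !lecE/=.
by move=> /andP[/eqP-> b0] /andP[/eqP-> a0] ? ?; rewrite mul0r subr0; apply: ler_pM.
Qed.

Lemma diag_bounded1 : diag_bounded (fun _ _ => 1).
Proof. by exists 1. Qed.

Lemma rk_closure1 : rk_closure (fun _ _ => 1) (fun=> 1).
Proof.
apply: rk_closure_space; exists 1 => // s.
rewrite mul1r /qn (_ : sform _ s s = (sqc (ev (fun=> 1) s))%:C)//.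
rewrite sqcE -sform_rank1; congr sform; apply/funext => x; apply/funext => y.
by rewrite conjc1 mulr1.
Qed.

Lemma rk_closure_prod (I : Type) (r : seq I) (K_ : I -> Y -> Y -> R[i]) (F_ : I -> Y -> R[i]) :
  (forall i, pdk (K_ i)) -> (forall i, diag_bounded (K_ i)) ->
  (forall i, rk_closure (K_ i) (F_ i)) ->
  diag_bounded (fun x y => \prod_(i <- r) K_ i x y) /\
  rk_closure (fun x y => \prod_(i <- r) K_ i x y) (fun y => \prod_(i <- r) F_ i y).
Proof.
move=> pK bK cK; elim: r => [|i r [IH1 IH2]].
  rewrite (_ : (fun x y => _) = fun _ _ => 1); last first.
    by apply/funext => x; apply/funext => y; rewrite big_nil.
  split; first exact: diag_bounded1.
  by apply: rk_closure_eq rk_closure1 => y _; rewrite big_nil.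
rewrite (_ : (fun x y => _) = fun x y => K_ i x y * \prod_(j <- r) K_ j x y); last first.
  by apply/funext => x; apply/funext => y; rewrite big_cons.
have pP := pdk_prod r pK; split; first exact: diag_boundedM.
apply: rk_closure_eq (rk_closureM (pK i) pP (bK i) IH1 (cK i) IH2) => y _.
by rewrite big_cons.
Qed.

End UniformClosure.

(** * Waves as uniform limits of functions in the space of [gauss1] *)

Section Waves.
Variables (R : realType) (X Y : topologicalType) (gamma : X -> X -> R) (h : Y -> X) (l : Y -> R).
Hypothesis cnd : cond_negative_definite gamma.
Hypothesis gamma_gt0 : forall u v, 0 < gamma u v.
Hypothesis gamma_cont : continuous (fun p : X * X => gamma p.1 p.2).
Hypothesis h_cont : continuous h.
Hypothesis l_cont : continuous l.
Variable C : set Y.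
Hypothesis cC : compact C.

Lemma continuous_pair (T U V : topologicalType) (f : T -> U) (g : T -> V) (x : T) :
  {for x, continuous f} -> {for x, continuous g} -> {for x, continuous (fun t => (f t, g t))}.
Proof. by move=> cf cg; apply: cvg_pair. Qed.

Lemma gamma_cont1 v : continuous (fun u => gamma u v).
Proof.
move=> u; apply: (@continuous_comp _ _ _ (fun u => (u, v)) (fun p : X * X => gamma p.1 p.2)).
  by apply: continuous_pair; [exact: cvg_id|exact: cvg_cst].
exact: gamma_cont.
Qed.

Lemma gamma_cont_diag : continuous (fun u => gamma u u).
Proof.
move=> u; apply: (@continuous_comp _ _ _ (fun u => (u, u)) (fun p : X * X => gamma p.1 p.2)).
  by apply: continuous_pair; exact: cvg_id.
exact: gamma_cont.
Qed.

Lemma kap_cont w v : continuous (fun u => kap gamma w u v).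
Proof.
move=> u; apply: cvgM; last exact: cvg_cst.
apply: (@cvgB _ R^o); last exact: cvg_cst.
apply: (@cvgB _ R^o); last exact: gamma_cont1.
by apply: (@cvgD _ R^o); [exact: gamma_cont1|exact: cvg_cst].
Qed.

Lemma mono_cont w r : continuous (mono gamma w r).
Proof.
move=> u; apply: cvg_big => [|v _]; last exact: kap_cont.
exact: mul_continuous.
Qed.

Lemma wave_cont b w r : continuous (fun zy : R * Y => wave gamma h l b w r zy.1 zy.2).
Proof.
move=> [z y]; rewrite /wave; apply: cvgM.
  apply: (@continuous_comp _ _ _ (fun zy : R * Y => l zy.2 * zy.1) (trig b)); last exact: continuous_trig.
  apply: cvgM; last exact: cvg_fst.
  by apply: (@continuous_comp _ _ _ snd l); [exact: cvg_snd|exact: l_cont].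
have ch : {for (z, y), continuous (fun zy : R * Y => h zy.2)}.
  by apply: (@continuous_comp _ _ _ snd h); [exact: cvg_snd|exact: h_cont].
apply: cvgM.
  apply: (@continuous_comp _ _ _ (fun zy : R * Y => - (zy.1 ^+ 2 / 4 * gamma (h zy.2) w)) (@expR R)); last exact: continuous_expR.
  apply: (@cvgN _ R^o); apply: cvgM.
    apply: cvgM; last exact: cvg_cst.
    by apply: (@continuous_comp _ _ _ fst (fun t : R => t ^+ 2)); [exact: cvg_fst|exact: sqr_continuous].
  by apply: (@continuous_comp _ _ _ (fun zy : R * Y => h zy.2) (gamma ^~ w)); last exact: gamma_cont1.
by apply: (@continuous_comp _ _ _ (fun zy : R * Y => h zy.2) (mono gamma w r)); last exact: mono_cont.
Qed.

(** Joint continuity in frequency and point, made uniform over the compact [C]. *)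
Lemma wave_equicont b w r x e : 0 < e -> exists2 d, 0 < d &
  forall z, `|x - z| <= d -> forall y, C y ->
    `|wave gamma h l b w r z y - wave gamma h l b w r x y| <= e.
Proof.
move=> e0.
pose P := [set D : set Y | exists2 d : R, 0 < d & forall z, `|x - z| <= d -> forall y, D y ->
    `|wave gamma h l b w r z y - wave gamma h l b w r x y| <= e].
suff : P C by [].
apply: compact_induction => //.
- by exists 1.
- by move=> A B AB [d d0 hd]; exists d => // z xz y /AB; exact: hd.
- move=> A B [d d0 hd] [d' d'0 hd']; exists (Num.min d d'); first by rewrite lt_min d0.
  by move=> z; rewrite le_min => /andP[z1 z2] y [Ay|By]; [exact: hd|exact: hd'].
move=> y Cy; have e20 : 0 < e / 2 by rewrite divr_gt0.
have /cvgrPdist_le/(_ _ e20) := @wave_cont b w r (x, y).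
move=> [[U V] /= [/nbhs_ballP[d /= d0 dU] Vy] UV].
exists V => //; exists (d / 2); first by rewrite divr_gt0.
move=> z xz y' [Vy' _].
have Uz : U z by apply: dU; rewrite /ball/= (le_lt_trans xz)// ltr_pdivrMr// ltr_pMr// ltr1n.
have Ux : U x by apply: dU; exact: ballxx.
have h1 := UV (z, y') (conj Uz Vy'); have h2 := UV (x, y') (conj Ux Vy').
rewrite /= in h1 h2; move: h1 h2; move: (wave _ _ _ _ _ _ x y) => c h1 h2.
have -> : wave gamma h l b w r z y' - wave gamma h l b w r x y' =
  (c - wave gamma h l b w r x y') - (c - wave gamma h l b w r z y') by ring.
by apply: le_trans (ler_normB _ _) _; lra.
Qed.

Lemma rk_closure_wave_ge0 b w r x : 0 <= x ->
  rk_closure C (rk (gauss1 gamma h l)) (fun p => (wave gamma h l b w r x p)%:C).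
Proof.
move=> x0 e e0; have s0 : 0 < Num.sqrt e by rewrite sqrtr_gt0.
have [d d0 hd] := wave_equicont b w r x s0.
have d20 : 0 < d / 2 by rewrite divr_gt0.
have dd : d / 2 < d by rewrite ltr_pdivrMr// ltr_pMr// ltr1n.
have xd0 : 0 < x + d / 2 by rewrite ltr_wpDl.
have xdd : x + d / 2 < x + d by rewrite ltrD2l.
(* The averaging interval lies strictly to the right of [x], so its left end is positive even for
   [x = 0], as [dom_wave_mean] requires. *)
exists (fun p => (wave_mean gamma h l b w r (x + d / 2) (x + d) p)%:C).
  exact: dom_wave_mean.
move=> y Cy; rewrite -real_complexB.
have -> : sqc (wave gamma h l b w r x y - wave_mean gamma h l b w r (x + d / 2) (x + d) y)%:C =
   (wave gamma h l b w r x y - wave_mean gamma h l b w r (x + d / 2) (x + d) y) ^+ 2.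
  by rewrite /sqc/= expr0n/= addr0.
rewrite -[leRHS](sqr_sqrtr (ltW e0)); apply: sqr_le_of_norm; rewrite distrC.
apply: mean_close => //; first exact: continuous_wave.
move=> z z1 z2; apply: hd => //; rewrite ler_norml; apply/andP; split; lra.
Qed.

Lemma rk_closure_wave b w r x :
  rk_closure C (rk (gauss1 gamma h l)) (fun p => (wave gamma h l b w r x p)%:C).
Proof.
have [x0|x0] := leP 0 x; first exact: rk_closure_wave_ge0.
have := rk_closure_wave_ge0 b w r (x := - x); rewrite oppr_ge0 => /(_ (ltW x0)) cl.
(* Sine is odd and cosine even: [a F + F] is [- F] for [a = -2] and [F] for [a = 0]. *)
have := rk_closure_lin (if b then -2 else 0) (pdk_gauss1 h l cnd gamma_gt0) cl cl.
apply: rk_closure_eq => y _; rewrite /wave sqrrN mulrN /trig; case: b {cl}.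
  rewrite sinN !real_complexM rmorphN; ring.
by rewrite cosN mul0r add0r.
Qed.

Definition cexp (t : R) : R[i] := cos t +i* sin t.

Lemma cexpD s t : cexp (s + t) = cexp s * cexp t.
Proof.
rewrite /cexp cosD sinD; apply/eqP; rewrite eq_complex/=.
by apply/andP; split; apply/eqP; ring.
Qed.

Definition cwave w r x p : R[i] :=
  cexp (l p * x) * (expR (- (x ^+ 2 / 4 * gamma (h p) w)) * mono gamma w r (h p))%:C.

Lemma rk_closure_cwave w r x : rk_closure C (rk (gauss1 gamma h l)) (cwave w r x).
Proof.
have := rk_closure_lin 'i%C (pdk_gauss1 h l cnd gamma_gt0) (rk_closure_wave true w r x) (rk_closure_wave false w r x).
apply: rk_closure_eq => y _; rewrite /wave /cwave /trig /cexp.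
move: (expR _ * mono _ _ _ _) (sin _) (cos _) => a s c.
by apply/eqP; rewrite eq_complex/=; apply/andP; split; apply/eqP; ring.
Qed.

Lemma diag_bounded_gauss1 : diag_bounded C (rk (gauss1 gamma h l)).
Proof.
have cg : continuous (fun y => (Num.sqrt (gamma (h y) (h y)))^-1).
  move=> y; apply: cvgV; first by rewrite gt_eqF// sqrtr_gt0.
  apply: (@continuous_comp _ _ _ (fun y => gamma (h y) (h y)) Num.sqrt).
    by apply: (@continuous_comp _ _ _ h (fun u => gamma u u)); [exact: h_cont|exact: gamma_cont_diag].
  exact: sqrt_continuous.
have [B B0 hB] := cont_on_bounded cC (cont_on_continuous (C := C) cg).
exists B => // y Cy; rewrite /rk/= /gauss1 subrr expr0n/= mul0r oppr0 expR0 mulr1.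
by rewrite (le_trans (ler_norm _))// hB.
Qed.

End Waves.

Lemma normc_sqc (R : realType) (z : R[i]) : ComplexField.Normc.normc z = Num.sqrt (sqc z).
Proof. by case: z. Qed.

Lemma sqc_sum_le (R : realType) (I : Type) (r : seq I) (z : I -> R[i]) :
  sqc (\sum_(i <- r) z i) <= 2 ^+ size r * \sum_(i <- r) sqc (z i).
Proof.
elim: r => [|i r IH]; first by rewrite !big_nil mulr0 /sqc/= expr0n/= addr0.
rewrite !big_cons /= exprS; apply: le_trans (sqcD _ _) _; rewrite [leRHS]mulrDr -!mulrA.
apply: lerD; rewrite ler_pM2l//.
by rewrite ler_peMl ?sqc_ge0// exprn_ege1// ler1n.
Qed.

(** * From uniform density to universality and strict positive definiteness *)

Section RKHSFacts.
Variables (R : realType) (Y : topologicalType) (K : Y -> Y -> R[i]).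
Hypothesis K_cont : continuous (fun p : Y * Y => K p.1 p.2 : R[i]^o).

Lemma kernel_cont1 v : continuous (fun y => K y v : R[i]^o).
Proof.
move=> y; apply: (@continuous_comp _ _ _ (fun u => (u, v)) (fun p : Y * Y => K p.1 p.2 : R[i]^o)).
  by apply: continuous_pair; [exact: cvg_id|exact: cvg_cst].
exact: K_cont.
Qed.

Lemma kernel_cont2 v : continuous (fun y => K v y : R[i]^o).
Proof.
move=> y; apply: (@continuous_comp _ _ _ (fun u => (v, u)) (fun p : Y * Y => K p.1 p.2 : R[i]^o)).
  by apply: continuous_pair; [exact: cvg_cst|exact: cvg_id].
exact: K_cont.
Qed.

Lemma kernel_cont_diag : continuous (fun y => K y y : R[i]^o).
Proof.
move=> y; apply: (@continuous_comp _ _ _ (fun u => (u, u)) (fun p : Y * Y => K p.1 p.2 : R[i]^o)).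
  by apply: continuous_pair; exact: cvg_id.
exact: K_cont.
Qed.

(** Domination tested on [x] with weight 1 and [y] with weight -1 bounds the squared modulus of
    [F x - F y] by [M q y], where [q y] is the squared distance of the kernel sections at [x] and
    [y]. *)
Lemma rk_space_cont F : rk_space K F -> continuous (F : Y -> R[i]^o).
Proof.
move=> [M M0 dF] x; apply/cvgC_sqc => e e0.
pose q y := complex.Re (K x x - K x y - K y x + K y y).
have cq : q y @[y --> x] --> (0 : R).
  have : ((K x x - K x y - K y x + K y y : R[i]^o) @[y --> x] --> (K x x - K x x - K x x + K x x : R[i]^o)).
    apply: cvgD; last exact: kernel_cont_diag.
    apply: cvgB; last exact: kernel_cont1.
    by apply: cvgB; [exact: cvg_cst|exact: kernel_cont2].
  move=> /cvgC_parts[+ _]; rewrite /q.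
  by rewrite (_ : K x x - K x x - K x x + K x x = 0)//; ring.
have M1 : 0 < M + 1 by rewrite ltr_wpDl.
have nq : \forall y \near x, q y < e / (M + 1).
  by apply: (cvgr_lt _ cq); rewrite divr_gt0.
apply: filterS nq => y qy.
have := dF ((x, 1) :: [:: (y, -1)]).
rewrite /ev /qn /sform !big_cons !big_nil/= !addr0 mul1r mulN1r.
have -> : complex.Re (1 * 1^*%C * K x x + 1 * (-1)^*%C * K x y + (-1 * 1^*%C * K y x + -1 * (-1)^*%C * K y y)) = q y.
  by rewrite /q rmorphN !conjc1; congr complex.Re; ring.
move=> /le_trans; apply.
have [q0|q0] := leP (q y) 0; first by rewrite (le_trans (mulr_ge0_le0 M0 q0))// ltW.
move: qy; rewrite ltr_pdivlMr// => qy; apply: le_trans (ltW qy).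
by rewrite mulrC ler_wpM2l ?(ltW q0)// lerDl.
Qed.

(* If [K y y = 0], then [K(., y) = 0] and the reproducing property makes every [F] vanish at [y]. *)
Lemma rkhs_vanish H ip y F : is_rkhs K H ip -> K y y = 0 -> H F -> F y = 0.
Proof.
move=> [hil ker rep _] Ky HF.
have K0 : K^~ y = fun=> 0 by apply: (hilb_ip_definite hil) => //; rewrite rep.
rewrite -(rep F y HF) K0 (hilb_ip_hermitian hil HF (hilb_zero hil)).
have := hilb_ip_linear hil (-1) (hilb_zero hil) (hilb_zero hil) HF.
rewrite (_ : (fun _ => -1 * 0 + 0) = (fun=> 0)); last by apply/funext => z; rewrite mulr0 addr0.
by rewrite mulN1r addNr => ->; rewrite conjc0.
Qed.

(** Otherwise the constant 1 on the compact set [[set y]] could not be approximated within 1/2. *)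
Lemma universal_diag_neq0 y : universal_kernel K -> K y y != 0.
Proof.
move=> [_ [H [ip [HK _ dense]]]]; apply/eqP => Ky.
have e0 : 0 < 2^-1 :> R by rewrite invr_gt0.
have c1 : {within [set y], continuous (fun=> 1 : R[i]^o)}.
  by apply: continuous_subspaceT; exact: cst_continuous.
have [f Hf] := dense [set y] (fun=> 1) 2^-1 (@compact_set1 _ y) c1 e0.
apply/negP; rewrite -leNgt; apply: le_ereal_sup_tmp.
exists (ComplexField.Normc.normc (f y - 1))%:E; first by exists y.
rewrite (rkhs_vanish HK Ky Hf) lee_fin normc_sqc add0r sqcN.
have -> : sqc (1 : R[i]) = 1 by rewrite /sqc/= expr0n/= addr0 expr1n.
by rewrite sqrtr1 invf_le1// ler1n.
Qed.

Lemma universal_of_closure : pdk K ->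
  (forall (C : set Y) (g : Y -> R[i]^o), compact C -> C !=set0 ->
     {within C, continuous g} -> rk_closure C K g) ->
  universal_kernel K.
Proof.
move=> pK dense; split; first exact/pdkP.
exists (rk_space K), (rk_ip K); split.
- exact: rk_is_rkhs.
- exact: rk_space_cont.
(* The supremum over the empty set is [-oo], so any function of the space will do. *)
move=> C g e cC cg e0; have [->|/set0P C0] := eqVneq C set0.
  exists (fun=> 0); first exact: hilb_zero (rkhs_hilbert (rk_is_rkhs pK)).
  by rewrite image_set0 ereal_sup0 ltNyr.
(* Halving makes the bound on the supremum strict; the square is there because [sqc] is a squared
   modulus. *)
have e20 : 0 < (e / 2) ^+ 2 by rewrite exprn_gt0// divr_gt0.
have [f Kf hf] := dense C g cC C0 cg _ e20.
exists f => //; apply: (@le_lt_trans _ _ (e / 2)%:E).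
  apply: ge_ereal_sup => _ [x Cx <-]; rewrite lee_fin normc_sqc.
  rewrite -[leRHS]ger0_norm ?divr_ge0 ?(ltW e0)// -sqrtr_sqr ler_wsqrtr//.
  by have := hf x Cx; rewrite -sqcN opprB.
by rewrite lte_fin ltr_pdivrMr// ltr_pMr// ltr1n.
Qed.

(* A null combination [s] annihilates the whole space; test it against a function with values
   [conj (c mu)] at the finitely many points. *)
Lemma spd_of_closure : hausdorff_space Y -> pdk K ->
  (forall (C : set Y) (g : Y -> R[i]^o), compact C -> C !=set0 ->
     {within C, continuous g} -> rk_closure C K g) ->
  strictly_positive_definite K.
Proof.
move=> hY pK dense; split; first exact/pdkP.
move=> n x c xinj c0 mu.
pose C := [set x i | i in [set: 'I_n]].
have fC : finite_set C by apply: finite_image; exact: finite_finset.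
have cC : compact C by exact: finite_compact.
pose g (y : Y) : R[i]^o := if pselect (exists i, x i = y) is left ex then (c (projT1 (cid ex)))^*%C else 0.
have gx i : g (x i) = (c i)^*%C.
  rewrite /g; case: pselect => [ex|[]]; last by exists i.
  by congr ((c _)^*%C); apply: xinj; exact: projT2 (cid ex).
have cg : {within C, continuous g}.
  apply/subspace_continuousP => y Cy.
  (* The other points of [C] form a finite, hence closed, set, so [y] is isolated in [C] and
     continuity there is automatic. *)
  have clD : closed (C `\ y) by apply: compact_closed => //; apply: finite_compact; exact: finite_setD.
  have nD : nbhs y (~` (C `\ y)).
    by apply: open_nbhs_nbhs; split; [exact: closed_openC|case=> _ /(_ erefl)].
  apply: (@cvg_trans _ ((cst (g y) : Y -> R[i]^o) z @[z --> within C (nbhs y)])); last exact: cvg_cst.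
  apply: near_eq_cvg; rewrite near_withinE; apply: filterS nD => z nz Cz.
  by have [->//|zy] := pselect (z = y); case: nz.
have Cmu : C !=set0 by exists (x mu), mu.
pose s := [seq (x i, c i) | i <- enum 'I_n].
have s0 : qn K s = 0 by rewrite /qn -kernel_formE c0.
have ev_f f : rk_space K f -> ev f s = 0.
  by move=> [M M0 dF]; apply: sqc_eq0; have := dF s; rewrite s0 mulr0.
have evE f : ev f s = \sum_i c i * f (x i) by rewrite /ev big_map big_enum.
pose S := \sum_i sqc (c i).
suff S0 : S = 0.
  apply: sqc_eq0; rewrite -S0 /S (bigD1 mu)//= lerDl.
  by apply: sumr_ge0 => i _; exact: sqc_ge0.
have gS : ev g s = S%:C.
  rewrite evE /S rmorph_sum; apply: eq_bigr => i _.
  by rewrite gx -sqcE.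
apply: complexI; rewrite -gS.
apply: (@sqc_eq0_le _ _ (2 ^+ size (enum 'I_n) * S)) => e e0 e1.
have [f Kf hf] := dense C g cC Cmu cg e e0.
rewrite -[ev g s]subr0 -(ev_f f Kf) -evB evE -big_enum.
apply: le_trans (sqc_sum_le _ _) _; rewrite -mulrA ler_wpM2l ?exprn_ge0//.
rewrite big_enum/= /S mulr_suml; apply: ler_sum => i _.
by rewrite sqcM ler_wpM2l ?sqc_ge0// hf//; exists i.
Qed.

End RKHSFacts.

Lemma hausdorff_prod (T U : topologicalType) :
  hausdorff_space T -> hausdorff_space U -> hausdorff_space (T * U)%type.
Proof.
move=> hT hU [a b] [c d] cl; congr pair.
- apply: hT => P Q Pa Qc.
  have [||[x y] [[Px _] [Qx _]]] := cl (P `*` setT) (Q `*` setT).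
  + by exists (P, setT) => //=; split => //; exact: filterT.
  + by exists (Q, setT) => //=; split => //; exact: filterT.
  by exists x.
- apply: hU => P Q Pa Qc.
  have [||[x y] [[_ Px] [_ Qx]]] := cl (setT `*` P) (setT `*` Q).
  + by exists (setT, P) => //=; split => //; exact: filterT.
  + by exists (setT, Q) => //=; split => //; exact: filterT.
  by exists y.
Qed.

(** * The kernel G *)

Section Main.
Variables (R : realType) (m : nat) (X : topologicalType).
Variables (gamma : X -> X -> R) (A : X -> X -> R[i]).
Hypothesis gamma_gt0 : forall u v, 0 < gamma u v.
Hypothesis gamma_cont : continuous (fun p : X * X => gamma p.1 p.2).
Hypothesis cnd : cond_negative_definite gamma.
Hypothesis A_cont : continuous (fun p : X * X => A p.1 p.2 : R[i]^o).
Hypothesis pC : positive_definite (scaled_kernel m A gamma).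

Notation Y := (X * 'rV[R]_m)%type.
Notation Ck := (scaled_kernel m A gamma).
Notation G := (gauss_kernel (m := m) A gamma).

Definition crd (i : 'I_m) (p : Y) : R := p.2 0 i.

Lemma crd_cont i : continuous (crd i).
Proof.
move=> p; apply: (@continuous_comp _ _ _ snd (fun M : 'rV[R]_m => M 0 i)); first exact: cvg_snd.
exact: coord_continuous.
Qed.

Lemma crd_sub_cont i : continuous (fun p : Y * Y => (p.1.2 - p.2.2) 0 i : R).
Proof.
have -> : (fun p : Y * Y => (p.1.2 - p.2.2) 0 i) = (fun p => crd i p.1 - crd i p.2).
  by apply/funext => q; rewrite !mxE.
move=> p; apply: (@cvgB _ R^o).
  by apply: (@continuous_comp _ _ _ fst (crd i)); [exact: cvg_fst|exact: crd_cont].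
by apply: (@continuous_comp _ _ _ snd (crd i)); [exact: cvg_snd|exact: crd_cont].
Qed.

Lemma powR_half (a : R) : 0 < a -> a `^ (m%:R / 2) = Num.sqrt a ^+ m.
Proof. by move=> a0; rewrite mulrC powRrM powR12_sqrt ?ltW// powR_mulrn// sqrtr_ge0. Qed.

Lemma scaledE u v : Ck u v = A u v * (Num.sqrt (gamma u v) ^+ m)%:C.
Proof. by rewrite /scaled_kernel powR_half. Qed.

(** The [m] factors [gamma^(-1/2)] of the one-dimensional kernels cancel the [gamma^(m/2)] in
    [Ck]. *)
Lemma gauss_kernelE : G = fun p q =>
  Ck p.1 q.1 * \prod_(i <- enum 'I_m) rk (gauss1 gamma fst (crd i)) p q.
Proof.
apply/funext => p; apply/funext => q; rewrite scaledE /gauss_kernel -mulrA; congr (_ * _).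
rewrite big_enum/=; have -> : \prod_(i < m) rk (gauss1 gamma fst (crd i)) p q =
    (\prod_(i < m) gauss1 gamma fst (crd i) p q)%:C by rewrite rmorph_prod.
rewrite -real_complexM; congr (_%:C).
have s0 : 0 < Num.sqrt (gamma p.1 q.1) by rewrite sqrtr_gt0.
have g0 := gamma_gt0 p.1 q.1.
rewrite /gauss1 big_split/= prodr_const card_ord -expR_sum mulrA -exprMn divff ?gt_eqF// expr1n mul1r.
congr expR; rewrite sumrN -mulr_suml; congr (- (_ / _)).
by apply: eq_bigr => i _; rewrite /crd !mxE.
Qed.

Lemma pdk_scaled : pdk Ck. Proof. exact/pdkP. Qed.

Lemma pdk_gauss : pdk G.
Proof.
rewrite gauss_kernelE; apply: pdkM; first exact: (pdk_pullback fst pdk_scaled).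
by apply: pdk_prod => i; exact: pdk_gauss1.
Qed.

Lemma gamma_fst_cont : continuous (fun p : Y * Y => gamma p.1.1 p.2.1).
Proof.
move=> p; apply: (@continuous_comp _ _ _ (fun p : Y * Y => (p.1.1, p.2.1)) (fun p : X * X => gamma p.1 p.2)); last exact: gamma_cont.
apply: continuous_pair.
  by apply: (@continuous_comp _ _ _ fst fst); exact: cvg_fst.
by apply: (@continuous_comp _ _ _ snd fst); [exact: cvg_snd|exact: cvg_fst].
Qed.

Lemma gauss_cont : continuous (fun p : Y * Y => G p.1 p.2 : R[i]^o).
Proof.
move=> p; apply: cvgM.
  apply: (@continuous_comp _ _ _ (fun p : Y * Y => (p.1.1, p.2.1)) (fun p : X * X => A p.1 p.2 : R[i]^o)); last exact: A_cont.
  apply: continuous_pair.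
    by apply: (@continuous_comp _ _ _ fst fst); exact: cvg_fst.
  by apply: (@continuous_comp _ _ _ snd fst); [exact: cvg_snd|exact: cvg_fst].
apply: cvg_real_complex.
apply: (@continuous_comp _ _ _ (fun p : Y * Y => - (sqr_euclid_norm (p.1.2 - p.2.2) / gamma p.1.1 p.2.1)) (@expR R)); last exact: continuous_expR.
apply: (@cvgN _ R^o); apply: cvgM; last by apply: cvgV; [rewrite gt_eqF|exact: gamma_fst_cont].
apply: cvg_big => [|i _]; first exact: add_continuous.
apply: (@continuous_comp _ _ _ (fun p : Y * Y => (p.1.2 - p.2.2) 0 i) (fun t : R => t ^+ 2)).
  exact: crd_sub_cont.
exact: sqr_continuous.
Qed.

Lemma scaled_cont : continuous (fun p : X * X => Ck p.1 p.2 : R[i]^o).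
Proof.
move=> p; rewrite (_ : (fun p : X * X => _) = fun p => A p.1 p.2 * (Num.sqrt (gamma p.1 p.2) ^+ m)%:C); last first.
  by apply/funext => q; rewrite scaledE.
apply: cvgM; first exact: A_cont.
apply: cvg_real_complex.
apply: (@continuous_comp _ _ _ (fun p : X * X => Num.sqrt (gamma p.1 p.2)) (fun x : R => x ^+ m)).
  apply: (@continuous_comp _ _ _ (fun p : X * X => gamma p.1 p.2) Num.sqrt); first exact: gamma_cont.
  exact: sqrt_continuous.
exact: exprn_continuous.
Qed.

Lemma gauss_diag (p : Y) : G p p = A p.1 p.1.
Proof.
rewrite /gauss_kernel subrr /sqr_euclid_norm big1 => [|i _]; last by rewrite mxE expr0n.
by rewrite mul0r oppr0 expR0 mulr1.
Qed.

Lemma A_diag_ge0 u : 0 <= A u u.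
Proof.
have := pdk_diag u pdk_scaled; rewrite scaledE pmulr_lge0//.
by rewrite ltcR exprn_gt0// sqrtr_gt0.
Qed.

Lemma A_diag_gt0 : (forall u, A u u != 0) -> forall u, 0 < A u u.
Proof. by move=> h u; rewrite lt0r h A_diag_ge0. Qed.

(** * Density on a compact set *)

Section Density.
Hypothesis m_gt0 : (0 < m)%N.
Hypothesis A_neq0 : forall u, A u u != 0.
Hypothesis metr : metrizable_kernel gamma.
Variables (C : set Y) (w : X).
Hypothesis cC : compact C.

(** Only the origin [w] is fixed. Varying [v] prevents common zeros, varying [r] gives the
    multipliers [kap], and varying [xi] the frequency shifts. *)
Definition wave_fun (v : X) (r : 'I_m -> seq X) (xi : 'I_m -> R) (p : Y) : R[i] :=
  Ck p.1 v * \prod_(i <- enum 'I_m) cwave gamma fst (crd i) w (r i) (xi i) p.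

Definition waves : set (Y -> R[i]) := [set F | exists v r xi, F = wave_fun v r xi].

Lemma rk_closure_wave_fun v r xi : rk_closure C G (wave_fun v r xi).
Proof.
rewrite gauss_kernelE /wave_fun.
have pg i : pdk (rk (gauss1 gamma fst (crd i))) by exact: pdk_gauss1.
have bg i : diag_bounded C (rk (gauss1 gamma fst (crd i))).
  by apply: diag_bounded_gauss1 => //; move=> p; exact: cvg_fst.
have cg i : rk_closure C (rk (gauss1 gamma fst (crd i))) (cwave gamma fst (crd i) w (r i) (xi i)).
  by apply: rk_closure_cwave => //; [move=> p; exact: cvg_fst|exact: crd_cont].
have [bP cP] := rk_closure_prod (enum 'I_m) pg bg cg.
have pP := pdk_prod (enum 'I_m) pg.
apply: (rk_closureM (pdk_pullback fst pdk_scaled) pP _ bP _ cP).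
  have cd : continuous (fun p : Y => complex.Re (Ck p.1 p.1)).
    move=> p; have : (fun p : Y => Ck p.1 p.1 : R[i]^o) q @[q --> p] --> (Ck p.1 p.1 : R[i]^o).
      apply: (@continuous_comp _ _ _ fst (fun u => Ck u u : R[i]^o)); first exact: cvg_fst.
      exact: kernel_cont_diag scaled_cont _.
    by move=> /cvgC_parts[].
  have [B B0 hB] := cont_on_bounded cC (cont_on_continuous (C := C) cd).
  by exists B => // p Cp; rewrite (le_trans (ler_norm _))// hB.
apply: rk_closure_space; exists (complex.Re (Ck v v)).
  by have := pdk_diag v pdk_scaled; case: (Ck v v) => a b; rewrite lecE/= => /andP[].
exact: (dom_pullback fst (dom_kernel v pdk_scaled)).
Qed.

Lemma rk_closure_hull F : hull C waves F -> rk_closure C G F.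
Proof.
elim=> {F} [F [v [r [xi ->]]]|a F H _ cF _ cH|F Fs _ IH h].
- exact: rk_closure_wave_fun.
- exact: rk_closure_lin pdk_gauss cF cH.
- by apply: rk_closure_lim => e e0; exists (Fs e); [exact: IH|exact: h].
Qed.

Lemma fst_cont : continuous (fst : Y -> X). Proof. by move=> p; exact: cvg_fst. Qed.

Lemma cwave_cont i r x : continuous (cwave gamma fst (crd i) w r x : Y -> R[i]^o).
Proof.
move=> p; apply: cvgM.
  apply/cvgC_parts; split => /=.
    apply: (@continuous_comp _ _ _ (fun p => crd i p * x) cos); last exact: continuous_cos.
    by apply: cvgM; [exact: crd_cont|exact: cvg_cst].
  apply: (@continuous_comp _ _ _ (fun p => crd i p * x) sin); last exact: continuous_sin.
  by apply: cvgM; [exact: crd_cont|exact: cvg_cst].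
apply: cvg_real_complex; apply: cvgM.
  apply: (@continuous_comp _ _ _ (fun p : Y => - (x ^+ 2 / 4 * gamma p.1 w)) (@expR R)); last exact: continuous_expR.
  apply: (@cvgN _ R^o); apply: cvgM; first exact: cvg_cst.
  by apply: (@continuous_comp _ _ _ fst (gamma ^~ w)); [exact: fst_cont|exact: gamma_cont1].
by apply: (@continuous_comp _ _ _ fst (mono gamma w r)); [exact: fst_cont|exact: mono_cont].
Qed.

Lemma waves_cont F : waves F -> continuous (F : Y -> R[i]^o).
Proof.
move=> [v [r [xi ->]]] p; apply: cvgM.
  apply: (@continuous_comp _ _ _ fst (fun u => Ck u v : R[i]^o)); first exact: fst_cont.
  exact: kernel_cont1 scaled_cont v _.
by apply: cvg_big => [|i _]; [exact: mul_continuous|exact: cwave_cont].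
Qed.

Let i0 : 'I_m := Ordinal m_gt0.

Lemma prod_change (f g : 'I_m -> R[i]) i c : (forall j, j != i -> f j = g j) ->
  f i = c * g i -> \prod_(j <- enum 'I_m) f j = c * \prod_(j <- enum 'I_m) g j.
Proof.
move=> fg fi; rewrite !big_enum/= (bigD1 i)//= [in RHS](bigD1 i)//= fi mulrA.
by congr (_ * _); apply: eq_bigr => j ji; exact: fg.
Qed.

Notation multW := (mult C waves).

(** The factor lengthens the monomial of one coordinate of a wave. Any coordinate would do, and
    [m > 0] provides [i0]. *)
Lemma mult_kap v : multW (kap gamma w ^~ v \o fst).
Proof.
apply: mult_gen => // [p|].
  apply: (@continuous_comp _ _ _ fst (kap gamma w ^~ v)); first exact: fst_cont.
  exact: kap_cont.
move=> _ [v' [r [xi ->]]]; apply: hull_gen.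
exists v', (fun i => if i == i0 then v :: r i else r i), xi.
apply/funext => p; rewrite /wave_fun mulrCA; congr (_ * _); apply/esym.
apply: (@prod_change _ _ i0) => [j /negbTE->//|].
rewrite eqxx /cwave /mono big_cons !real_complexM /=; ring.
Qed.

(** Equality at [z = u] and [z = v] would make the squared distance [kap u u + kap v v - 2 kap u v]
    of the embedded points zero. It equals [gamma u v - (gamma u u + gamma v v) / 2], which
    metrizability makes positive. *)
Lemma kap_separates u v : u <> v -> exists z, kap gamma w u z <> kap gamma w v z.
Proof.
move=> uv; apply: contrapT => h.
have e z : kap gamma w u z = kap gamma w v z by apply: contrapT => k; apply: h; exists z.
have := e u; have := e v; have := metr uv; rewrite /kap (cnd.1 v u); lra.
Qed.

Lemma mult_fst (f : X -> R) : continuous f -> multW (f \o fst).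
Proof.
apply: mult_comp => //.
- exact: waves_cont.
- exact: fst_cont.
move=> u v uv; have [z hz] := kap_separates uv.
exists (kap gamma w ^~ z); split=> //; first exact: mult_kap.
exact: kap_cont.
Qed.

(* Shifting the frequency [xi i] by [eta] changes the Gaussian weight by a function of [u]
   alone, which is a multiplier. *)
Lemma hull_cexp i eta F : waves F -> hull C waves (fun p => cexp (crd i p * eta) * F p).
Proof.
move=> [v [r [xi ->]]].
pose xi' j := if j == i then xi j + eta else xi j.
pose s := (xi i + eta) ^+ 2 / 4 - xi i ^+ 2 / 4.
pose f u := expR (s * gamma u w).
have cf : continuous f.
  move=> u; apply: (@continuous_comp _ _ _ (fun u => s * gamma u w) (@expR R)); last exact: continuous_expR.
  by apply: cvgM; [exact: cvg_cst|exact: gamma_cont1].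
have Gw : waves (wave_fun v r xi') by exists v, r, xi'.
apply: hull_eq (mult_fst cf (hull_gen C Gw)) _ => p _.
rewrite /wave_fun mulrCA [RHS]mulrCA; congr (_ * _).
rewrite (@prod_change _ (fun j => cwave gamma fst (crd j) w (r j) (xi j) p) i (cexp (crd i p * eta) * ((f p.1)^-1)%:C)).
- rewrite !mulrA; congr (_ * _); rewrite mulrAC -real_complexM /= divff ?mul1r//.
  by rewrite gt_eqF// expR_gt0.
- by move=> j ji; rewrite /xi' (negbTE ji).
rewrite /xi' eqxx /cwave mulrDr cexpD.
have -> : expR (- ((xi i + eta) ^+ 2 / 4 * gamma p.1 w)) =
    (f p.1)^-1 * expR (- (xi i ^+ 2 / 4 * gamma p.1 w)).
  by rewrite /f -expRN -expRD /s; congr expR; ring.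
by rewrite !real_complexM; ring.
Qed.

(** Multipliers are real, so the shifts by [eta] and [- eta] are combined by Euler's formula for the
    sine. *)
Lemma mult_sin i eta : multW (fun p => sin (crd i p * eta)).
Proof.
apply: mult_gen => // [p|].
  apply: (@continuous_comp _ _ _ (fun p => crd i p * eta) sin); last exact: continuous_sin.
  by apply: cvgM; [exact: crd_cont|exact: cvg_cst].
move=> F wF; have h1 := hull_cexp i eta wF; have h2 := hull_cexp i (- eta) wF.
apply: hull_eq (hull_lin (0 -i* 2^-1) h1 (hull_scale (0 +i* 2^-1) h2)) _ => p _ /=.
rewrite mulrN !mulrA -mulrDl; congr (_ * _); rewrite /cexp sinN cosN.
by apply/eqP; rewrite eq_complex/=; apply/andP; split; apply/eqP; field.
Qed.

Lemma waves_separate p q : C p -> C q -> p <> q -> exists b : Y -> R,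
  [/\ multW b, continuous b & b p <> b q].
Proof.
move=> _ _; case: p q => [u x] [v y] pq; have [uv|uv] := pselect (u = v); last first.
  have [z hz] := kap_separates uv; exists (kap gamma w ^~ z \o fst); split=> //.
    exact: mult_kap.
  by move=> p; apply: (@continuous_comp _ _ _ fst (kap gamma w ^~ z)); [exact: fst_cont|exact: kap_cont].
have [i xyi] : exists i, x 0 i <> y 0 i.
  apply: contrapT => h; apply: pq; rewrite uv; congr pair; apply/rowP => i.
  by apply: contrapT => k; apply: h; exists i.
(* Dividing by [D] brings both coordinates into [[-1, 1]], inside the interval from [- pi / 2] to
   [pi / 2] on which the sine is injective. *)
pose D := `|x 0 i| + `|y 0 i| + 1.
have D0 : 0 < D by rewrite ltr_wpDl// addr_ge0.
exists (fun p => sin (crd i p * D^-1)); split.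
- exact: mult_sin.
- move=> p; apply: (@continuous_comp _ _ _ (fun p => crd i p * D^-1) sin); last exact: continuous_sin.
  by apply: cvgM; [exact: crd_cont|exact: cvg_cst].
rewrite /crd/=.
have bnd (t : R) : `|t| <= D -> t * D^-1 \in `[(- (pi / 2)), (pi / 2)].
  move=> tD; have : `|t * D^-1| <= 1 by rewrite normrM (gtr0_norm (_ : 0 < D^-1)) ?invr_gt0// ler_pdivrMr// mul1r.
  rewrite ler_norml in_itv/= => /andP[t1 t2]; have := pi_ge2 R.
  by move=> p2; apply/andP; split; lra.
have xD : `|x 0 i| <= D by rewrite /D -addrA lerDl addr_ge0.
have yD : `|y 0 i| <= D by rewrite /D addrAC lerDr addr_ge0.
move=> /(sin_inj (bnd _ xD) (bnd _ yD)).
by move/(mulIf (invr_neq0 (lt0r_neq0 D0))).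
Qed.

(** With [v = p.1], empty monomials and zero frequencies, the wave takes at [p] the value
    [Ck p.1 p.1]. *)
Lemma waves_neq0 p : C p -> exists2 F, waves F & F p != 0.
Proof.
move=> _; exists (wave_fun p.1 (fun=> [::]) (fun=> 0)); first by exists p.1, (fun=> [::]), (fun=> 0).
rewrite /wave_fun mulf_neq0//.
  rewrite scaledE mulf_neq0//; apply/eqP => -[] /eqP.
  by rewrite gt_eqF// exprn_gt0// sqrtr_gt0.
rewrite prodf_seq_neq0; apply/allP => i _ /=.
rewrite /cwave mulr0 /cexp cos0 sin0 /mono big_nil expr0n/= !mul0r oppr0 expR0 mulr1.
by rewrite mulf_neq0// eq_complex/= oner_eq0.
Qed.

Lemma gauss_dense (g : Y -> R[i]^o) : {within C, continuous g} -> rk_closure C G g.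
Proof.
move=> cg; apply: rk_closure_hull; apply: hull_all cg => //.
- exact: waves_cont.
- exact: waves_separate.
- by exists (wave_fun w (fun=> [::]) (fun=> 0)), w, (fun=> [::]), (fun=> 0).
- exact: waves_neq0.
Qed.

End Density.
End Main.

Theorem theorem5p1 (R : realType) (m : nat) (X : topologicalType)
    (gamma : X -> X -> R) (A : X -> X -> R[i]) :
  (0 < m)%N ->
  hausdorff_space X ->
  (forall u v, 0 < gamma u v) ->
  continuous (fun p : X * X => gamma p.1 p.2) ->
  cond_negative_definite gamma ->
  continuous (fun p : X * X => A p.1 p.2 : R[i]^o) ->
  positive_definite (scaled_kernel m A gamma) ->
  [/\ positive_definite (gauss_kernel (m:=m) A gamma),
      continuous (fun p : (X * 'rV[R]_m) * (X * 'rV[R]_m) =>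
                    gauss_kernel A gamma p.1 p.2 : R[i]^o) &
      metrizable_kernel gamma ->
        (strictly_positive_definite (gauss_kernel (m:=m) A gamma) <->
           (forall u, 0 < A u u)) /\
        (universal_kernel (gauss_kernel (m:=m) A gamma) <->
           (forall u, 0 < A u u))].
Proof.
move=> m0 hX g0 cg cnd cA pC.
have pG := pdk_gauss g0 cnd pC; have cG := gauss_cont g0 cg cA.
split; [exact/pdkP|exact: cG|move=> metr].
have dense : (forall u, 0 < A u u) ->
    forall (C : set (X * 'rV[R]_m)) (f : X * 'rV[R]_m -> R[i]^o), compact C -> C !=set0 ->
    {within C, continuous f} -> rk_closure C (gauss_kernel A gamma) f.
  (* The origin [w] is the first component of a point of [C], which is why [C] is taken nonempty. *)
  move=> A0 C f cC [p _] cf; apply: (gauss_dense g0 cg cnd cA pC m0 _ metr p.1 cC cf).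
  by move=> u; rewrite gt_eqF.
split; split.
- move=> [_ spd]; apply: (A_diag_gt0 g0 pC) => u; apply/eqP => Au.
  suff /eqP : (1 : R[i]) = 0 by rewrite oner_eq0.
  (* The single point [(u, 0)] with coefficient 1 has the form [A u u]. *)
  apply: (spd 1%N (fun=> (u, 0)) (fun=> 1)) ord0.
    by move=> i j _; rewrite !ord1.
  by rewrite /kernel_form !big_ord1 gauss_diag Au mulr0.
- move=> A0; apply: spd_of_closure (dense A0) => //.
  by apply: hausdorff_prod => //; exact: norm_hausdorff.
- move=> univ; apply: (A_diag_gt0 g0 pC) => u.
  have := @universal_diag_neq0 R (X * 'rV[R]_m)%type _ (u, 0 : 'rV[R]_m) univ.
  by rewrite gauss_diag.
- by move=> A0; apply: universal_of_closure (dense A0) => //; exact: cG.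
Qed.
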